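(* Let $f(s,t)\in \mathscr H$ with $f=\mathscr L(\varphi)$, $\varphi(u)=o(u^\gamma)$ as $u\to 0^+$ for some $\gamma\in\mathbb C$ with $\mathrm{Re}(\gamma)>-1$, let $f^m(s,t)=m^{-s}f(s,mt)$, fix $t_0>0$, and define $\mathbf{a}$ by $a_0=0$, $a_n=f(s-1,t_0+n-1)$, $n\ge1$. If $s\neq 0$, the series corresponding to $\mathbf{a}$ is weakly renormalizable and $$ \mathbb E[X_\mathbf{a}]=-\frac{1}{s}\left(\mathbf{B} f(s,t_0)-m^s \mathbf{B} f^m\left(s,\frac{t_0-1}{m}+1\right)\right). $$
   Context: Function setting: $\mathscr L(\varphi)(t)=\int_0^\infty e^{-tu}\varphi(u)\,du$ with domain $\mathscr D(\mathscr L)$ (integrable on each $(0,R)$, absolutely convergent for $\mathrm{Re}(s)>0$); $\mathscr H$ is the space of $f(s,t):\mathbb C\times\mathbb R_+\to\mathbb C$ differentiable in $t$, with $f$, $\partial_t f$ entire in $s$, $f(-1,t)=\mathscr L(\varphi)$ with $|\varphi|\le\psi$ for an increasing $\psi\in\mathscr D(\mathscr L)$, and $f(-s,t)=\mathscr L(\varphi(u)u^{s-1}/\Gamma(s))(t)$ for $\mathrm{Re}(s)>1$. $\mathbf{B}=\sum_{n\ge0}\frac{(-\boldsymbol{\Delta})^n}{n+1}$ with $(\boldsymbol{\Delta} g)(t)=g(t+1)-g(t)$; $\mathbf{B} f(s,t)$ means $\mathbf{B}$ applied to $t\mapsto f(s,t)$. Renormalization setting: $\mathbb{P}$ is a finitely-additive,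 translation-invariant probability measure on all subsets of $\mathbb N$, expectation $\mathbb E$. For a sequence, $(\mathbf{E}\mathbf{a})_n=a_{n+1}$, $\boldsymbol{\Delta}=\mathbf{E}-\mathrm{id}$, $\mathbf{E}^h=\sum_{k\ge0}\binom{h}{k}\boldsymbol{\Delta}^k$. For $m\in\mathbb N$, $j\in\{0,\dots,m-1\}$, $\mathbf{s}_{[j],n}=\sum_{i=0}^{n} a_i -\sum_{i=0}^{(n-j)/m} a_{mi}$ for $n\equiv j\bmod m$, extended to all $n\ge j$ via $\mathbf{s}_{[j],n}=\tilde s_{(n-j)/m}$, $\tilde s_{k+i/m}=(\mathbf{E}^{i/m}\tilde{\mathbf{s}})_k$ where $\tilde{\mathbf{s}}_k=\mathbf{s}_{[j],km+j}$; $X_{\mathbf{a}}=\frac1m(\mathbf{s}_{[0]}+\cdots+\mathbf{s}_{[m-1]})$ as a random variable on $\mathbb N$. Weakly renormalizable: for all $m$, all extensions exist and $\mathbb E[X_\mathbf{a}]$ is finite.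
   Formalization: In s_{[j],n} the second sum carries a factor m, i.e. ∑a_i − m∑a_{mi}; without it the claim is false (φ=1, f=t^s, t_0=1, m=2, s=−1: the expectation is (3/4)ζ(2), but the formula gives ζ(2)/2). *)

(* Defs.v *)
From HB Require Import structures.
From mathcomp Require Import all_boot all_order all_algebra.
From mathcomp Require Import complex.
From mathcomp Require Import all_classical all_reals all_analysis.

Set Implicit Arguments.
Unset Strict Implicit.
Unset Printing Implicit Defensive.

Import Order.TTheory GRing.Theory Num.Theory.
Import numFieldNormedType.Exports.

Local Open Scope classical_set_scope.
Local Open Scope ring_scope.
Local Open Scope complex_scope.

(* The topology of [R[i]], as a normed module over itself. *)
HB.instance Definition _ (R : realType) := NormedModule.copy R[i] R[i]^o.

Section Complex.
Context {R : realType}.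
Implicit Types (z : R[i]) (u : R).

Definition cexp z : R[i] :=
  (expR (complex.Re z))%:C * (cos (complex.Im z) +i* sin (complex.Im z)).

(* u ^ z for u > 0 *)
Definition cpow u z : R[i] := cexp (z * (ln u)%:C).

Definition entire (g : R[i] -> R[i]) : Prop := forall z, derivable g z 1.

(* Functions of a real variable with complex values are differentiated and
   integrated componentwise; [R[i]] is not a normed module over [R]. *)
Definition derivableC (g : R -> R[i]) u : Prop :=
  derivable (fun x => complex.Re (g x)) u 1 /\
  derivable (fun x => complex.Im (g x)) u 1.

Definition deriveC (g : R -> R[i]) u : R[i] :=
  derive1 (fun x => complex.Re (g x)) u +i*
  derive1 (fun x => complex.Im (g x)) u.

(* [mu] is an arbitrary set function: the library's integral is the supremum
   of the integrals of the simple functions below the positive part, minus the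
   same for the negative part, which is meaningful for a finitely additive
   [mu] too. *)
Definition integrableC {d} {T : measurableType d} (mu : set T -> \bar R)
    (D : set T) (g : T -> R[i]) : Prop :=
  mu.-integrable D (fun x => (complex.Re (g x))%:E) /\
  mu.-integrable D (fun x => (complex.Im (g x))%:E).

Definition integralC {d} {T : measurableType d} (mu : set T -> \bar R)
    (D : set T) (g : T -> R[i]) : R[i] :=
  fine (\int[mu]_(x in D) (complex.Re (g x))%:E)%E +i*
  fine (\int[mu]_(x in D) (complex.Im (g x))%:E)%E.

End Complex.

Section Laplace.
Context {R : realType}.
Implicit Types (phi : R -> R[i]) (f : R[i] -> R -> R[i]).

Let mu : set R -> \bar R := @lebesgue_measure R.

Definition laplace_dom phi : Prop :=
  (forall r : R, 0 < r -> integrableC mu `]0, r[%classic phi) /\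
  (forall s : R[i], 0 < complex.Re s ->
     integrableC mu `]0, +oo[%classic (fun u => cexp (- (s * u%:C)) * phi u)).

Definition laplace phi (t : R) : R[i] :=
  integralC mu `]0, +oo[%classic (fun u => cexp (- (t * u)%:C) * phi u).

(* Euler's integral, so only meaningful for 0 < Re s *)
Definition Gamma (s : R[i]) : R[i] := laplace (fun u => cpow u (s - 1)) 1.

(* R_+ is the open half-line: the second argument is only used for t > 0. *)
Definition calH f : Prop :=
  (forall (s : R[i]) (t : R), 0 < t -> derivableC (f s) t) /\
  (forall t : R, 0 < t -> entire (fun s => f s t)) /\
  (forall t : R, 0 < t -> entire (fun s => deriveC (f s) t)) /\
  exists phi : R -> R[i],
    [/\ laplace_dom phi,
        (exists psi : R -> R,
          [/\ laplace_dom (fun u => (psi u)%:C),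
              (forall u v : R, 0 < u -> u <= v -> psi u <= psi v) &
              (forall u : R, 0 < u -> `|phi u| <= (psi u)%:C)]),
        (forall t : R, 0 < t -> f (-1) t = laplace phi t) &
        (forall (s : R[i]) (t : R), 1 < complex.Re s -> 0 < t ->
           f (- s) t = laplace (fun u => phi u * cpow u (s - 1) / Gamma s) t)].

Definition fpow_dilate (m : nat) f (s : R[i]) (t : R) : R[i] :=
  cpow m%:R (- s) * f s (m%:R * t).

End Laplace.

Section OperatorB.
Context {R : realType}.
Implicit Types (g : R -> R[i]) (t : R).

Definition fdiff g : R -> R[i] := fun t => g (t + 1) - g t.

Definition opB_term g t : nat -> R[i] :=
  fun n => (-1) ^+ n * iter n fdiff g t / n.+1%:R.

Definition opB_exists g t : Prop := cvgn (series (opB_term g t)).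

Definition opB g t : R[i] := limn (series (opB_term g t)).

End OperatorB.

Section Renormalization.
Context {R : realType}.
Implicit Types (a : nat -> R[i]) (m j n k i : nat).

Definition sdiff a : nat -> R[i] := fun n => a n.+1 - a n.

Definition gbinom (h : R) k : R := (\prod_(i < k) (h - i%:R)) / k`!%:R.

Definition shift_term (h : R) a n : nat -> R[i] :=
  fun k => (gbinom h k)%:C * iter k sdiff a n.

Definition shift_exists (h : R) a n : Prop := cvgn (series (shift_term h a n)).

(* E^h a at n *)
Definition shift (h : R) a n : R[i] := limn (series (shift_term h a n)).

(* s_{[j],n} for n = j mod m.  The weight m of the sub-series is essential: it
   is what cancels the divergent parts, and for an absolutely convergent series
   it makes X_a tend to (sum of the a_i) - m (sum of the a_{mi}). *)
Definition s_bracket0 m a j n : R[i] :=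
  \sum_(0 <= i < n.+1) a i - m%:R * \sum_(0 <= i < ((n - j) %/ m).+1) a (m * i)%N.

Definition s_tilde m a j k : R[i] := s_bracket0 m a j (k * m + j).

(* s_{[j],n} for n >= j, where n - j = k m + i with i < m.  It is undefined for
   n < j; those finitely many n are negligible for a translation-invariant
   finitely additive probability, and 0 is used there. *)
Definition s_bracket m a j n : R[i] :=
  if (n < j)%N then 0
  else shift (((n - j) %% m)%N%:R / m%:R) (s_tilde m a j) ((n - j) %/ m)%N.

Definition X_ m a n : R[i] := m%:R^-1 * \sum_(0 <= j < m) s_bracket m a j n.

Definition translation_invariant (P : set nat -> \bar R) : Prop :=
  forall (A : set nat) k, P [set (n + k)%N | n in A] = P A.

Definition weakly_renormalizable (P : set nat -> \bar R) a : Prop :=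
  forall m, (0 < m)%N ->
    (forall j k i, (j < m)%N -> (i < m)%N ->
       shift_exists (i%:R / m%:R) (s_tilde m a j) k) /\
    integrableC P setT (X_ m a).

Definition expectC (P : set nat -> \bar R) (X : nat -> R[i]) : R[i] :=
  integralC P setT X.

End Renormalization.

(* Main.v *)
(* The relation f(-s, .) = L(phi u^(s-1) / Gamma(s)) gives d/dt f(s, t) =
   s f(s-1, t) for Re s < -1, hence for all s by the identity theorem.  So
   F_k = s (s-1) ... (s-k+1) f(s-k, .) is the k-th derivative of F_0 = f(s, .),
   and for large N, F_N is itself a Laplace transform.  Attach to a finite linear
   combination of values F_i(x) its symbol, the same combination of
   (-u)^i e^(-xu).  By Taylor's formula with Peano kernel, a combination whose
   symbol is O(u^N) at 0 is the integral of (-u)^(-N) times its symbol against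
   the original of F_N; so a sequence of combinations converges when its symbols
   do so suitably fast, and tends to 0 when the limit symbol is 0.

   The symbol of B f(s, t) is e^(-tu) u / (1 - e^(-u)), the logarithmic series in
   1 - e^(-u), and the Newton series for the shifts E^h converges on symbols to
   multiplication by e^(-hu).  Since s a_n = F_1(t_0 + n - 1), the symbol of
   s s_[j],n is a constant in n plus a multiple of e^(-nu), and these multiples
   cancel in the sum over j < m.  Thus X_a(n) has, for all n >= m, the value
   claimed for its expectation, and a translation-invariant finitely additive
   probability does not see the finitely many n < m. *)

(* The obstacle is that for general [s] neither [f(s, .)] nor its low derivatives need be Laplace
   transforms, so [B f] and the Newton series cannot be summed under an integral sign. Passing to
   [F_N] costs a Taylor polynomial at 1, which disappears as soon as the symbol vanishes to order
   [N] at 0. Pointwise convergence of symbols is therefore too weak: the error after [K] terms is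
   required to be at most a constant times [e^(-tau u) (1 - e^(-cu))^K]. For [K >= N] this is
   [O(u^N)] with exponential decay, so one rate both removes the polynomial and supplies a majorant
   for dominated convergence. The logarithmic and the binomial series both have errors of this kind.
   Symbols have real coefficients, so the real and imaginary parts of [f] are handled by the same
   real integrals; the complex factor [m^s] does no harm, as it cancels the [m^(-s)] inside [f^m].
   The point [(t_0 - 1) / m + 1] arises because [m] times it is [t_0 + m - 1], the argument at which
   [a_m], the first nontrivial term of the sub-series, is taken. *)
Require Import Defs.
From HB Require Import structures.
From mathcomp Require Import all_boot all_order all_algebra.
From mathcomp Require Import complex.
From mathcomp Require Import all_classical all_reals all_analysis.
From mathcomp Require Import measurable_realfun ring lra.

Set Implicit Arguments.
Unset Strict Implicit.
Unset Printing Implicit Defensive.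

Import Order.TTheory GRing.Theory Num.Theory.
Import numFieldNormedType.Exports.

Local Open Scope classical_set_scope.
Local Open Scope ring_scope.
Local Open Scope complex_scope.

(** * The complex plane *)

Section ComplexTopology.
Context {R : realType}.
Implicit Types (z w : R[i]).
Local Notation nc := (@Normc.normc R).

Lemma normcE_nc z : `|z| = (nc z)%:C.
Proof. by case: z => a b; rewrite normc_def. Qed.

Lemma nc_ge0 z : 0 <= nc z.
Proof. by rewrite -lecR -normcE_nc normr_ge0. Qed.

Lemma ncB z w : nc (z - w) = nc (w - z).
Proof. by apply: complexI; rewrite -!normcE_nc distrC. Qed.

Lemma nc_real (x : R) : nc x%:C = `|x|.
Proof. by rewrite /= expr0n/= addr0 sqrtr_sqr. Qed.

Lemma nc_i : nc 'i%C = 1.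
Proof. by rewrite /= expr0n/= expr1n add0r sqrtr1. Qed.

Lemma ncX z n : nc (z ^+ n) = nc z ^+ n.
Proof.
elim: n => [|n ih]; first by rewrite !expr0 Normc.normc1.
by rewrite !exprS Normc.normcM ih.
Qed.

Lemma Re_le_nc z : `|complex.Re z| <= nc z.
Proof. by rewrite -lecR -normcE_nc normc_ge_Re. Qed.

Lemma Im_le_nc z : `|complex.Im z| <= nc z.
Proof.
case: z => a b /=; rewrite -[X in X <= _]sqrtr_sqr ler_wsqrtr//.
by rewrite lerDr sqr_ge0.
Qed.

Lemma nc_le_ReIm z : nc z <= `|complex.Re z| + `|complex.Im z|.
Proof.
rewrite [X in nc X]complexE (le_trans (le_normcD _ _))//.
by rewrite Normc.normcM nc_i mul1r !nc_real.
Qed.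

Lemma cReD z w : complex.Re (z + w) = complex.Re z + complex.Re w.
Proof. by case: z w => [a b] [c d]. Qed.

Lemma cImD z w : complex.Im (z + w) = complex.Im z + complex.Im w.
Proof. by case: z w => [a b] [c d]. Qed.

Lemma cReN z : complex.Re (- z) = - complex.Re z.
Proof. by case: z => [a b]. Qed.

Lemma cImN z : complex.Im (- z) = - complex.Im z.
Proof. by case: z => [a b]. Qed.

Lemma cReM z w :
  complex.Re (z * w) = complex.Re z * complex.Re w - complex.Im z * complex.Im w.
Proof. by case: z w => [a b] [c d]. Qed.

Lemma cImM z w :
  complex.Im (z * w) = complex.Re z * complex.Im w + complex.Im z * complex.Re w.
Proof. by case: z w => [a b] [c d]. Qed.

Lemma cReZ (x : R) z : complex.Re (x%:C * z) = x * complex.Re z.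
Proof. by rewrite cReM /= mul0r subr0. Qed.

Lemma cImZ (x : R) z : complex.Im (x%:C * z) = x * complex.Im z.
Proof. by rewrite cImM /= mul0r addr0. Qed.

Lemma complex_eqP z w :
  complex.Re z = complex.Re w -> complex.Im z = complex.Im w -> z = w.
Proof. by case: z w => [a b] [c d] /= -> ->. Qed.

(** The radii of balls in [R[i]] are themselves elements of [R[i]]; the real modulus [nc] moves all
    later estimates into [R]. *)
Lemma cvgC_nc {T : Type} (F : set_system T) {FF : Filter F} (f : T -> R[i]) z :
  f x @[x --> F] --> z <-> nc (f x - z) @[x --> F] --> (0 : R).
Proof.
split=> [/cvgrPdist_lt fz|/cvgrPdist_lt fz]; apply/cvgrPdist_lt.
  move=> e e0; have := fz e%:C; rewrite ltcR => /(_ e0).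
  apply: filterS => x; rewrite normcE_nc ltcR sub0r normrN.
  by rewrite ger0_norm ?nc_ge0// ncB.
(* In the order of [R[i]], [0 < e] forces [e] to be real. *)
move=> e e0; have ee : e = (complex.Re e)%:C.
  by apply: complex_eqP => //=; rewrite ger0_Im// ltW.
have := fz (complex.Re e); rewrite -ltcR -ee => /(_ e0).
apply: filterS => x; rewrite normcE_nc ee ltcR sub0r normrN.
by rewrite ger0_norm ?nc_ge0// ncB.
Qed.

Lemma cvgC_ReIm {T : Type} (F : set_system T) {FF : Filter F} (f : T -> R[i]) z :
  f x @[x --> F] --> z <->
  complex.Re (f x) @[x --> F] --> complex.Re z /\
  complex.Im (f x) @[x --> F] --> complex.Im z.
Proof.
split=> [/cvgC_nc/cvgrPdist_lt fz|[/cvgrPdist_lt Rf /cvgrPdist_lt If]].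
  split; apply/cvgrPdist_lt => e /fz; apply: filterS => x;
    rewrite sub0r normrN ger0_norm ?nc_ge0//; apply: le_lt_trans.
    by rewrite ncB -cReN -cReD Re_le_nc.
  by rewrite ncB -cImN -cImD Im_le_nc.
apply/cvgC_nc/cvgrPdist_lt => e e0.
have e2 : 0 < e / 2 by rewrite divr_gt0.
near=> x; rewrite sub0r normrN ger0_norm ?nc_ge0// (le_lt_trans (nc_le_ReIm _))//.
rewrite cReD cImD cReN cImN (splitr e) ltrD// distrC; near: x;
  [exact: Rf|exact: If].
Unshelve. all: by end_near. Qed.

Lemma near_nc z (d : R) : 0 < d -> \forall w \near z, nc (w - z) < d.
Proof.
move=> d0; apply/nbhs_ballP; exists d%:C => /=; first by rewrite ltcR.
by move=> w; rewrite /ball/= normcE_nc ltcR [nc (z - w)]ncB.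
Qed.

Lemma nc_gt0 z : (0 < nc z) = (z != 0).
Proof. by rewrite -ltcR -normcE_nc normr_gt0. Qed.

Lemma continuousC_nc (f : R[i] -> R[i]) z :
  {for z, continuous f} <->
  forall e : R, 0 < e -> exists2 d : R, 0 < d &
    forall w, nc (w - z) < d -> nc (f w - f z) < e.
Proof.
split=> [/cvgC_nc/cvgrPdist_lt fz e /fz/nbhs_ballP[d d0 dfz]|fz].
  have dd : d = (complex.Re d)%:C.
    by apply: complex_eqP => //=; rewrite ger0_Im// ltW.
  exists (complex.Re d) => [|w wz]; first by rewrite -ltcR -dd.
  have := dfz w; rewrite /ball/= normcE_nc dd ltcR [nc (z - w)]ncB => /(_ wz).
  by rewrite sub0r normrN ger0_norm ?nc_ge0.
apply/(@cvgC_nc _ (nbhs z) (nbhs_filter z))/cvgrPdist_lt => e /fz[d d0 dfz].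
apply/nbhs_ballP; exists d%:C => /=; first by rewrite ltcR.
move=> w; rewrite /ball/= normcE_nc ltcR [nc (z - w)]ncB => /dfz.
by rewrite sub0r normrN ger0_norm ?nc_ge0.
Qed.

Lemma ccontM (f g : R[i] -> R[i]) z : {for z, continuous f} -> {for z, continuous g} ->
  {for z, continuous (fun w : R[i] => f w * g w : R[i])}.
Proof. exact: continuousM. Qed.

Lemma ccontD (f g : R[i] -> R[i]) z : {for z, continuous f} -> {for z, continuous g} ->
  {for z, continuous (fun w : R[i] => f w + g w : R[i])}.
Proof. exact: continuousD. Qed.

Lemma ccontN (f : R[i] -> R[i]) z : {for z, continuous f} ->
  {for z, continuous (fun w : R[i] => - f w : R[i])}.
Proof. exact: continuousN. Qed.

Lemma ccontV (f : R[i] -> R[i]) z : f z != 0 -> {for z, continuous f} ->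
  {for z, continuous (fun w : R[i] => (f w)^-1 : R[i])}.
Proof. exact: continuousV. Qed.

Lemma ccont_cst (c : R[i]) z : {for z, continuous (fun _ : R[i] => c)}.
Proof. exact: cst_continuous. Qed.

Lemma ccont_id z : {for z, continuous (fun w : R[i] => w)}.
Proof. by move=> A. Qed.

(** Carathéodory's form of differentiability: without a quotient, sums, products and compositions
    become algebraic identities between slopes. *)
Definition cdiff (g : R[i] -> R[i]) z := exists2 q : R[i] -> R[i],
  {for z, continuous q} & forall w, g w = g z + q w * (w - z).

Lemma cdiff_continuous g z : cdiff g z -> {for z, continuous g}.
Proof.
move=> [q cq gE].
rewrite [X in {for z, continuous X}](_ : g = fun w => g z + q w * (w - z)).
  apply: ccontD; first exact: ccont_cst.
  apply: ccontM; first exact: cq.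
  by apply: (ccontD (g := fun=> - z)); [exact: ccont_id|exact: ccont_cst].
exact/funext.
Qed.

Lemma derivable_cdiff g z : derivable g z 1 -> cdiff g z.
Proof.
move=> /cvg_ex[l /= gl].
exists (fun w => if w == z then l else (g w - g z) / (w - z)); last first.
  move=> w; case: eqP => [->|/eqP wz]; first by rewrite subrr mulr0 addr0.
  by rewrite divfK ?subr_eq0// addrC subrK.
apply/continuousC_nc => e e0.
move/cvgC_nc/cvgrPdist_lt : gl => /(_ _ e0).
move/nbhs_ballP => [d d0 dg].
have dd : d = (complex.Re d)%:C.
  by apply: complex_eqP => //=; rewrite ger0_Im// ltW.
exists (complex.Re d) => [|w wz]; first by rewrite -ltcR -dd.
rewrite eqxx; case: eqP => [_|/eqP wz0]; first by rewrite subrr Normc.normc0.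
have := dg (w - z); rewrite /ball/= sub0r normrN normcE_nc dd ltcR.
move=> /(_ wz); rewrite subr_eq0 => /(_ wz0).
rewrite sub0r normrN ger0_norm ?nc_ge0//.
rewrite /GRing.scale/= mulr1 subrK.
by rewrite mulrC.
Qed.

Lemma cdiff_cst (c : R[i]) z : cdiff (fun=> c) z.
Proof.
exists (fun=> 0); first exact: ccont_cst.
by move=> w; rewrite mul0r addr0.
Qed.

Lemma cdiff_id z : cdiff id z.
Proof.
by exists (fun=> 1) => [|w]; [exact: ccont_cst|rewrite mul1r addrC subrK].
Qed.

Lemma cdiffD f g z : cdiff f z -> cdiff g z -> cdiff (fun w => f w + g w) z.
Proof.
move=> [p cp fE] [q cq gE]; exists (fun w => p w + q w); first exact: ccontD.
by move=> w; rewrite fE gE; ring.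
Qed.

Lemma cdiffM f g z : cdiff f z -> cdiff g z -> cdiff (fun w => f w * g w) z.
Proof.
move=> [p cp fE] dg; have cg := cdiff_continuous dg; case: dg => [q cq gE].
exists (fun w => p w * g w + f z * q w).
  apply: ccontD; first exact: ccontM.
  by apply: (ccontM (f := fun=> f z)); [exact: ccont_cst|exact: cq].
by move=> w; rewrite fE gE; ring.
Qed.

Lemma cdiffN f z : cdiff f z -> cdiff (fun w => - f w) z.
Proof.
move=> [p cp fE]; exists (fun w => - p w); first exact: ccontN.
by move=> w; rewrite fE; ring.
Qed.

Lemma cdiffX f n z : cdiff f z -> cdiff (fun w => f w ^+ n) z.
Proof.
move=> df; elim: n => [|n ih]; first exact: cdiff_cst.
rewrite (_ : (fun w => _) = (fun w => f w * f w ^+ n)); first exact: cdiffM.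
by apply/funext => w; rewrite exprS.
Qed.

Lemma near_ccont (f g : R[i] -> R[i]) z : (\forall w \near z, g w = f w) ->
  {for z, continuous g} -> {for z, continuous f}.
Proof.
move=> gf cg; rewrite /prop_for /continuous_at -(nbhs_singleton gf).
by apply: cvg_trans cg; exact: (@near_eq_cvg _ _ (nbhs z) (nbhs_filter z) _ _ gf).
Qed.

Lemma near_cdiff f g z : (\forall w \near z, f w = g w) -> cdiff g z -> cdiff f z.
Proof.
move=> fg [p cp gE].
have fz : f z = g z by exact: (nbhs_singleton fg).
exists (fun w => if f w == g w then p w else (f w - f z) / (w - z)).
  by apply: near_ccont cp; apply: filterS fg => w ->; rewrite eqxx.
move=> w; case: eqP => [->|fgw]; first by rewrite fz -gE.
have wz : w - z != 0.
  by rewrite subr_eq0; apply/eqP => wz; apply: fgw; rewrite wz.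
by rewrite divfK// addrC subrK.
Qed.

Lemma cdiff_inv z : z != 0 -> cdiff (fun w => w^-1) z.
Proof.
(* Since [0^-1 = 0], the slope at [w = 0] has to be [z ^- 2]; this exceptional point stays away from
   [z]. *)
move=> z0; exists (fun w => if w == 0 then z ^- 2 else - (w * z)^-1).
  apply: (@near_ccont _ (fun w : R[i] => - (w * z)^-1)); last first.
    apply: ccontN; apply: ccontV; first by rewrite mulf_neq0.
    by apply: (ccontM (g := fun=> z)); [exact: ccont_id|exact: ccont_cst].
  have z0' : 0 < nc z by rewrite nc_gt0.
  apply: filterS (near_nc z z0') => w wz; case: eqP => // w0.
  by move: wz; rewrite w0 sub0r normcN ltxx.
move=> w; case: eqP => [->|/eqP w0]; first by rewrite invr0; field.
by field; rewrite z0 w0.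
Qed.

Lemma cdiff_comp f g z : cdiff g z -> cdiff f (g z) -> cdiff (fun w => f (g w)) z.
Proof.
move=> dg; have cg := cdiff_continuous dg; case: dg => [q cq gE] [p cp fE].
exists (fun w => p (g w) * q w).
  apply: ccontM; last exact: cq.
  exact: (continuous_comp cg cp).
by move=> w; rewrite (fE (g w)) {2}(gE w) -mulrA [g z + _]addrC addrK.
Qed.

End ComplexTopology.

(** * The complex exponential is entire *)

Section ComplexExp.
Context {R : realType}.
Implicit Types (z w : R[i]).
Local Notation nc := (@Normc.normc R).

Lemma is_derive_littleo (f : R -> R) (a l e : R) : is_derive a 1 f l -> 0 < e ->
  exists2 d : R, 0 < d &
    forall x, `|x - a| < d -> `|f x - f a - l * (x - a)| <= e * `|x - a|.
Proof.
move=> /is_derive1_caratheodory[g [fE cg ga]] e0.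
move: cg => /cvgrPdist_lt/(_ _ e0)/nbhs_ballP[d /= d0 dg].
exists d => // x xa; rewrite fE -ga -mulrBl normrM ler_wpM2r//.
by rewrite distrC ltW//; apply: dg; rewrite /ball/= distrC.
Qed.

Lemma cexpD z w : cexp (z + w) = cexp z * cexp w.
Proof.
case: z w => [a b] [c d]; rewrite /cexp /= expRD cosD sinD.
by apply: complex_eqP => /=; ring.
Qed.

Lemma cexp0 : cexp 0 = 1 :> R[i].
Proof. by rewrite /cexp /= expR0 cos0 sin0 mul1r. Qed.

Lemma nc_cexp z : nc (cexp z) = expR (complex.Re z).
Proof.
rewrite /cexp Normc.normcM nc_real ger0_norm ?expR_ge0//=.
by rewrite cos2Dsin2 sqrtr1 mulr1.
Qed.

Lemma cexp_neq0 z : cexp z != 0.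
Proof. by rewrite -nc_gt0 nc_cexp expR_gt0. Qed.

Lemma cexp_real (x : R) : cexp x%:C = (expR x)%:C.
Proof. by rewrite /cexp /= cos0 sin0 mulr1. Qed.

Lemma Re_cexp z : complex.Re (cexp z) = expR (complex.Re z) * cos (complex.Im z).
Proof. by rewrite /cexp cReZ. Qed.

Lemma Im_cexp z : complex.Im (cexp z) = expR (complex.Re z) * sin (complex.Im z).
Proof. by rewrite /cexp cImZ. Qed.

(** Differentiability at 0, from the first-order expansions of [expR], [cos] and [sin]; [cexpD]
    carries it to every other point. *)
Lemma cexp_littleo (e : R) : 0 < e -> exists2 d : R, 0 < d &
  forall z, nc z < d -> nc (cexp z - 1 - z) <= e * nc z.
Proof.
(* The four errors [A1] to [A4] below add up to at most [6 * e' * nc z]. *)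
move=> e0; pose e' := Num.min (e / 8) 1.
have e'0 : 0 < e' by rewrite lt_min divr_gt0/=.
have e'1 : e' <= 1 by rewrite ge_min lexx orbT.
have e'e : 8 * e' <= e by rewrite -ler_pdivlMl// mulrC ge_min lexx.
have [d1 d10 H1] := is_derive_littleo (is_derive_expR (0 : R)) e'0.
have [d2 d20 H2] := is_derive_littleo (is_derive_cos (0 : R)) e'0.
have [d3 d30 H3] := is_derive_littleo (is_derive_sin (0 : R)) e'0.
(* The bound [e' / (1 + e')] yields [|expR x - 1| <= e'], and the bound 1 yields [|1 + x| <= 2]. *)
pose m := Num.min (Num.min d1 d2) (Num.min (Num.min d3 (e' / (1 + e'))) 1).
have m0 : 0 < m by rewrite !lt_min d10 d20 d30 ltr01 divr_gt0//= addr_gt0.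
exists m => // z zm; pose x := complex.Re z; pose y := complex.Im z.
have xz : `|x| <= nc z := Re_le_nc z; have yz : `|y| <= nc z := Im_le_nc z.
rewrite (le_trans (nc_le_ReIm _))// !cReD !cImD !cReN !cImN Re_cexp Im_cexp /= oppr0 addr0.
rewrite -/x -/y.
set N := nc z in zm xz yz *.
have N0 : 0 <= N := nc_ge0 _.
move: (zm); rewrite !lt_min => /andP[/andP[N1 N2] /andP[/andP[N3 N4] N5]].
have {}H1 : `|expR x - 1 - x| <= e' * `|x|.
  by have := H1 x; rewrite !subr0 expR0 mul1r; apply; exact: le_lt_trans N1.
have {}H2 : `|cos y - 1| <= e' * `|y|.
  have := H2 y; rewrite !subr0 cos0 sin0 oppr0 mul0r subr0; apply.
  exact: le_lt_trans N2.
have {}H3 : `|sin y - y| <= e' * `|y|.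
  have := H3 y; rewrite !subr0 cos0 sin0 mul1r subr0; apply.
  exact: le_lt_trans N3.
have eN x' : `|x'| <= N -> e' * `|x'| <= e' * N by move=> ?; rewrite ler_wpM2l// ltW.
have x1 : `|x| <= 1 by rewrite (le_trans xz)// ltW.
have ex1 : `|expR x - 1| <= e'.
  rewrite -[expR x - 1](subrK x) (le_trans (ler_normD _ _))//.
  rewrite (le_trans (lerD H1 (lexx _)))// -[X in _ + X]mul1r -mulrDl.
  rewrite (@le_trans _ _ ((e' + 1) * N))//.
    by rewrite ler_wpM2l// addr_ge0// ltW.
  rewrite addrC mulrC -ler_pdivlMr ?addr_gt0//; exact: ltW.
have siny : `|sin y| <= (1 + e') * N.
  rewrite -[sin y](subrK y) (le_trans (ler_normD _ _))//.
  by rewrite mulrDl mul1r addrC lerD// (le_trans H3)// eN.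
have -> : expR x * cos y - 1 - x =
  (expR x - 1 - x) * cos y + (1 + x) * (cos y - 1) by ring.
have -> : expR x * sin y - y = (expR x - 1) * sin y + (sin y - y) by ring.
have A1 : `|(expR x - 1 - x) * cos y| <= e' * N.
  rewrite normrM -[leRHS]mulr1 ler_pM//; first by rewrite (le_trans H1)// eN.
  by rewrite ler_norml cos_geN1 cos_le1.
have A2 : `|(1 + x) * (cos y - 1)| <= 2 * (e' * N).
  rewrite normrM ler_pM//; last by rewrite (le_trans H2)// eN.
  by rewrite (le_trans (ler_normD _ _))// normr1 -[2]/(1 + 1) lerD2l.
have A3 : `|(expR x - 1) * sin y| <= 2 * (e' * N).
  have -> : 2 * (e' * N) = (2 * e') * N by ring.
  rewrite normrM (le_trans (ler_pM _ _ ex1 siny))// mulrA ler_wpM2r//.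
  by rewrite mulrC ler_wpM2r ?(ltW e'0)// -[2]/(1 + 1) lerD2l.
have A4 : `|sin y - y| <= e' * N.
  by rewrite (le_trans H3)// eN.
have := ler_normD ((expR x - 1 - x) * cos y) ((1 + x) * (cos y - 1)).
have := ler_normD ((expR x - 1) * sin y) (sin y - y).
have : 8 * (e' * N) <= e * N by rewrite mulrA ler_wpM2r.
have : 0 <= e' * N by rewrite mulr_ge0// ltW.
lra.
Qed.

Lemma cdiff_cexp z : cdiff cexp z.
Proof.
exists (fun w => if w == z then cexp z else (cexp w - cexp z) / (w - z)); last first.
  move=> w; case: eqP => [->|/eqP wz]; first by rewrite subrr mulr0 addr0.
  by rewrite divfK ?subr_eq0// addrC subrK.
apply/continuousC_nc => e e0.
have E0 : 0 < e / 2 / nc (cexp z).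
  by rewrite !divr_gt0// nc_gt0 cexp_neq0.
have [d d0 H] := cexp_littleo E0.
exists d => // w wz; rewrite eqxx; case: eqP => [_|/eqP wz0].
  by rewrite subrr Normc.normc0.
have wz1 : w - z != 0 by rewrite subr_eq0.
have -> : (cexp w - cexp z) / (w - z) - cexp z =
    cexp z * ((cexp (w - z) - 1 - (w - z)) / (w - z)).
  have -> : cexp w = cexp z * cexp (w - z) by rewrite -cexpD addrC subrK.
  by field.
rewrite Normc.normcM [nc (_ / _)]Normc.normcM Normc.normcV mulrA ltr_pdivrMr ?nc_gt0//.
rewrite (le_lt_trans (ler_wpM2l (nc_ge0 _) (H _ wz)))// mulrA.
rewrite ltr_pM2r ?nc_gt0// mulrC divfK; last by rewrite gt_eqF// nc_gt0 cexp_neq0.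
by rewrite ltr_pdivrMr// ltr_pMr// ltr1n.
Qed.

End ComplexExp.

(** * Mean value inequalities and primitives along lines *)

Section RealMVT.
Context {R : realType}.

Lemma is_derive_bounded_increment (f df : R -> R) (a b M : R) : a <= b ->
  (forall x, a <= x <= b -> is_derive x 1 f (df x)) ->
  (forall x, a <= x <= b -> `|df x| <= M) -> `|f b - f a| <= M * (b - a).
Proof.
rewrite le_eqVlt => /predU1P[-> _ _|ab fdf dfM].
  by rewrite !subrr normr0 mulr0.
have [x xab|x|c] := @MVT R f df a b ab.
- by apply: fdf; move: xab; rewrite in_itv/= => /andP[/ltW -> /ltW ->].
- apply: derivable_within_continuous => y; rewrite in_itv/= => yab.
  by have [] := fdf y yab.
- rewrite in_itv/= => /andP[ac cb] ->.
  have ba : 0 <= b - a by rewrite subr_ge0 ltW.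
  by rewrite normrM (ger0_norm ba) ler_wpM2r// dfM// !ltW.
Qed.

(** The integral from [m] is a primitive only to the right of [m]; this is why the rectangles below
    lie in a quadrant beyond [m]. *)
Lemma continuous_primitive (f : R -> R) (m : R) : continuous f ->
  exists F, forall x, m < x -> is_derive x 1 F (f x).
Proof.
move=> cf; exists (fun x => \int[lebesgue_measure]_(t in `[m, x]) f t)%R => x mx.
have xx : x < x + 1 by rewrite ltrDl.
have mi : lebesgue_measure.-integrable `[m, x + 1] (EFin \o f).
  apply: continuous_compact_integrable; first exact: segment_compact.
  exact: continuous_subspaceT.
have [d1 d2] := continuous_FTC1_closed xx mi mx (cf x).
by apply: DeriveDef; [exact: d1|rewrite -derive1E; exact: d2].
Qed.

End RealMVT.

Section Curves.
Context {R : realType}.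
Implicit Types (f g : R -> R[i]) (x : R) (l : R[i]).
Local Notation nc := (@Normc.normc R).

Definition cder f x l :=
  is_derive x 1 (fun y => complex.Re (f y)) (complex.Re l) /\
  is_derive x 1 (fun y => complex.Im (f y)) (complex.Im l).

Lemma cder_cst (c : R[i]) x : cder (fun=> c) x 0.
Proof. by split; exact: is_derive_cst. Qed.

Lemma cderD f g x a b : cder f x a -> cder g x b ->
  cder (fun y => f y + g y) x (a + b).
Proof.
move=> [f1 f2] [g1 g2]; split.
  under eq_fun do rewrite cReD; rewrite cReD; exact: (is_deriveD f1 g1).
under eq_fun do rewrite cImD; rewrite cImD; exact: (is_deriveD f2 g2).
Qed.

Lemma cderM f g x a b : cder f x a -> cder g x b ->
  cder (fun y => f y * g y) x (a * g x + f x * b).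
Proof.
move=> [f1 f2] [g1 g2]; split.
  under eq_fun do rewrite cReM.
  apply: (is_derive_eq (is_deriveB (is_deriveM f1 g1) (is_deriveM f2 g2))).
  by rewrite /GRing.scale/= cReD !cReM; ring.
under eq_fun do rewrite cImM.
apply: (is_derive_eq (is_deriveD (is_deriveM f1 g2) (is_deriveM f2 g1))).
by rewrite /GRing.scale/= cImD !cImM; ring.
Qed.

Lemma cder_cstM (c : R[i]) f x a : cder f x a -> cder (fun y => c * f y) x (c * a).
Proof.
by move=> fa; have := cderM (cder_cst c x) fa; rewrite mul0r add0r.
Qed.

Lemma cderN f x a : cder f x a -> cder (fun y => - f y) x (- a).
Proof.
move=> fa; have := cder_cstM (-1) fa; rewrite mulN1r.
by congr cder; apply/funext => y; rewrite mulN1r.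
Qed.

Lemma cder_hline (y x : R) : cder (fun t => t +i* y) x 1.
Proof. by split => /=; [exact: is_derive_id|exact: is_derive_cst]. Qed.

Lemma cder_vline (x y : R) : cder (fun t => x +i* t) y 'i%C.
Proof. by split => /=; [exact: is_derive_cst|exact: is_derive_id]. Qed.

(** The mean value theorem is applied to the real and the imaginary part separately, whence the
    factor 2. *)
Lemma cder_bounded_increment f (df : R -> R[i]) (a b M : R) : a <= b ->
  (forall x, a <= x <= b -> cder f x (df x)) ->
  (forall x, a <= x <= b -> nc (df x) <= M) ->
  nc (f b - f a) <= 2 * (M * (b - a)).
Proof.
move=> ab fdf dfM; rewrite (le_trans (nc_le_ReIm _))// mulr_natl mulr2n.
rewrite cReD cImD cReN cImN lerD//.
  apply: (@is_derive_bounded_increment _ (fun y => complex.Re (f y))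
    (fun y => complex.Re (df y))) => // x xab; first by have [] := fdf x xab.
  by rewrite (le_trans (Re_le_nc _))// dfM.
apply: (@is_derive_bounded_increment _ (fun y => complex.Im (f y))
  (fun y => complex.Im (df y))) => // x xab; first by have [] := fdf x xab.
by rewrite (le_trans (Im_le_nc _))// dfM.
Qed.

Lemma curve_primitive f (m : R) : continuous (fun x => complex.Re (f x)) ->
  continuous (fun x => complex.Im (f x)) ->
  exists F, forall x, m < x -> cder F x (f x).
Proof.
move=> /continuous_primitive-/(_ m)[F FE] /continuous_primitive-/(_ m)[G GE].
by exists (fun x => F x +i* G x) => x mx; split => /=; [exact: FE|exact: GE].
Qed.

End Curves.

(** * Goursat's theorem and the identity theorem *)

Section Rectangles.
Context {R : realType}.
Local Notation nc := (@Normc.normc R).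

Lemma continuous_hline (k : R[i] -> R[i]) : (forall z, {for z, continuous k}) ->
  forall y, continuous (fun x => complex.Re (k (x +i* y))) /\
            continuous (fun x => complex.Im (k (x +i* y))).
Proof.
move=> ck y; suff H x : (k (t +i* y)) @[t --> x] --> k (x +i* y).
  by split=> x; have [] := (cvgC_ReIm _ _).1 (H x).
apply: (@continuous_comp _ _ _ (fun t => t +i* y) k); last exact: ck.
apply/(@cvgC_ReIm _ _ (nbhs x) (nbhs_filter x)); split => /=; first exact: cvg_id.
exact: cvg_cst.
Qed.

Lemma continuous_vline (k : R[i] -> R[i]) : (forall z, {for z, continuous k}) ->
  forall x, continuous (fun y => complex.Re (k (x +i* y))) /\
            continuous (fun y => complex.Im (k (x +i* y))).
Proof.
move=> ck x; suff H y : (k (x +i* t)) @[t --> y] --> k (x +i* y).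
  by split=> y; have [] := (cvgC_ReIm _ _).1 (H y).
apply: (@continuous_comp _ _ _ (fun t => x +i* t) k); last exact: ck.
apply/(@cvgC_ReIm _ _ (nbhs y) (nbhs_filter y)); split => /=; first exact: cvg_cst.
exact: cvg_id.
Qed.

(* The boundary integral over the rectangle with lower left corner (x, y) and
   sides s and t, where [H y] and [V x] are primitives along the horizontal and
   the vertical lines. *)
Definition rect_int (H V : R -> R -> R[i]) (x y s t : R) : R[i] :=
  (H y (x + s) - H y x) - (H (y + t) (x + s) - H (y + t) x) +
  'i%C * ((V (x + s) (y + t) - V (x + s) y) - (V x (y + t) - V x y)).

Lemma rect_int_split H V (x y s t : R) :
  let s' := s / 2 in let t' := t / 2 in
  rect_int H V x y s t =
    rect_int H V x y s' t' + rect_int H V (x + s') y s' t' +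
    rect_int H V x (y + t') s' t' + rect_int H V (x + s') (y + t') s' t'.
Proof.
move=> s' t'; rewrite /rect_int.
have -> : x + s' + s' = x + s by rewrite /s'; field.
have -> : y + t' + t' = y + t by rewrite /t'; field.
by ring.
Qed.

Section RectangleBound.
Variables (k : R[i] -> R[i]) (m : R) (H V : R -> R -> R[i]).
Hypothesis HE : forall y x, m < x -> cder (H y) x (k (x +i* y)).
Hypothesis VE : forall x y, m < y -> cder (V x) y (k (x +i* y)).

(** An affine function has the quadratic primitive [A], so its boundary integral is zero and only
    the deviation [e] of [k] from it counts, once on each of the four sides. *)
Lemma rect_int_le (p a b : R[i]) (e x y s t : R) :
  m < x -> m < y -> 0 <= s -> 0 <= t ->
  (forall u v, x <= u <= x + s -> y <= v <= y + t ->
     nc (k (u +i* v) - (a + b * ((u +i* v) - p))) <= e) ->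
  nc (rect_int H V x y s t) <= 4 * (e * (s + t)).
Proof.
move=> mx my s0 t0 ke.
pose A w := a * (w - p) + b / 2 * ((w - p) * (w - p)).
have Ah v u : cder (fun u => A (u +i* v)) u (a + b * ((u +i* v) - p)).
  have d1 : cder (fun u => (u +i* v) - p) u 1.
    by have := cderD (cder_hline v u) (cder_cst (- p) u); rewrite addr0.
  have := cderD (cder_cstM a d1) (cder_cstM (b / 2) (cderM d1 d1)).
  by rewrite [X in cder _ _ X -> _](_ : _ = a + b * ((u +i* v) - p)) //; field.
have Av u v : cder (fun v => - 'i%C * A (u +i* v)) v (a + b * ((u +i* v) - p)).
  have d1 : cder (fun v => (u +i* v) - p) v 'i%C.
    by have := cderD (cder_vline u v) (cder_cst (- p) v); rewrite addr0.
  have := cder_cstM (- 'i%C) (cderD (cder_cstM a d1) (cder_cstM (b / 2) (cderM d1 d1))).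
  rewrite [X in cder _ _ X -> _](_ : _ = - ('i%C ^+ 2) * (a + b * ((u +i* v) - p))).
    by rewrite sqr_i opprK mul1r.
  by field.
have hbound v : y <= v <= y + t ->
    nc ((H v (x + s) - A ((x + s) +i* v)) - (H v x - A (x +i* v))) <=
    2 * (e * s).
  move=> yv; rewrite -[s in 2 * (e * s)](addrK x) [s + x]addrC.
  apply: (cder_bounded_increment (f := fun u => H v u - A (u +i* v))
    (df := fun u => k (u +i* v) - (a + b * ((u +i* v) - p)))).
  - by rewrite lerDl.
  - move=> u /andP[xu _]; apply: cderD; first by apply: HE; exact: lt_le_trans xu.
    exact: cderN.
  - by move=> u xu; exact: ke.
have vbound u : x <= u <= x + s ->
    nc ((V u (y + t) - - 'i%C * A (u +i* (y + t))) - (V u y - - 'i%C * A (u +i* y))) <=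
    2 * (e * t).
  move=> xu; rewrite -[t in 2 * (e * t)](addrK y) [t + y]addrC.
  apply: (cder_bounded_increment (f := fun v => V u v - - 'i%C * A (u +i* v))
    (df := fun v => k (u +i* v) - (a + b * ((u +i* v) - p)))).
  - by rewrite lerDl.
  - move=> v /andP[yv _]; apply: cderD; first by apply: VE; exact: lt_le_trans yv.
    exact: cderN.
  - by move=> v yv; exact: ke.
have -> : rect_int H V x y s t =
  ((H y (x + s) - A ((x + s) +i* y)) - (H y x - A (x +i* y))) -
  ((H (y + t) (x + s) - A ((x + s) +i* (y + t))) - (H (y + t) x - A (x +i* (y + t)))) +
  ('i%C * ((V (x + s) (y + t) - - 'i%C * A ((x + s) +i* (y + t))) -
    (V (x + s) y - - 'i%C * A ((x + s) +i* y))) -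
  'i%C * ((V x (y + t) - - 'i%C * A (x +i* (y + t))) - (V x y - - 'i%C * A (x +i* y)))).
  rewrite /rect_int.
  set A1 := A _; set A2 := A _; set A3 := A _; set A4 := A _.
  (* The values of [A] at the four corners cancel because they occur with the factor
     [1 + 'i ^+ 2]. *)
  transitivity ((H y (x + s) - H y x) - (H (y + t) (x + s) - H (y + t) x) +
  'i%C * ((V (x + s) (y + t) - V (x + s) y) - (V x (y + t) - V x y)) +
   (1 + 'i%C ^+ 2) * (A3 - A4 - A1 + A2)); last by ring.
  by rewrite sqr_i subrr mul0r addr0.
have xx : x <= x <= x + s by rewrite lexx lerDl.
have xs : x <= x + s <= x + s by rewrite lexx lerDl s0.
have yy : y <= y <= y + t by rewrite lexx lerDl.
have yt : y <= y + t <= y + t by rewrite lexx lerDl t0.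
have -> : 4 * (e * (s + t)) =
  (2 * (e * s) + 2 * (e * s)) + (2 * (e * t) + 2 * (e * t)) by ring.
rewrite (le_trans (le_normcD _ _))// lerD//.
  rewrite (le_trans (le_normcD _ _))// lerD//; first exact: hbound.
  by rewrite normcN; exact: hbound.
rewrite (le_trans (le_normcD _ _))// lerD ?normcN// Normc.normcM nc_i mul1r.
  exact: vbound.
exact: vbound.
Qed.

End RectangleBound.
End Rectangles.

Section Goursat.
Context {R : realType}.
Local Notation nc := (@Normc.normc R).
Variables (k : R[i] -> R[i]) (m : R) (H V : R -> R -> R[i]).
Hypothesis dk : forall z, cdiff k z.
Hypothesis HE : forall y x, m < x -> cder (H y) x (k (x +i* y)).
Hypothesis VE : forall x y, m < y -> cder (V x) y (k (x +i* y)).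

Lemma rect_int_quarter (x y s t : R) : exists p : R * R,
  [/\ p.1 = x \/ p.1 = x + s / 2, p.2 = y \/ p.2 = y + t / 2 &
   nc (rect_int H V x y s t) <= 4 * nc (rect_int H V p.1 p.2 (s / 2) (t / 2))].
Proof.
rewrite rect_int_split.
set s' := s / 2; set t' := t / 2.
set a := rect_int _ _ x y _ _; set b := rect_int _ _ (x + _) y _ _.
set c := rect_int _ _ x (y + _) _ _; set d := rect_int _ _ (x + _) (y + _) _ _.
have : nc (a + b + c + d) <= nc a + nc b + nc c + nc d.
  by do 3 (rewrite (le_trans (le_normcD _ _))// lerD2r).
set n := nc (a + b + c + d).
have [na|na] := leP n (4 * nc a); first by exists (x, y); split; [left|left|].
have [nb|nb] := leP n (4 * nc b); first by exists (x + s', y); split; [right|left|].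
have [nC|nC] := leP n (4 * nc c); first by exists (x, y + t'); split; [left|right|].
have [nd|nd] := leP n (4 * nc d); first by exists (x + s', y + t'); split; [right|right|].
move=> nabcd; exfalso; lra.
Qed.

(** Repeated quartering keeps at least the share [4 ^- n] of a nonzero integral, while
    differentiability at the common point of the rectangles forces a strictly smaller share. *)
Lemma goursat (x y s t : R) : m < x -> m < y -> 0 < s -> 0 < t ->
  rect_int H V x y s t = 0.
Proof.
move=> mx my s0 t0; apply/eqP; rewrite -[_ == _]negbK -nc_gt0 -leNgt leNgt; apply/negP => J0.
set h := nc _ in J0.
have [next nextP] : {next : nat -> R * R -> R * R | forall n q,
    let s' := s / 2 ^+ n in let t' := t / 2 ^+ n in
    [/\ (next n q).1 = q.1 \/ (next n q).1 = q.1 + s' / 2,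
        (next n q).2 = q.2 \/ (next n q).2 = q.2 + t' / 2 &
     nc (rect_int H V q.1 q.2 s' t') <=
      4 * nc (rect_int H V (next n q).1 (next n q).2 (s' / 2) (t' / 2))]}.
  have : forall nq : nat * (R * R), exists p : R * R,
    let s' := s / 2 ^+ nq.1 in let t' := t / 2 ^+ nq.1 in
    [/\ p.1 = nq.2.1 \/ p.1 = nq.2.1 + s' / 2,
        p.2 = nq.2.2 \/ p.2 = nq.2.2 + t' / 2 &
     nc (rect_int H V nq.2.1 nq.2.2 s' t') <=
      4 * nc (rect_int H V p.1 p.2 (s' / 2) (t' / 2))].
    by move=> [n q]; exact: rect_int_quarter.
  move=> /choice[f fP]; exists (fun n q => f (n, q)) => n q; exact: (fP (n, q)).
pose q := fix q n := if n is n'.+1 then next n' (q n') else (x, y).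
pose sn n := s / 2 ^+ n; pose tn n := t / 2 ^+ n.
have snS n : sn n.+1 = sn n / 2 by rewrite /sn exprSr invfM mulrA.
have tnS n : tn n.+1 = tn n / 2 by rewrite /tn exprSr invfM mulrA.
have sn0 n : 0 < sn n by rewrite divr_gt0// exprn_gt0.
have tn0 n : 0 < tn n by rewrite divr_gt0// exprn_gt0.
have Jn n : h <= 4 ^+ n * nc (rect_int H V (q n).1 (q n).2 (sn n) (tn n)).
  elim: n => [|n ih]; first by rewrite expr0 mul1r /sn /tn expr0 !divr1.
  rewrite (le_trans ih)// exprSr -mulrA ler_wpM2l ?exprn_ge0//.
  by have [_ _] := nextP n (q n); rewrite snS tnS.
have qx n : (q n).1 <= (q n.+1).1 /\ (q n.+1).1 + sn n.+1 <= (q n).1 + sn n.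
  have [[q1|q1] _ _] := nextP n (q n); rewrite [q n.+1]/= q1 snS -/(sn n);
    have := sn0 n; split; lra.
have qy n : (q n).2 <= (q n.+1).2 /\ (q n.+1).2 + tn n.+1 <= (q n).2 + tn n.
  have [_ [q1|q1] _] := nextP n (q n); rewrite [q n.+1]/= q1 tnS -/(tn n);
    have := tn0 n; split; lra.
have nested (u w : nat -> R) : (forall n, 0 < w n) ->
    (forall n, u n <= u n.+1 /\ u n.+1 + w n.+1 <= u n + w n) ->
    exists p, forall n, u n <= p <= u n + w n.
  move=> w0 uw.
  have uinc a b : (a <= b)%N -> u a <= u b.
    move/subnKC <-; elim: (b - a)%N => [|d ih]; rewrite ?addn0// addnS (le_trans ih)//.
    by have [] := uw (a + d)%N.
  have vdec a b : (a <= b)%N -> u b + w b <= u a + w a.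
    move/subnKC <-; elim: (b - a)%N => [|d ih]; rewrite ?addn0// addnS (le_trans _ ih)//.
    by have [] := uw (a + d)%N.
  have uv a b : u a <= u b + w b.
    have [ab|/ltnW ba] := leqP a b.
      by rewrite (le_trans (uinc _ _ ab))// lerDl ltW.
    by rewrite (le_trans _ (vdec _ _ ba))// lerDl ltW.
  exists (sup (range u)) => n; apply/andP; split.
    apply: ub_le_sup; last by exists n.
    by exists (u 0%N + w 0%N) => _ [a _ <-].
  apply: ge_sup; first by exists (u 0%N); exists 0%N.
  by move=> _ [a _ <-].
have [p1 p1P] := nested (fun n => (q n).1) sn sn0 qx.
have [p2 p2P] := nested (fun n => (q n).2) tn tn0 qy.
pose p : R[i] := p1 +i* p2.
have [Q cQ kE] := dk p.
(* At stage [n] the bound of [rect_int_le] is [4 * e * (s + t) ^+ 2 / 4 ^+ n]; this [e] makes it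
   [h / 2 / 4 ^+ n], half of what quartering guarantees. *)
pose e := h / (8 * (s + t) ^+ 2).
have st0 : 0 < s + t by rewrite addr_gt0.
have e0 : 0 < e by rewrite divr_gt0// mulr_gt0// exprn_gt0.
have [d d0 dQ] := (continuousC_nc _ _).1 cQ e e0.
have [n nd] : exists n, sn n + tn n < d.
  have := @cvg_geometric R (s + t) (2^-1).
  rewrite gtr0_norm ?invr_gt0// invf_lt1 ?ltr1n// => /(_ isT).
  move=> /cvgrPdist_lt/(_ _ d0)[n _ /(_ n (leqnn n))].
  rewrite /geometric/= sub0r normrN gtr0_norm ?mulr_gt0 ?exprn_gt0 ?invr_gt0// exprVn mulrDl.
  by exists n.
have qxn : m < (q n).1.
  rewrite (lt_le_trans mx)//; elim: n {nd} => //= n ih.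
  by rewrite (le_trans ih)//; have [] := qx n.
have qyn : m < (q n).2.
  rewrite (lt_le_trans my)//; elim: n {nd qxn} => //= n ih.
  by rewrite (le_trans ih)//; have [] := qy n.
have := rect_int_le HE VE (p := p) (a := k p) (b := Q p)
  (e := e * (sn n + tn n)) qxn qyn (ltW (sn0 n)) (ltW (tn0 n)).
have key u v : (q n).1 <= u <= (q n).1 + sn n ->
    (q n).2 <= v <= (q n).2 + tn n ->
    nc (k (u +i* v) - (k p + Q p * ((u +i* v) - p))) <= e * (sn n + tn n).
  move=> uq vq.
  have up : nc ((u +i* v) - p) <= sn n + tn n.
    rewrite (le_trans (nc_le_ReIm _))//= lerD// ler_norml.
      by have := p1P n; lra.
    by have := p2P n; lra.
  rewrite kE opprD addrACA subrr add0r -mulrBl Normc.normcM ler_pM ?nc_ge0//.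
  by rewrite ltW// dQ// (le_lt_trans up).
move=> /(_ key) Jle.
have : h <= h / 2.
  rewrite (le_trans (Jn n))// (le_trans (ler_wpM2l _ Jle)) ?exprn_ge0//.
  rewrite /sn /tn -mulrDl /e.
  rewrite [leLHS](_ : _ = h / 2)//.
  have -> : (4 : R) ^+ n = 2 ^+ n * 2 ^+ n by rewrite -exprMn -natrM.
  have : (2 : R) ^+ n != 0 by rewrite expf_neq0.
  move: (2 ^+ n) => u u0; field; rewrite u0/= gt_eqF//.
lra.
Qed.

End Goursat.

Section MeanValue.
Context {R : realType}.
Local Notation nc := (@Normc.normc R).

(* Goursat's theorem for [w |-> h (z + e^w)] on [l, ln r] x [0, 2 pi], with
   [l -> -oo]: the horizontal sides cancel by periodicity.  Real and imaginary
   parts are bounded separately, hence the factor 2. *)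
Lemma circle_bound (h : R[i] -> R[i]) (z : R[i]) (r M : R) :
  (forall w, cdiff h w) -> 0 < r ->
  (forall x, 0 <= x <= 2 * pi -> nc (h (z + cexp (ln r +i* x))) <= M) ->
  nc (h z) <= 2 * M.
Proof.
move=> dh r0 hM.
have ch w : {for w, continuous h} := cdiff_continuous (dh w).
pose k w := h (z + cexp w).
have dk w : cdiff k w.
  apply: (@cdiff_comp _ h) => //; apply: cdiffD; first exact: cdiff_cst.
  exact: cdiff_cexp.
have ck w : {for w, continuous k} := cdiff_continuous (dk w).
have kper x : k (x +i* (2 * pi)) = k (x +i* 0).
  by rewrite /k /cexp /= mulr2n mulrDl mul1r cos2pi sin2pi cos0 sin0.
apply/ler_addgt0Pr => e e0.
have e20 : 0 < e / 2 by rewrite divr_gt0.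
have [d d0 hd] := (continuousC_nc _ _).1 (ch z) _ e20.
(* [l] is so far to the left that the side [Re w = l] is mapped into the disc of radius [d] around
   [z], where [h] differs from [h z] by less than [e / 2]. *)
pose L := ln r; pose l := Num.min (L - 1) (ln (d / 2)).
have lL : l < L by rewrite gt_min ltrBlDr ltrDl ltr01.
have eld : expR l < d.
  rewrite (@le_lt_trans _ _ (d / 2))//; last by rewrite ltr_pdivrMr// ltr_pMr// ltr1n.
  by rewrite -[leRHS]lnK ?posrE ?divr_gt0// ler_expR ge_min lexx orbT.
pose m := Num.min l 0 - 1.
have lm : Num.min l 0 <= l by rewrite ge_min lexx.
have lm0 : Num.min l 0 <= 0 by rewrite ge_min lexx orbT.
have ml : m < l by rewrite /m; lra.
have m0 : m < 0 by rewrite /m; lra.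
have /choice[H HE] y : exists F, forall x, m < x -> cder F x (k (x +i* y)).
  by have [c1 c2] := continuous_hline ck y; exact: curve_primitive.
have /choice[V VE] x : exists F, forall y, m < y -> cder F y (k (x +i* y)).
  by have [c1 c2] := continuous_vline ck x; exact: curve_primitive.
pose T : R := 2 * pi.
have T0 : 0 < T by rewrite mulr_gt0 ?pi_gt0.
have := goursat dk (fun y x => HE y x) (fun x y => VE x y) ml m0 (s := L - l) (t := T).
rewrite subr_gt0 => /(_ lL T0).
rewrite /rect_int add0r [l + _]addrC subrK.
have -> : H T L - H T l = H 0 L - H 0 l.
  apply/eqP; rewrite -subr_eq0 -[_ == _]negbK -nc_gt0 -leNgt.
  have := @cder_bounded_increment R (fun x => H T x - H 0 x) (fun=> 0) l L 0 (ltW lL).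
  rewrite mul0r mulr0 [_ - _ - _](_ : _ = (H T L - H T l) - (H 0 L - H 0 l)); last by ring.
  apply=> [x /andP[lx _]|x _]; last by rewrite Normc.normc0.
  rewrite -[X in cder _ _ X](subrr (k (x +i* 0))) -{1}kper.
  by apply: cderD; [apply: HE|apply: cderN; apply: HE]; exact: lt_le_trans lx.
rewrite subrr add0r => /eqP; rewrite mulf_eq0 => /orP[/eqP i0|].
  by move: (@nc_i R); rewrite i0 Normc.normc0 => /eqP; rewrite eq_sym oner_eq0.
rewrite subr_eq0 => /eqP VLl.
have kc x y : nc (z + cexp (x +i* y) - z) = expR x.
  by rewrite addrC addKr nc_cexp.
have bL : nc (V L T - V L 0) <= 2 * (M * T).
  have := @cder_bounded_increment R (V L) (fun y => k (L +i* y)) 0 T M (ltW T0).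
  rewrite subr0; apply => [x /andP[x0 _]|x xT]; last exact: hM.
  by apply: VE; exact: lt_le_trans x0.
(* On the left side the integrand is nearly the constant [h z], whose integral over [[0, T]] is
   [h z * T]. *)
have bl : nc ((V l T - h z * T%:C) - (V l 0 - h z * 0%:C)) <= 2 * (e / 2 * T).
  have := @cder_bounded_increment R (fun y => V l y - h z * y%:C)
    (fun y => k (l +i* y) - h z) 0 T (e / 2) (ltW T0).
  rewrite subr0; apply => [x /andP[x0 _]|x _].
    apply: cderD; first by apply: VE; exact: lt_le_trans x0.
    apply: cderN; rewrite -[X in cder _ _ X]mulr1; apply: cder_cstM.
    exact: cder_hline.
  by rewrite ltW// hd// kc.
have : nc (h z) * T <= (2 * M + e) * T.
  have -> : nc (h z) * T = nc (h z * T%:C) by rewrite Normc.normcM nc_real ger0_norm// ltW.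
  have -> : h z * T%:C = (V l T - V l 0) - ((V l T - h z * T%:C) - (V l 0 - h z * 0%:C)).
    by rewrite mulr0 subr0; ring.
  rewrite (le_trans (le_normcD _ _))// normcN -VLl mulrDl lerD//.
    by rewrite -mulrA.
  by rewrite (le_trans bl)// mulrA [2 * _]mulrC divfK.
by rewrite ler_pM2r.
Qed.

(* A function vanishing near [c] can be divided by any power of [w - c]; on a
   circle where it vanishes or [|w - c|] exceeds [|z - c|], the mean value
   bound for large powers forces it to vanish at [z]. *)
Lemma cdiff_eq0 (g : R[i] -> R[i]) (b : R) : (forall z, cdiff g z) ->
  (forall z, complex.Re z < b -> g z = 0) -> forall z, g z = 0.
Proof.
move=> dg g0 z.
have [zb|bz] := ltP (complex.Re z) b; first exact: g0.
(* The centre [c = z - 2 * d] then has real part [b - 1 - d], inside the half-plane where [g]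
   vanishes. *)
pose d := complex.Re z - b + 1; have d1 : 1 <= d by rewrite /d; lra.
have d0 : 0 < d by lra.
pose c := z - (2 * d)%:C.
have zc : z - c = (2 * d)%:C by rewrite /c opprB addrC subrK.
have Rc : complex.Re c < b by rewrite /c cReD cReN /= /d; lra.
(* The numerator [z - c] normalizes [h n z] to [g z]. At [w = c] the convention [0^-1 = 0] is
   harmless, because [g] vanishes near [c]. *)
pose h n w := g w * ((z - c) * (w - c)^-1) ^+ n.
have dh n w : cdiff (h n) w.
  have [->|wc] := eqVneq w c.
    apply: (@near_cdiff _ _ (fun=> 0)); last exact: cdiff_cst.
    have e0 : 0 < b - complex.Re c by rewrite subr_gt0.
    apply: filterS (near_nc c e0) => u uc.
    rewrite /h g0 ?mul0r//.
    have := le_lt_trans (Re_le_nc _) uc; rewrite cReD cReN ltr_norml; lra.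
  apply: cdiffM => //; apply: cdiffX; apply: cdiffM; first exact: cdiff_cst.
  apply: (@cdiff_comp _ (fun w => w^-1)); last by apply: cdiff_inv; rewrite subr_eq0.
  by apply: cdiffD; [exact: cdiff_id|exact: cdiff_cst].
(* With radius [3 * d], the points of the circle with real part at least [b] have distance at least
   [3 * d] from [c], whereas [z] has distance [2 * d]: hence the ratio [2 / 3]. *)
pose r := 3 * d; have r0 : 0 < r by rewrite mulr_gt0.
pose p x := z + cexp (ln r +i* x).
have [B Bg] : exists B, forall x, 0 <= x <= 2 * pi -> nc (g (p x)) <= B.
  have ck w : {for w, continuous (fun w => g (z + cexp w))}.
    apply: cdiff_continuous; apply: (@cdiff_comp _ g) => //.
    by apply: cdiffD; [exact: cdiff_cst|exact: cdiff_cexp].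
  have [cR cI] := continuous_vline ck (ln r).
  have T0 : 0 <= 2 * pi :> R by rewrite mulr_ge0 ?pi_ge0.
  pose gR x := complex.Re (g (p x)); pose gI x := complex.Im (g (p x)).
  have [|x _ xmax] := @EVT_max R (fun x => `|gR x| + `|gI x|) _ _ T0.
    apply: continuous_subspaceT => x.
    apply: (@continuousD _ _ _ (fun x => `|gR x|) (fun x => `|gI x|)).
      by apply: (@continuous_comp _ _ _ gR); [exact: cR|exact: norm_continuous].
    by apply: (@continuous_comp _ _ _ gI); [exact: cI|exact: norm_continuous].
  exists (`|gR x| + `|gI x|) => y yT.
  by rewrite (le_trans (nc_le_ReIm _))// xmax// in_itv.
have B0 : 0 <= B.
  have := Bg 0; rewrite lexx mulr_ge0 ?pi_ge0//= => /(_ isT).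
  exact: le_trans (nc_ge0 _).
have hB n x : 0 <= x <= 2 * pi -> nc (h n (p x)) <= B * (2 / 3) ^+ n.
  move=> xT; have [pb|bp] := ltP (complex.Re (p x)) b.
    by rewrite /h g0// mul0r Normc.normc0 mulr_ge0// exprn_ge0// divr_ge0.
  rewrite /h Normc.normcM ncX ler_pM ?nc_ge0 ?exprn_ge0 ?nc_ge0 ?Bg//.
  rewrite lerXn2r ?nnegrE ?nc_ge0 ?divr_ge0//.
  rewrite Normc.normcM Normc.normcV zc nc_real ger0_norm; last by rewrite mulr_ge0// ltW.
  have pc : p x - c = cexp (ln r +i* x) + (2 * d)%:C by rewrite -zc /p; ring.
  have : (3 * d) ^+ 2 <= nc (p x - c) ^+ 2.
    rewrite pc; move: bp; rewrite /p cReD.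
    have : nc (cexp (ln r +i* x)) = r by rewrite nc_cexp /= lnK.
    move: (cexp (ln r +i* x)) => -[u v] /= uvr uz.
    have uv : u ^+ 2 + v ^+ 2 = r ^+ 2.
      by rewrite -uvr sqr_sqrtr// addr_ge0 ?sqr_ge0.
    rewrite sqr_sqrtr ?addr_ge0 ?sqr_ge0// addr0.
    have ud : - d <= u by rewrite /d; lra.
    have -> : (u + 2 * d) ^+ 2 + v ^+ 2 =
      u ^+ 2 + v ^+ 2 + 4 * d * (u + d) by ring.
    by rewrite uv lerDl mulr_ge0 //; lra.
  rewrite ler_sqr ?nnegrE ?nc_ge0//; last by rewrite mulr_ge0// ltW.
  move=> dpc.
  rewrite ler_pdivrMr; last by rewrite (lt_le_trans _ dpc)// mulr_gt0.
  by rewrite (le_trans _ (ler_wpM2l _ dpc))// ?divr_ge0// mulrA divfK.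
have gz n : nc (g z) <= 2 * (B * (2 / 3) ^+ n).
  have := circle_bound (dh n) r0 (hB n).
  by rewrite /h divff ?expr1n ?mulr1// zc; apply/eqP => -[] /eqP; rewrite gt_eqF// mulr_gt0.
apply/eqP; rewrite -[_ == _]negbK -nc_gt0; apply/negP => gz0.
have := @cvg_geometric R (2 * B) (2 / 3).
rewrite ger0_norm ?divr_ge0// ltr_pdivrMr// mul1r ltr_nat => /(_ isT).
move=> /cvgrPdist_lt/(_ _ gz0)[n _ /(_ n (leqnn n))].
rewrite /geometric/= sub0r normrN ger0_norm ?mulr_ge0 ?exprn_ge0 ?divr_ge0//.
by rewrite ltNge -mulrA gz.
Qed.

End MeanValue.

(** * Laplace integrals *)

Section HalfLine.
Context {R : realType}.
Implicit Types (h k chi : R -> R) (u : R).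

Definition halfline : set R := `]0, +oo[%classic.
Local Notation D := halfline.
Local Notation mu := (@lebesgue_measure R).

Definition intD h := mu.-integrable D (EFin \o h).
Definition ID h : R := \int[mu]_(u in D) h u.

Lemma halflineE u : D u = (0 < u).
Proof. by rewrite /halfline/= in_itv/= andbT. Qed.

Lemma measurable_halfline : measurable D.
Proof. exact: measurable_itv. Qed.
Local Hint Resolve measurable_halfline : core.

Lemma intD_measurable h : intD h -> measurable_fun D h.
Proof. by move=> /measurable_int/measurable_EFinP. Qed.

Lemma intD_le h k : measurable_fun D h -> (forall u, 0 < u -> `|h u| <= `|k u|) ->
  intD k -> intD h.
Proof.
move=> mh hk; apply: le_integrable => //; first exact/measurable_EFinP.
by move=> u; rewrite halflineE /= lee_fin => /hk.
Qed.

Lemma eq_intD h k : (forall u, 0 < u -> h u = k u) -> intD h -> intD k.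
Proof.
move=> hk; apply: eq_integrable => // u; rewrite inE halflineE => u0 /=.
by rewrite hk.
Qed.

Lemma eq_ID h k : (forall u, 0 < u -> h u = k u) -> ID h = ID k.
Proof.
by move=> hk; apply: eq_Rintegral => u; rewrite inE halflineE => /hk.
Qed.

Lemma intDD h k : intD h -> intD k -> intD (fun u => h u + k u).
Proof.
move=> ih ik; rewrite /intD (_ : EFin \o _ = (EFin \o h) \+ (EFin \o k))%E//.
exact: integrableD.
Qed.

Lemma intDZ c h : intD h -> intD (fun u => c * h u).
Proof.
move=> ih; rewrite /intD (_ : EFin \o _ = fun u => c%:E * (EFin \o h) u)%E//.
exact: integrableZl.
Qed.

Lemma intD_norm h : intD h -> intD (fun u => `|h u|).
Proof.
move=> ih; rewrite /intD (_ : EFin \o _ = abse \o (EFin \o h))%E//.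
exact: integrable_abse.
Qed.

Lemma IDD h k : intD h -> intD k -> ID (fun u => h u + k u) = ID h + ID k.
Proof. by move=> ih ik; exact: RintegralD. Qed.

Lemma IDZ c h : intD h -> ID (fun u => c * h u) = c * ID h.
Proof. by move=> ih; exact: RintegralZl. Qed.

Lemma intD_dominated_cvg (h_ : nat -> R -> R) h k :
  (forall n, measurable_fun D (h_ n)) -> intD k ->
  (forall n u, 0 < u -> `|h_ n u| <= k u) ->
  (forall u, 0 < u -> h_ n u @[n --> \oo] --> h u) ->
  ID (h_ n) @[n --> \oo] --> ID h.
Proof.
move=> mh ik hk hc.
have mh0 : measurable_fun D h.
  apply/measurable_EFinP; apply: (emeasurable_fun_cvg (fun n => EFin \o h_ n)).
    by move=> n; exact/measurable_EFinP.
  move=> u; rewrite halflineE => u0; apply: cvg_EFin; first exact: nearW.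
  exact: hc.
have ih : intD h.
  apply: intD_le ik => // u u0.
  have ku : 0 <= k u by apply: le_trans (hk 0%N _ u0).
  rewrite [leRHS]ger0_norm//; apply: (cvgr_to_le (cvg_norm (hc _ u0))).
  by apply: nearW => n; exact: hk.
apply: fine_cvg; rewrite fineK; last exact: integrable_fin_num.
apply: (@dominated_cvg _ _ R mu D measurable_halfline (fun n u => (h_ n u)%:E)
  (fun u => (h u)%:E) (fun u => (k u)%:E)) => //=.
- by move=> n; apply/measurable_EFinP; exact: mh.
- move=> u; rewrite halflineE => u0; apply: cvg_EFin; first exact: nearW.
  exact: hc.
- by move=> n u; rewrite halflineE /= lee_fin => /hk.
Qed.

End HalfLine.

Section LaplaceClass.
Context {R : realType}.
Implicit Types (h k chi : R -> R) (u : R).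
Local Notation D := (@halfline R).
Local Notation mu := (@lebesgue_measure R).

(** The real functions with an absolutely convergent Laplace integral at every positive [t]; growth
    and behaviour at 0 are controlled by this alone. *)
Definition LT chi := forall t : R, 0 < t -> intD (fun u => expR (- (t * u)) * chi u).

Lemma continuous_measurable_halfline h : (forall u, 0 < u -> {for u, continuous h}) ->
  measurable_fun D h.
Proof.
move=> ch; apply: open_continuous_measurable_fun; first exact: interval_open.
by move=> u; rewrite inE halflineE => /ch.
Qed.

Lemma measurable_expRM (t : R) : measurable_fun D (fun u => expR (t * u)).
Proof.
by apply: measurable_funTS; apply: measurableT_comp.
Qed.

Lemma LT_measurable chi : LT chi -> measurable_fun D chi.
Proof.
move=> /(_ 1 ltr01)/intD_measurable mc.
rewrite [X in measurable_fun _ X](_ : _ =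
    (fun u => expR (1 * u)) \* (fun u => expR (- (1 * u)) * chi u)).
  by apply: measurable_funM => //; exact: measurable_expRM.
by apply/funext => u /=; rewrite mulrA -expRD subrr expR0 mul1r.
Qed.

Lemma LT_kernel chi k (M tau : R) : LT chi -> 0 < tau -> measurable_fun D k ->
  (forall u, 0 < u -> `|k u| <= M * expR (- (tau * u))) ->
  intD (fun u => k u * chi u).
Proof.
move=> LTc tau0 mk kM.
apply: (@intD_le R _ (fun u => M * (expR (- (tau * u)) * chi u))); last exact/intDZ/LTc.
  by apply: measurable_funM => //; exact: LT_measurable.
move=> u u0; rewrite mulrA !normrM [`|expR _|]ger0_norm ?expR_ge0//.
by rewrite ler_wpM2r// (le_trans (kM _ u0))// ler_wpM2r ?expR_ge0// ler_norm.
Qed.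

(** Differentiation under the integral sign, with the single majorant
    [M * expR (- (tau * u)) * |chi u|] for the kernel and for its derivative. *)
Lemma is_derive_kernel chi (K K1 : R -> R -> R) (a l r M tau : R) :
  LT chi -> 0 < tau -> 0 <= M -> l < a < r ->
  (forall x, l < x < r -> measurable_fun D (K x)) ->
  (forall x u, l < x < r -> 0 < u -> `|K x u| <= M * expR (- (tau * u))) ->
  (forall x u, l < x < r -> 0 < u -> is_derive x 1 (K ^~ u) (K1 x u)) ->
  (forall x u, l < x < r -> 0 < u -> `|K1 x u| <= M * expR (- (tau * u))) ->
  is_derive a 1 (fun x => ID (fun u => K x u * chi u)) (ID (fun u => K1 a u * chi u)).
Proof.
move=> LTc tau0 M0 alr mK KM dK K1M.
have dKc x u : l < x < r -> 0 < u ->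
    is_derive x 1 (fun x => K x u * chi u) (K1 x u * chi u).
  move=> xlr u0; have H := dK x u xlr u0.
  have := is_deriveM H (is_derive_cst (chi u) x 1).
  move/is_derive_eq; apply.
  by rewrite scaler0 add0r /GRing.scale/= mulrC.
pose f x u := K x u * chi u.
pose G u := M * (expR (- (tau * u)) * `|chi u|).
have iG : intD G.
  apply: intDZ; apply: eq_intD (intD_norm (LTc _ tau0)) => u u0.
  by rewrite normrM ger0_norm ?expR_ge0.
have GE u : M * expR (- (tau * u)) * `|chi u| = G u by rewrite /G mulrA.
have aI : (`]l, r[%classic : set R) a by rewrite /= in_itv.
have intf x : (`]l, r[%classic : set R) x -> mu.-integrable D (EFin \o f x).
  rewrite /= in_itv/= => xlr; apply: (LT_kernel LTc tau0 (mK _ xlr)) => u u0.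
  exact: KM.
have derf x u : (`]l, r[%classic : set R) x -> D u -> derivable (f ^~ u) x 1.
  by rewrite /= in_itv/= halflineE => xlr u0; have [] := dKc x u xlr u0.
have G0 u : 0 <= G u by rewrite /G !mulr_ge0 ?expR_ge0.
have Gub x u : (`]l, r[%classic : set R) x -> D u -> `|partial1of2 f x u| <= G u.
  rewrite /= in_itv/= halflineE => xlr u0.
  have E : partial1of2 f x u = K1 x u * chi u.
    by rewrite partial1of2E; have [_ ->] := dKc x u xlr u0.
  by rewrite E normrM -GE ler_wpM2r// K1M.
have d := @derivable_under_integral R _ _ mu f D measurable_halfline a l r aI
   intf derf G G0 iG Gub.
have e := @differentiation_under_integral R _ _ mu f D measurable_halfline a l r aI
   intf derf G G0 iG Gub.
apply: DeriveDef; first exact: d.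
rewrite -derive1E e; apply: eq_Rintegral => u; rewrite inE halflineE => u0.
by rewrite partial1of2E; have [_ ->] := dKc a u alr u0.
Qed.

(** This is [u ^ p <= M * e ^ (tau * u)], obtained from [ln (d * u) <= d * u] with [d = tau / p]. *)
Lemma expR_ln_le (p tau : R) : 0 <= p -> 0 < tau -> exists2 M, 0 <= M &
  forall u, 0 < u -> expR (p * ln u) <= M * expR (tau * u).
Proof.
rewrite le_eqVlt => /predU1P[<- tau0|p0 tau0].
  by exists 1 => // u u0; rewrite mul0r expR0 mul1r -expR0 ler_expR mulr_ge0 ?ltW.
pose d := tau / p; have d0 : 0 < d by exact: divr_gt0.
exists (expR (p * - ln d)); first exact: expR_ge0.
move=> u u0; rewrite -expRD ler_expR.
have -> : tau * u = p * (d * u) by rewrite /d; field; rewrite gt_eqF.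
rewrite -mulrDr ler_pM2l// addrC -lerBlDr opprK -lnM ?posrE// [d * u]mulrC.
by rewrite ltW// ln_sublinear// mulr_gt0.
Qed.

End LaplaceClass.

(* The library equips [R] with two measurable structures, with the same
   measurable sets but different displays: its own and [measurableTypeR R], on
   which [lebesgue_measure] is a measure. *)
Section Display.
Context {R : realType}.
Local Notation TB := (measurableTypeR R).
Import HBSimple HBNNSimple.

Lemma ereal_sup_nnsfun (mu : set R -> \bar R) (g : R -> \bar R) :
  [set sintegral mu h | h in [set h : {nnsfun R >-> R} | forall x, ((h x)%:E <= g x)%E]] =
  [set sintegral mu h | h in [set h : {nnsfun TB >-> R} | forall x, ((h x)%:E <= g x)%E]].
Proof.
apply/seteqP; split => _ [h hg <-].
  have mh : measurable_fun [set: TB] (h : TB -> R).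
    exact: (@measurable_funPT _ _ R R h).
  pose M1 := isMeasurableFun.Build _ _ TB R (h : TB -> R) mh.
  pose M2 := FiniteImage.Build TB R (h : TB -> R) (@fimfunP _ _ h).
  pose M3 := isNonNegFun.Build TB R (h : TB -> R) (@fun_ge0 _ _ h).
  pose h2 : {nnsfun TB >-> R} := HB.pack (h : TB -> R) M1 M2 M3.
  by exists h2.
have mh : measurable_fun [set: R] (h : R -> R).
  exact: (@measurable_funPT _ _ TB R h).
pose M1 := isMeasurableFun.Build _ _ R R (h : R -> R) mh.
pose M2 := FiniteImage.Build R R (h : R -> R) (@fimfunP _ _ h).
pose M3 := isNonNegFun.Build R R (h : R -> R) (@fun_ge0 _ _ h).
pose h2 : {nnsfun R >-> R} := HB.pack (h : R -> R) M1 M2 M3.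
by exists h2.
Qed.

Lemma integral_display (mu : set R -> \bar R) (A : set R) (g : R -> \bar R) :
  @integral _ R R mu A g = @integral _ TB R mu A g.
Proof.
by rewrite /integral !ereal_sup_nnsfun.
Qed.

Lemma integrable_display (mu : set R -> \bar R) (A : set R) (g : R -> \bar R) :
  @integrable _ R R mu A g = @integrable _ TB R mu A g.
Proof.
by apply/integrableP/integrableP => -[mg ig]; split => //;
  rewrite ?integral_display// -?integral_display.
Qed.

End Display.

Section Improper.
Context {R : realType}.
Local Notation D := (@halfline R).
Local Notation mu := (@lebesgue_measure R).

Lemma LT1 : LT (fun=> 1 : R).
Proof.
move=> t t0; have ip0 := @integrable_exponential_pdf R t t0.
have ip : intD (exponential_pdf t).
  apply: (integrableS _ _ _ ip0) => //; exact: measurable_halfline.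
apply: (@eq_intD R (fun u => t^-1 * exponential_pdf t u)); last exact: intDZ ip.
move=> u u0; rewrite mulr1 exponential_pdfE ?ltW// mulrA mulVf ?gt_eqF// mul1r.
by rewrite mulNr.
Qed.

(** The fundamental theorem of calculus on compact intervals exhausting the half-line, followed by
    dominated convergence with majorant [|e|]. *)
Lemma ID_derive (E e : R -> R) :
  (forall u : R, 0 < u -> is_derive u 1 E (e u)) ->
  (forall u : R, 0 < u -> {for u, continuous e}) -> intD e ->
  E n.+2%:R^-1 @[n --> \oo] --> 0 -> E n.+2%:R @[n --> \oo] --> 0 -> ID e = 0.
Proof.
move=> dE ce ie E0 Ey.
(* Starting at 2 keeps the endpoints distinct for every [n]. *)
pose I n : set R := `[n.+2%:R^-1, n.+2%:R]%classic.
have I0 n u : I n u -> 0 < u.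
  by rewrite /I/= in_itv/= => /andP[+ _]; apply: lt_le_trans; rewrite invr_gt0.
have ID_ n : ID (e \_ (I n)) = E n.+2%:R - E n.+2%:R^-1.
  have ab : n.+2%:R^-1 < n.+2%:R :> R.
    by rewrite (@lt_trans _ _ 1)// ?invf_lt1 ?ltr1n.
  rewrite /ID /Rintegral.
  rewrite (_ : (fun x => _) = (EFin \o e) \_ (I n)); last first.
    by apply/funext => u; rewrite /patch /=; case: ifP.
  rewrite -integral_mkcondr (_ : D `&` I n = I n); last first.
    by apply/seteqP; split => [u []//|u Iu]; split => //; rewrite halflineE; exact: I0 Iu.
  rewrite (continuous_FTC2 (F := E) ab)//.
  - apply: continuous_in_subspaceT => u; rewrite inE => /I0; exact: ce.
  - have dEu (u : R) : 0 < u -> {for u, continuous E}.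
      move=> u0; apply: differentiable_continuous; apply/derivable1_diffP.
      by have [] := dE u u0.
    split.
    + move=> u; rewrite in_itv/= => /andP[au _].
      have u0 : 0 < u by apply: lt_trans au; rewrite invr_gt0.
      by have [] := dE u u0.
    + by apply: cvg_at_right_filter; apply: dEu; rewrite invr_gt0.
    + by apply: cvg_at_left_filter; apply: dEu.
  - move=> u; rewrite in_itv/= => /andP[au _]; rewrite derive1E.
    have u0 : 0 < u by apply: lt_trans au; rewrite invr_gt0.
    by have [_ ->] := dE u u0.
have : ID (e \_ (I n)) @[n --> \oo] --> ID e.
  apply: (intD_dominated_cvg _ (intD_norm ie)).
  - move=> n; apply/(measurable_restrict _ _ measurable_halfline).
      by rewrite /I; exact: measurable_itv.
    apply: measurable_funS (intD_measurable ie) => //; exact: measurable_halfline.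
  - by move=> n u u0; rewrite /patch; case: ifP => //; rewrite normr0.
  - move=> u u0; apply: cvg_near_cst.
    near=> n; rewrite /patch ifT// inE /I/= in_itv/=; apply/andP; split.
      rewrite -[leRHS]invrK lef_pV2 ?posrE ?invr_gt0//.
      rewrite (@le_trans _ _ n%:R)// ?ler_nat//; first by near: n; exact: nbhs_infty_ger.
      by rewrite ltnW.
    rewrite (@le_trans _ _ n%:R)// ?ler_nat//; first by near: n; exact: nbhs_infty_ger.
    by rewrite ltnW.
rewrite (_ : (fun n => _) = (fun n => E n.+2%:R - E n.+2%:R^-1)); last exact/funext.
move=> Ee; have L : E n.+2%:R - E n.+2%:R^-1 @[n --> \oo] --> (0 : R).
  by rewrite -[0 in X in _ --> X](subr0 0); exact: cvgB.
exact: (cvg_unique _ Ee L).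
Unshelve. all: by end_near. Qed.

End Improper.

Section ComplexLaplace.
Context {R : realType}.
Local Notation D := (@halfline R).
Local Notation mu := (@lebesgue_measure R).
Local Notation nc := (@Normc.normc R).
Implicit Types (w c : R -> R[i]).

Definition LTC w := LT (fun u => complex.Re (w u)) /\ LT (fun u => complex.Im (w u)).

(** Growth below every exponential: multiplication by such a function preserves Laplace
    integrability, at the price of an arbitrarily small part of the decay. *)
Definition subexp c :=
  [/\ measurable_fun D (fun u => complex.Re (c u)),
      measurable_fun D (fun u => complex.Im (c u)) &
      forall tau : R, 0 < tau -> exists2 M, 0 <= M &
        forall u, 0 < u -> nc (c u) <= M * expR (tau * u)].

Lemma LT_subexp (chi k : R -> R) : LT chi -> measurable_fun D k ->
  (forall tau : R, 0 < tau -> exists2 M, 0 <= M &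
     forall u, 0 < u -> `|k u| <= M * expR (tau * u)) ->
  LT (fun u => chi u * k u).
Proof.
move=> LTc mk kM t t0; have t20 : 0 < t / 2 by rewrite divr_gt0.
have [M M0 kMt] := kM _ t20.
apply: (@eq_intD R (fun u => expR (- (t * u)) * k u * chi u)).
  by move=> u _; rewrite -mulrA [k u * _]mulrC.
apply: (@LT_kernel _ _ _ M (t / 2)) => //.
  apply: measurable_funM => //.
  by under eq_fun do rewrite -mulNr; exact: measurable_expRM.
move=> u u0; rewrite normrM ger0_norm ?expR_ge0//.
rewrite (le_trans (ler_wpM2l (expR_ge0 _) (kMt _ u0)))//.
by rewrite mulrCA -expRD ler_wpM2l// ler_expR; lra.
Qed.

Lemma LTD (h k : R -> R) : LT h -> LT k -> LT (fun u => h u + k u).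
Proof.
move=> Lh Lk t t0; apply: eq_intD (intDD (Lh t t0) (Lk t t0)) => u _.
by rewrite mulrDr.
Qed.

Lemma LTZ (a : R) (h : R -> R) : LT h -> LT (fun u => a * h u).
Proof.
move=> Lh t t0; apply: eq_intD (intDZ a (Lh t t0)) => u _; exact: mulrCA.
Qed.

Lemma LTCM w c : LTC w -> subexp c -> LTC (fun u => w u * c u).
Proof.
move=> [wR wI] [cR cI cM].
have bR tau : 0 < tau -> exists2 M, 0 <= M &
     forall u, 0 < u -> `|complex.Re (c u)| <= M * expR (tau * u).
  move=> /cM[M M0 H]; exists M => // u /H; exact: le_trans (Re_le_nc _).
have bI tau : 0 < tau -> exists2 M, 0 <= M &
     forall u, 0 < u -> `|complex.Im (c u)| <= M * expR (tau * u).
  move=> /cM[M M0 H]; exists M => // u /H; exact: le_trans (Im_le_nc _).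
split.
  under eq_fun do rewrite cReM -mulN1r.
  by apply: LTD; [exact: LT_subexp|apply: LTZ; exact: LT_subexp].
under eq_fun do rewrite cImM.
by apply: LTD; exact: LT_subexp.
Qed.

Lemma laplaceE w t : laplace w t =
  ID (fun u => expR (- (t * u)) * complex.Re (w u)) +i*
  ID (fun u => expR (- (t * u)) * complex.Im (w u)).
Proof.
rewrite /laplace /integralC /ID /Rintegral.
have -> : (fun u => (complex.Re (cexp (- (t * u)%:C) * w u))%:E) =
    (fun u => (expR (- (t * u)) * complex.Re (w u))%:E).
  by apply/funext => u; rewrite -rmorphN cexp_real cReZ.
have -> : (fun u => (complex.Im (cexp (- (t * u)%:C) * w u))%:E) =
    (fun u => (expR (- (t * u)) * complex.Im (w u))%:E).
  by apply/funext => u; rewrite -rmorphN cexp_real cImZ.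
by rewrite !integral_display.
Qed.

Lemma eq_laplace w w' t : (forall u, 0 < u -> w u = w' u) -> laplace w t = laplace w' t.
Proof. by move=> ww'; rewrite !laplaceE; congr (_ +i* _); apply: eq_ID => u /ww' ->. Qed.

Lemma laplace_dom_LTC w : laplace_dom w -> LTC w.
Proof.
move=> [_ iw]; split=> t t0; have [] := iw t%:C t0;
  rewrite !integrable_display => iR iI.
  apply: eq_intD iR => u _.
  by rewrite -rmorphM -rmorphN cexp_real cReZ.
apply: eq_intD iI => u _.
by rewrite -rmorphM -rmorphN cexp_real cImZ.
Qed.

Lemma laplaceM (a : R[i]) w t : LTC w -> 0 < t ->
  laplace (fun u => a * w u) t = a * laplace w t.
Proof.
move=> [wR wI] t0; have iR := wR t t0; have iI := wI t t0.
rewrite !laplaceE; case: a => a b; apply: complex_eqP => /=.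
  rewrite -mulNr -!IDZ// -IDD; [|exact: intDZ|exact: intDZ].
  by apply: eq_ID => u _; rewrite cReM /=; ring.
rewrite -!IDZ// -IDD; [|exact: intDZ|exact: intDZ].
by apply: eq_ID => u _; rewrite cImM /=; ring.
Qed.

Lemma subexp_id : subexp (fun u => u%:C).
Proof.
split; [exact: measurable_id|exact: measurable_cst|move=> tau tau0].
exists tau^-1 => [|u u0]; first by rewrite invr_ge0 ltW.
rewrite nc_real gtr0_norm// ler_pdivlMl//.
have := @expR_ge1Dx R (tau * u); lra.
Qed.

Lemma cder_laplace w t : LTC w -> 0 < t ->
  cder (laplace w) t (- laplace (fun u => w u * u%:C) t).
Proof.
(* For [x > t / 2] the factor [u] is absorbed by [expR (t / 4 * u)], which leaves the decay
   [expR (- (t / 4 * u))] uniformly in [x]. *)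
move=> [wR wI] t0; have t40 : 0 < t / 4 by rewrite divr_gt0.
have [_ _ /(_ _ t40)[M M0 uM]] := subexp_id.
have lt2 : t / 2 < t < 2 * t by lra.
have t0x x : t / 2 < x -> 0 < x by move=> ?; lra.
have H (chi : R -> R) : LT chi ->
    is_derive t 1 (fun x => ID (fun u => expR (- (x * u)) * chi u))
      (ID (fun u => - u * expR (- (t * u)) * chi u)).
  move=> LTchi.
  apply: (@is_derive_kernel R chi (fun x u => expR (- (x * u)))
      (fun x u => - u * expR (- (x * u))) t (t / 2) (2 * t) (1 + M) (t / 4)) => //.
  - by rewrite addr_ge0.
  - by move=> x _; under eq_fun do rewrite -mulNr; exact: measurable_expRM.
  - move=> x u /andP[tx _] u0; rewrite ger0_norm ?expR_ge0// -[leLHS]mul1r ler_pM ?expR_ge0//.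
      by rewrite lerDl.
    by rewrite ler_expR; nra.
  - move=> x u _ _.
    have H1 : is_derive x 1 (fun x => - (x * u)) (- u).
      rewrite [X in is_derive _ _ X _](_ : _ = (fun x => - u * x)).
        have := is_deriveZ (- u) (is_derive_id x (1 : R)).
        by rewrite /GRing.scale/= mulr1.
      by apply/funext => y; rewrite mulNr mulrC.
    apply: (is_derive_eq (is_derive1_comp (is_derive_expR _) H1)).
    by rewrite mulrC.
  - move=> x u /andP[tx _] u0.
    rewrite normrM normrN (gtr0_norm u0) ger0_norm ?expR_ge0//.
    have := uM _ u0; rewrite nc_real (gtr0_norm u0) => uMu.
    rewrite (@le_trans _ _ (M * expR (t / 4 * u) * expR (- (x * u))))//.
      by rewrite ler_wpM2r ?expR_ge0.
    rewrite -mulrA -expRD ler_pM ?expR_ge0//; first by rewrite lerDr.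
    by rewrite ler_expR; nra.
have [LR LI] := LTCM (conj wR wI) subexp_id.
rewrite laplaceE; split.
  under eq_fun do rewrite laplaceE/=.
  apply: (is_derive_eq (H _ wR)).
  rewrite /= -mulN1r -IDZ; last exact: LR.
  by apply: eq_ID => u _; rewrite cReM /=; ring.
under eq_fun do rewrite laplaceE/=.
apply: (is_derive_eq (H _ wI)).
rewrite /= -mulN1r -IDZ; last exact: LI.
by apply: eq_ID => u _; rewrite cImM /=; ring.
Qed.

End ComplexLaplace.

(** * Complex powers and the functional equation of Gamma *)

Section Cpow.
Context {R : realType}.
Local Notation D := (@halfline R).
Local Notation nc := (@Normc.normc R).
Implicit Types (u : R) (z w : R[i]).

Lemma cder_continuous (f : R -> R[i]) (x : R) l : cder f x l ->
  {for x, continuous (fun y => complex.Re (f y))} /\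
  {for x, continuous (fun y => complex.Im (f y))}.
Proof.
by move=> [[f1 _] [f2 _]]; split; apply: differentiable_continuous; apply/derivable1_diffP.
Qed.

Lemma cder_cexp (f : R -> R[i]) (x : R) l : cder f x l ->
  cder (fun y => cexp (f y)) x (l * cexp (f x)).
Proof.
move=> [f1 f2].
have e1 := is_derive1_comp (is_derive_expR _) f1.
have c2 := is_derive1_comp (is_derive_cos _) f2.
have s2 := is_derive1_comp (is_derive_sin _) f2.
split.
  under eq_fun do rewrite Re_cexp.
  apply: (is_derive_eq (is_deriveM e1 c2)).
  by rewrite /GRing.scale/= cReM Re_cexp Im_cexp; ring.
under eq_fun do rewrite Im_cexp.
apply: (is_derive_eq (is_deriveM e1 s2)).
by rewrite /GRing.scale/= cImM Re_cexp Im_cexp; ring.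
Qed.

Lemma nc_cpow u z : nc (cpow u z) = expR (complex.Re z * ln u).
Proof. by rewrite nc_cexp cReM /= mulr0 subr0. Qed.

Lemma cpowD u z w : cpow u (z + w) = cpow u z * cpow u w.
Proof. by rewrite /cpow mulrDl cexpD. Qed.

Lemma cpow1 u : 0 < u -> cpow u 1 = u%:C.
Proof. by move=> u0; rewrite /cpow mul1r cexp_real lnK. Qed.

Lemma cpow0 u : cpow u 0 = 1.
Proof. by rewrite /cpow mul0r cexp0. Qed.

Lemma cder_cpow u z : 0 < u -> cder (fun u => cpow u z) u (z * cpow u (z - 1)).
Proof.
move=> u0.
have l : cder (fun u => (ln u)%:C) u (u^-1)%:C.
  by split => /=; [exact: is_derive1_ln|exact: is_derive_cst].
have := cder_cexp (cder_cstM z l).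
rewrite -/(cpow u z) -[in cpow u z](subrK 1 z) [cpow u (z - 1 + 1)]cpowD cpow1//.
rewrite [X in cder _ _ X -> _](_ : _ = z * cpow u (z - 1))//.
have : u%:C != 0 :> R[i] by apply/eqP => -[] /eqP; rewrite gt_eqF.
rewrite mulrA fmorphV => u0'.
by field.
Qed.

Lemma subexp_cpow z : 0 <= complex.Re z -> subexp (fun u => cpow u z).
Proof.
move=> z0; split.
- apply: continuous_measurable_halfline => u u0.
  by have [] := cder_continuous (cder_cpow z u0).
- apply: continuous_measurable_halfline => u u0.
  by have [] := cder_continuous (cder_cpow z u0).
- move=> tau tau0; have [M M0 H] := expR_ln_le z0 tau0.
  by exists M => // u u0; rewrite nc_cpow H.
Qed.

Lemma LTC1 : LTC (fun=> 1 : R[i]).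
Proof.
split; first exact: LT1.
by move=> t t0; apply: eq_intD (intDZ 0 (LT1 t0)) => u _; rewrite mul0r mulr0.
Qed.

Lemma LTC_cpow z : 0 <= complex.Re z -> LTC (fun u => cpow u z).
Proof.
move=> z0; have [LR LI] := LTCM LTC1 (subexp_cpow z0).
by split => t t0; [apply: eq_intD (LR t t0)|apply: eq_intD (LI t t0)] => u _; rewrite mul1r.
Qed.

Lemma LTCZ (c : R[i]) (w : R -> R[i]) : LTC w -> LTC (fun u => c * w u).
Proof.
move=> [wR wI]; split.
  under eq_fun do rewrite cReM -mulNr.
  by apply: LTD; exact: LTZ.
under eq_fun do rewrite cImM.
by apply: LTD; exact: LTZ.
Qed.

Lemma LTCD (v w : R -> R[i]) : LTC v -> LTC w -> LTC (fun u => v u + w u).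
Proof.
move=> [vR vI] [wR wI]; split.
  by under eq_fun do rewrite cReD; exact: LTD.
by under eq_fun do rewrite cImD; exact: LTD.
Qed.

Lemma laplaceD (v w : R -> R[i]) (t : R) : LTC v -> LTC w -> 0 < t ->
  laplace (fun u => v u + w u) t = laplace v t + laplace w t.
Proof.
move=> [vR vI] [wR wI] t0; rewrite !laplaceE; apply: complex_eqP => /=.
  rewrite -IDD; [|exact: vR|exact: wR].
  by apply: eq_ID => u _; rewrite cReD mulrDr.
rewrite -IDD; [|exact: vI|exact: wI].
by apply: eq_ID => u _; rewrite cImD mulrDr.
Qed.

(** The derivative of [E u = e^(-u) u^z] is [e^(-u) (z u^(z-1) - u^z)], and [E] tends to 0 at both
    ends of the half-line. *)
Lemma GammaS z : 1 < complex.Re z -> Gamma (z + 1) = z * Gamma z.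
Proof.
move=> z1; rewrite /Gamma addrK.
have z0 : 0 <= complex.Re z by lra.
have z10 : 0 <= complex.Re (z - 1) by rewrite cReD cReN /=; lra.
have L1 := LTC_cpow z0; have L2 := LTC_cpow z10.
apply/eqP; rewrite eq_sym -subr_eq0 -laplaceM// -[X in _ + X]mulN1r.
rewrite -laplaceM// -laplaceD//; [|exact: LTCZ|exact: LTCZ].
pose e u : R[i] := z * cpow u (z - 1) - cpow u z.
pose E u : R[i] := (expR (- u))%:C * cpow u z.
have dexp u : cder (fun u => (expR (- u))%:C) u (- (expR (- u))%:C).
  split => /=; last by rewrite oppr0; exact: is_derive_cst.
  by have := is_derive1_comp (is_derive_expR _) (is_deriveNid u (1 : R)); rewrite mulrN1.
have dE u : 0 < u -> cder E u ((expR (- u))%:C * e u).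
  move=> u0; have := cderM (dexp u) (cder_cpow z u0).
  by rewrite [X in cder _ _ X -> _](_ : _ = (expR (- u))%:C * e u)// /e; ring.
have ce u : 0 < u ->
    {for u, continuous (fun u => complex.Re ((expR (- u))%:C * e u))} /\
    {for u, continuous (fun u => complex.Im ((expR (- u))%:C * e u))}.
  move=> u0; apply: cder_continuous; apply: cderM (dexp u) _.
  apply: cderD; first exact: (cder_cstM z (cder_cpow (z - 1) u0)).
  exact: (cderN (cder_cpow z u0)).
have ncE u : nc (E u) = expR (- u) * expR (complex.Re z * ln u).
  by rewrite /E Normc.normcM nc_real ger0_norm ?expR_ge0// nc_cpow.
have E0 : E n.+2%:R^-1 @[n --> \oo] --> (0 : R[i]).
  apply/cvgC_nc; apply/cvgrPdist_lt => d d0.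
  near=> n; rewrite sub0r normrN ger0_norm ?nc_ge0// subr0 ncE.
  have n0 : 0 < n.+2%:R :> R by [].
  rewrite (@le_lt_trans _ _ (n.+2%:R^-1))//.
    rewrite -[leRHS]mul1r ler_pM ?expR_ge0//.
    rewrite -[leRHS]lnK ?posrE ?invr_gt0// ler_expR -[leRHS]mul1r ler_wnM2r//.
      by rewrite ln_le0// invf_le1// ler1n.
    exact: ltW.
  rewrite invf_plt ?posrE//; apply: (@lt_le_trans _ _ n%:R).
    by near: n; exact: nbhs_infty_gtr.
  by rewrite ler_nat -addn2 leq_addr.
have Ey : E n.+2%:R @[n --> \oo] --> (0 : R[i]).
  (* Bounding one power more than occurs in [E] gives [nc (E u) <= M / u], which tends to 0. *)
  have [||M M0 H] := @expR_ln_le R (complex.Re z + 1) 1 => //; first by lra.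
  apply/cvgC_nc; apply/cvgrPdist_lt => d d0.
  near=> n; rewrite sub0r normrN ger0_norm ?nc_ge0// subr0 ncE.
  have n0 : 0 < n.+2%:R :> R by [].
  rewrite (@le_lt_trans _ _ (M / n.+2%:R))//.
    rewrite ler_pdivlMr// -[X in _ * X]lnK ?posrE// -mulrA -expRD.
    rewrite -[X in _ + X]mul1r -mulrDl.
    rewrite (le_trans (ler_wpM2l (expR_ge0 _) (H _ n0)))//.
    by rewrite mulrCA -expRD mul1r addrC subrr expR0 mulr1.
  rewrite ltr_pdivrMr// mulrC -ltr_pdivrMr//; apply: (@lt_le_trans _ _ n%:R).
    by near: n; exact: nbhs_infty_gtr.
  by rewrite ler_nat -addn2 leq_addr.
have Le : LTC e.
  have := LTCD (LTCZ z L2) (LTCZ (-1) L1).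
  by congr LTC; apply/funext => u; rewrite /e mulN1r.
rewrite (@eq_laplace _ _ e); last by move=> u _; rewrite /e mulN1r.
rewrite laplaceE; apply/eqP.
have [LeR LeI] := Le.
have /cvgC_ReIm[ER0 EI0] := E0; have /cvgC_ReIm[ERy EIy] := Ey.
apply: complex_eqP => /=.
  apply: (@ID_derive _ (fun u => complex.Re (E u)) _ _ _ _ ER0 ERy).
  - move=> u u0; have [d _] := dE u u0; apply: (is_derive_eq d).
    by rewrite cReZ mul1r.
  - move=> u u0; have [c _] := ce u u0.
    rewrite [X in {for u, continuous X}](_ : _ =
      fun u => complex.Re ((expR (- u))%:C * e u)) //.
    by apply/funext => v; rewrite mul1r -cReZ.
  - exact: LeR.
apply: (@ID_derive _ (fun u => complex.Im (E u)) _ _ _ _ EI0 EIy).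
- move=> u u0; have [_ d] := dE u u0; apply: (is_derive_eq d).
  by rewrite cImZ mul1r.
- move=> u u0; have [_ c] := ce u u0.
  rewrite [X in {for u, continuous X}](_ : _ =
      fun u => complex.Im ((expR (- u))%:C * e u)) //.
    by apply/funext => v; rewrite mul1r -cImZ.
- exact: LeI.
Unshelve. all: by end_near. Qed.

End Cpow.

(** * The differential equation relating [f(s, .)] and [f(s - 1, .)] *)

Section ODE.
Context {R : realType}.
Implicit Types (z s : R[i]) (t : R).

Lemma cder_deriveC (g : R -> R[i]) t l : cder g t l -> deriveC g t = l.
Proof.
move=> [[_ d1] [_ d2]]; rewrite /deriveC !derive1E.
by apply: complex_eqP => /=; [exact: d1|exact: d2].
Qed.

Lemma derivableC_cder (g : R -> R[i]) t : derivableC g t -> cder g t (deriveC g t).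
Proof.
by move=> [d1 d2]; split; rewrite /deriveC/= derive1E; exact: derivableP.
Qed.

Lemma near_cder (g h : R -> R[i]) t l : 0 < t -> (forall t, 0 < t -> g t = h t) ->
  cder h t l -> cder g t l.
Proof.
move=> t0 gh [d1 d2]; split.
  apply: near_eq_is_derive d1; near=> x.
  by rewrite gh//; near: x; exact: lt_nbhsr.
apply: near_eq_is_derive d2; near=> x.
by rewrite gh//; near: x; exact: lt_nbhsr.
Unshelve. all: by end_near. Qed.

(** The function whose Laplace transform is [f (- s)] for [1 < Re s]. *)
Definition laplace_weight (phi : R -> R[i]) s (u : R) : R[i] :=
  phi u * cpow u (s - 1) / Gamma s.

Lemma LTC_weight phi s : laplace_dom phi -> 1 < complex.Re s ->
  LTC (laplace_weight phi s).
Proof.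
move=> /laplace_dom_LTC Lphi s1.
have s0 : 0 <= complex.Re (s - 1) by rewrite cReD cReN /=; lra.
have := LTCZ (Gamma s)^-1 (LTCM Lphi (subexp_cpow s0)).
by congr LTC; apply/funext => u; rewrite mulrC.
Qed.

(* Both sides are entire in [s] and agree for [Re s < -1] by differentiating
   under the integral and [Gamma (v + 1) = v * Gamma v]. *)
Lemma cder_calH (f : R[i] -> R -> R[i]) s t : calH f -> 0 < t ->
  cder (f s) t (s * f (s - 1) t).
Proof.
move=> [fd [fe [fde [phi [Lphi _ _ fphi]]]]] t0.
suff fG : deriveC (f s) t - s * f (s - 1) t = 0.
  by move/eqP : fG; rewrite subr_eq0 => /eqP <-; exact/derivableC_cder/fd.
move: s; apply: (@cdiff_eq0 _ _ (-1)) => z.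
  apply: cdiffD; first exact: (derivable_cdiff (fde t t0 z)).
  apply: cdiffN; apply: cdiffM; first exact: cdiff_id.
  apply: (@cdiff_comp _ (fun s => f s t)); last exact: (derivable_cdiff (fe t t0 _)).
  by apply: cdiffD; [exact: cdiff_id|exact: cdiff_cst].
move=> z1; pose v := - z; have -> : z = - v by rewrite opprK.
have v1 : 1 < complex.Re v by rewrite cReN; lra.
have v2 : 1 < complex.Re (v + 1) by rewrite cReD /=; lra.
have Lv := LTC_weight Lphi v1.
have d : cder (f (- v)) t (- laplace (fun u => laplace_weight phi v u * u%:C) t).
  apply: near_cder t0 _ (cder_laplace Lv t0) => x x0.
  by rewrite fphi.
rewrite (cder_deriveC d); have -> : - v - 1 = - (v + 1) by rewrite opprD.
rewrite fphi// mulNr opprK -laplaceM//; last exact: LTC_weight.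
apply/eqP; rewrite addrC subr_eq0; apply/eqP/eq_laplace => u u0.
rewrite /laplace_weight GammaS// addrK.
have -> : cpow u v = cpow u (v - 1) * u%:C.
  by rewrite -(cpow1 u0) -cpowD subrK.
(* If [Gamma v = 0], both sides vanish by the convention [0^-1 = 0]. *)
have [G0|G0] := eqVneq (Gamma v) 0; first by rewrite G0 !(mulr0, invr0, mul0r).
have v0 : v != 0 by apply: contraTneq v1 => ->; rewrite /= ltr10.
by field; rewrite G0 v0.
Qed.

End ODE.

(** * Symbols of finite linear combinations *)

Section TaylorSum.
Context {R : realType}.
Implicit Types (a : nat -> R) (x : R).

(** The Taylor polynomial at 1 of degree below [j] with derivatives [a k] there; 1 serves as a base
    point common to all arguments. *)
Definition taylor_sum a j x := \sum_(k < j) a k * (x - 1) ^+ k / k`!%:R.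

Lemma taylor_sum_at1 a j : taylor_sum a j.+1 1 = a 0%N.
Proof.
rewrite /taylor_sum big_ord_recl/= expr0 fact0 divr1 mulr1 big1 ?addr0// => k _.
by rewrite subrr expr0n /= mulr0 mul0r.
Qed.

Lemma is_derive_taylor_sum a j x :
  is_derive x 1 (taylor_sum a j.+1) (taylor_sum (fun k => a k.+1) j x).
Proof.
elim: j => [|j ih].
  rewrite /taylor_sum big_ord0.
  rewrite [X in is_derive _ _ X _](_ : _ = cst (a 0%N)); first exact: is_derive_cst.
  by apply/funext => y; rewrite big_ord_recl big_ord0 expr0 fact0 divr1 mulr1 addr0.
rewrite [X in is_derive _ _ X _](_ : _ =
    taylor_sum a j.+1 + (fun x => a j.+1 / j.+1`!%:R * (x - 1) ^+ j.+1)); last first.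
  by apply/funext => y; rewrite /taylor_sum big_ord_recr/= -[RHS]/(_ + _) mulrAC.
have d1 : is_derive x 1 (fun x : R => x - 1) 1.
  have := is_deriveB (is_derive_id x 1) (is_derive_cst (1 : R) x 1).
  by rewrite subr0.
have d2' : is_derive x 1 (fun x : R => (x - 1) ^+ j.+1) (j.+1%:R * (x - 1) ^+ j).
  have := is_deriveX j.+1 d1; rewrite exprfctE => /is_derive_eq; apply.
  by rewrite /GRing.scale/= mulr1 mulr_natl.
have d2 := is_deriveZ (a j.+1 / j.+1`!%:R) d2'.
apply: (is_derive_eq (is_deriveD ih d2)).
rewrite /taylor_sum big_ord_recr/= /GRing.scale/=; congr (_ + _).
rewrite factS natrM.
have j0 : j`!%:R != 0 :> R by rewrite pnatr_eq0 -lt0n fact_gt0.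
have jS0 : j.+1%:R != 0 :> R by rewrite pnatr_eq0.
by field; rewrite j0 addrC natr1.
Qed.

(** Letting [u] tend to 0 kills the constant coefficient; dividing by [u] then lowers [n] by one. *)
Lemma littleo_poly_eq0 n (b : nat -> R) (C : R) :
  (forall u, 0 < u < 1 -> `|\sum_(k < n) b k * u ^+ k| <= C * u ^+ n) ->
  forall k, (k < n)%N -> b k = 0.
Proof.
elim: n b => [//|n ih] b bC.
have C0 : 0 <= C.
  have h : 0 < (1 / 2 : R) < 1 by apply/andP; split; lra.
  have := le_trans (normr_ge0 _) (bC _ h).
  by rewrite pmulr_lge0// exprn_gt0//; lra.
pose B := \sum_(k < n) `|b k.+1|.
have B0 : 0 <= B by apply: sumr_ge0.
have bE u : \sum_(k < n.+1) b k * u ^+ k = b 0%N + u * \sum_(k < n) b k.+1 * u ^+ k.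
  rewrite big_ord_recl/= expr0 mulr1; congr (_ + _).
  by rewrite mulr_sumr; apply: eq_bigr => k _; rewrite /bump/= exprS mulrCA.
have b00 : b 0%N = 0.
  apply/eqP; rewrite -normr_eq0 eq_le normr_ge0 andbT.
  apply/ler_addgt0Pl => e e0; rewrite addr0.
  pose u := Num.min (1/2) (e / (C + B + 1)).
  have CB : 0 < C + B + 1 by lra.
  have u0 : 0 < u by rewrite lt_min; apply/andP; split; [lra|exact: divr_gt0].
  have u12 : u <= 1/2 by rewrite ge_min lexx.
  have u1 : 0 < u < 1 by apply/andP; split; [exact: u0|lra].
  have ue : u * (C + B + 1) <= e by rewrite -ler_pdivlMr// ge_min lexx orbT.
  have u0' := ltW u0; have u1' : u <= 1 by lra.
  have := bC u u1; rewrite bE.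
  set S := \sum_(k < n) _ => H.
  have S_B : `|S| <= B.
    rewrite /S (le_trans (ler_norm_sum _ _ _))//; apply: ler_sum => k _.
    rewrite normrM -[leRHS]mulr1 ler_wpM2l// ger0_norm ?exprn_ge0// exprn_ile1//.
  have -> : b 0%N = (b 0%N + u * S) - u * S by rewrite addrK.
  rewrite (le_trans (ler_normB _ _))//.
  have uS : `|u * S| <= u * B by rewrite normrM gtr0_norm// ler_wpM2l// ltW.
  have un : C * u ^+ n.+1 <= C * u.
    by rewrite ler_wpM2l// exprS -[leRHS]mulr1 ler_wpM2l// exprn_ile1.
  nra.
case=> [//|k]; rewrite ltnS; move: k; apply: ih => u u01.
have /andP[u0 _] := u01.
have := bC u u01; rewrite bE b00 add0r normrM gtr0_norm// exprS mulrCA.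
by rewrite ler_pM2l.
Qed.

End TaylorSum.

Section TaylorKernel.
Context {R : realType}.
Local Notation D := (@halfline R).

(* The Peano kernel of the Taylor expansion at 1 of [x |-> e^(-xu) / (-u)^j]. *)
Definition laplace_kernel j (x u : R) : R :=
  (- u) ^- j * (expR (- (x * u)) - expR (- u) * taylor_sum (fun k => (- u) ^+ k) j x).

Lemma laplace_kernel0 x u : laplace_kernel 0 x u = expR (- (x * u)).
Proof. by rewrite /laplace_kernel expr0 invr1 mul1r /taylor_sum big_ord0 mulr0 subr0. Qed.

Lemma laplace_kernel_at1 j u : laplace_kernel j.+1 1 u = 0.
Proof. by rewrite /laplace_kernel taylor_sum_at1 expr0 mulr1 mul1r subrr mulr0. Qed.

Lemma is_derive_laplace_kernel j (x u : R) : 0 < u ->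
  is_derive x 1 (laplace_kernel j.+1 ^~ u) (laplace_kernel j x u).
Proof.
move=> u0.
have d1 : is_derive x 1 (fun x => - (x * u)) (- u).
  rewrite [X in is_derive _ _ X _](_ : _ = (fun x => - u * x)).
    have := is_deriveZ (- u) (is_derive_id x (1 : R)).
    by rewrite /GRing.scale/= mulr1.
  by apply/funext => y; rewrite mulNr mulrC.
have d2 := is_derive1_comp (is_derive_expR _) d1.
have d3 := is_deriveZ (expR (- u)) (is_derive_taylor_sum (fun k => (- u) ^+ k) j x).
apply: (is_derive_eq (is_deriveZ ((- u) ^- j.+1) (is_deriveB d2 d3))).
rewrite /laplace_kernel /GRing.scale/=.
have -> : taylor_sum (fun k => (- u) ^+ k.+1) j x =
    - u * taylor_sum (fun k => (- u) ^+ k) j x.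
  by rewrite mulr_sumr; apply: eq_bigr => k _; rewrite exprS -!mulrA.
rewrite exprS; have : (- u) ^+ j != 0 by rewrite expf_neq0// oppr_eq0 gt_eqF.
move: ((- u) ^+ j) => w w0.
by field; rewrite w0 /= gt_eqF.
Qed.

(** The bound has no singularity at [u = 0] in spite of the factor [(- u) ^- j]: each kernel
    vanishes at [x = 1] and has the previous one as derivative in [x], so every integration from 1
    costs a factor of at most [r - l]. *)
Lemma laplace_kernel_le j (l r x u : R) : 0 < l -> l <= 1 -> 1 <= r ->
  l <= x <= r -> 0 < u -> `|laplace_kernel j x u| <= (r - l) ^+ j * expR (- (l * u)).
Proof.
move=> l0 l1 r1 + u0; elim: j x => [|j ih] x /andP[lx xr].
  by rewrite laplace_kernel0 expr0 mul1r ger0_norm ?expR_ge0// ler_expR lerN2 ler_pM2r.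
have M0 : 0 <= (r - l) ^+ j * expR (- (l * u)).
  by rewrite mulr_ge0 ?expR_ge0// exprn_ge0//; lra.
have d y := is_derive_laplace_kernel j y u0.
rewrite exprS -mulrA mulrC.
have [x1|x1] := leP x 1.
  have := @is_derive_bounded_increment R (laplace_kernel j.+1 ^~ u)
    (laplace_kernel j ^~ u) x 1 _ x1 (fun y _ => d y).
  rewrite laplace_kernel_at1 sub0r normrN => H.
  apply: le_trans (H _ _) _.
    by move=> y /andP[xy y1]; apply: ih; lra.
  by rewrite ler_wpM2l//; lra.
have := @is_derive_bounded_increment R (laplace_kernel j.+1 ^~ u)
  (laplace_kernel j ^~ u) 1 x _ (ltW x1) (fun y _ => d y).
rewrite laplace_kernel_at1 subr0 => H.
apply: le_trans (H _ _) _.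
  by move=> y /andP[xy y1]; apply: ih; lra.
by rewrite ler_wpM2l//; lra.
Qed.

Lemma continuous_Nexp j (u : R) : {for u, continuous (fun u : R => (- u) ^+ j)}.
Proof.
apply: (@continuous_comp _ _ _ (fun u : R => - u) (fun u => u ^+ j)).
  exact: opp_continuous.
exact: exprn_continuous.
Qed.

Lemma measurable_Nexp j : measurable_fun D (fun u : R => (- u) ^+ j).
Proof. by apply: continuous_measurable_halfline => u _; exact: continuous_Nexp. Qed.

Lemma measurable_NexpV j : measurable_fun D (fun u : R => (- u) ^- j).
Proof.
apply: continuous_measurable_halfline => u u0.
apply: (@continuousV _ _ (fun u : R => (- u) ^+ j)); last exact: continuous_Nexp.
by rewrite expf_neq0// oppr_eq0 gt_eqF.
Qed.

Lemma measurable_expRN (x : R) : measurable_fun D (fun u => expR (- (x * u))).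
Proof. by under eq_fun do rewrite -mulNr; exact: measurable_expRM. Qed.

Lemma measurable_laplace_kernel j x : measurable_fun D (laplace_kernel j x).
Proof.
apply: measurable_funM; first exact: measurable_NexpV.
apply: measurable_funB; first exact: measurable_expRN.
apply: measurable_funM.
  by have := measurable_expRN 1; under eq_fun do rewrite mul1r.
rewrite /taylor_sum; under eq_fun do (under eq_bigr do rewrite -mulrA).
apply: measurable_sum => k.
by apply: measurable_funM => //; exact: measurable_Nexp.
Qed.

End TaylorKernel.

Section Chain.
Context {R : realType}.
Local Notation D := (@halfline R).
Variables (F : nat -> R -> R) (N : nat) (chi : R -> R).
Hypothesis Lchi : LT chi.
Hypothesis dF : forall k (x : R), 0 < x -> is_derive x 1 (F k) (F k.+1 x).
Hypothesis FN : forall x : R, 0 < x -> F N x = ID (fun u => expR (- (x * u)) * chi u).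

(** Induction going down from [F N]: both sides agree at 1, where the kernel vanishes, and have
    equal derivatives by the induction hypothesis for [F i.+1]. *)
Lemma taylor_laplace j i x : (i + j = N)%N -> 0 < x ->
  F i x = taylor_sum (fun k => F (i + k)%N 1) j x +
          ID (fun u => laplace_kernel j x u * chi u).
Proof.
elim: j i x => [|j ih] i x ijN x0.
  rewrite addn0 in ijN; rewrite ijN FN// /taylor_sum big_ord0 add0r.
  by apply: eq_ID => u _; rewrite laplace_kernel0.
pose H y := F i y - (taylor_sum (fun k => F (i + k)%N 1) j.+1 y +
          ID (fun u => laplace_kernel j.+1 y u * chi u)).
have dH (y : R) : 0 < y -> is_derive y 1 H 0.
  (* The interval has to contain both [y] and the base point 1 for [laplace_kernel_le] to apply. *)
  move=> y0; pose l := Num.min (y / 2) (1 / 2); pose r := 2 * (y + 1).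
  have ly2 : l <= y / 2 by rewrite ge_min lexx.
  have l12 : l <= 1 / 2 by rewrite ge_min lexx orbT.
  have l0 : 0 < l by rewrite lt_min; apply/andP; split; lra.
  have lyr : l < y < r by rewrite /r; apply/andP; split; lra.
  have l1 : l <= 1 by lra.
  have r1 : 1 <= r by rewrite /r; lra.
  have rl : 0 <= r - l by lra.
  have dI : is_derive y 1 (fun y => ID (fun u => laplace_kernel j.+1 y u * chi u))
      (ID (fun u => laplace_kernel j y u * chi u)).
    apply: (@is_derive_kernel R chi (laplace_kernel j.+1) (laplace_kernel j) y l r
       ((r - l) ^+ j.+1 + (r - l) ^+ j) l Lchi l0 _ lyr).
    - by rewrite addr_ge0 ?exprn_ge0.
    - by move=> z _; exact: measurable_laplace_kernel.
    - move=> z u /andP[/ltW lz /ltW zr] u0.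
      have lzr : l <= z <= r by rewrite lz zr.
      rewrite (le_trans (laplace_kernel_le j.+1 l0 l1 r1 lzr u0))//.
      by rewrite ler_wpM2r ?expR_ge0// lerDl exprn_ge0.
    - by move=> z u _ u0; exact: is_derive_laplace_kernel.
    - move=> z u /andP[/ltW lz /ltW zr] u0.
      have lzr : l <= z <= r by rewrite lz zr.
      rewrite (le_trans (laplace_kernel_le j l0 l1 r1 lzr u0))//.
      by rewrite ler_wpM2r ?expR_ge0// lerDr exprn_ge0.
  have := is_deriveB (dF i y0) (is_deriveD
    (is_derive_taylor_sum (fun k => F (i + k)%N 1) j y) dI).
  move/is_derive_eq; apply.
  rewrite (ih i.+1) ?addSnnS//.
  rewrite (_ : (fun k => F (i.+1 + k)%N 1) = (fun k => F (i + k.+1)%N 1)) ?subrr//.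
  by apply/funext => k; rewrite addSnnS.
have H1 : H 1 = 0.
  rewrite /H taylor_sum_at1 addn0 opprD addrA subrr add0r.
  rewrite (@eq_ID _ _ (fun=> 0 * 0)); last first.
    by move=> u _; rewrite laplace_kernel_at1 !mul0r.
  by rewrite IDZ ?mul0r ?oppr0//; exact: integrable0.
suff : H x = 0 by move/eqP; rewrite subr_eq0 => /eqP.
have b y : `|(cst 0 : R -> R) y| <= 0 by rewrite normr0.
have [x1|/ltW x1] := leP x 1.
  have := is_derive_bounded_increment x1
    (fun y xy => dH y (lt_le_trans x0 (andP xy).1)) (fun y _ => b y).
  by rewrite mul0r H1 sub0r normrN normr_le0 => /eqP.
have := is_derive_bounded_increment x1
  (fun y xy => dH y (lt_le_trans ltr01 (andP xy).1)) (fun y _ => b y).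
by rewrite mul0r H1 subr0 normr_le0 => /eqP.
Qed.

End Chain.

Section Symbol.
Context {R : realType}.
Local Notation D := (@halfline R).
Variables (F : nat -> R -> R) (N : nat) (chi : R -> R).
Hypothesis N0 : (0 < N)%N.
Hypothesis Lchi : LT chi.
Hypothesis dF : forall k (x : R), 0 < x -> is_derive x 1 (F k) (F k.+1 x).
Hypothesis FN : forall x : R, 0 < x -> F N x = ID (fun u => expR (- (x * u)) * chi u).

(* [v] is a finite linear combination of values of [F 0] and [F 1], and [e u] is
   the same combination for [F i x := (- u) ^+ i * expR (- (x * u))]. *)
Inductive has_symbol : R -> (R -> R) -> Prop :=
| has_symbol0 : has_symbol 0 (fun=> 0)
| has_symbolS c i x v e : (i <= 1)%N -> 0 < x -> has_symbol v e ->
    has_symbol (c * F i x + v) (fun u => c * ((- u) ^+ i * expR (- (x * u))) + e u).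

(** Since [F k 1] has the symbol [(- u) ^+ k * expR (- u)], this is the symbol left after
    subtracting [\sum_k al k * F k 1], divided by that of an [N]-th derivative. *)
Let rest (al : nat -> R) (e : R -> R) u :=
  (- u) ^- N * (e u - expR (- u) * \sum_(k < N) al k * (- u) ^+ k).

(* Expanding each [F i x] at 1 by [taylor_laplace]: the Taylor coefficients [al]
   of the combination are those of its symbol, and the remainder is governed by
   the Taylor remainder [rest al e] of the symbol. *)
Lemma has_symbol_taylor v e : has_symbol v e -> exists al M tau,
  [/\ 0 < tau, measurable_fun D (rest al e),
      forall u, 0 < u -> `|rest al e u| <= M * expR (- (tau * u)) &
      v = \sum_(k < N) al k * F k 1 + ID (fun u => rest al e u * chi u)].
Proof.
elim=> [|c i x {}v {}e i1 x0 _ [al [M [tau [tau0 mr rM vE]]]]].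
  exists (fun=> 0), 0, 1.
  have r0 u : rest (fun=> 0) (fun=> 0) u = 0.
    by rewrite /rest big1 ?mulr0 ?subr0 ?mulr0// => k _; rewrite mul0r.
  split => //.
  - rewrite (_ : rest _ _ = fun=> 0) //; exact/funext.
  - by move=> u _; rewrite r0 normr0 mul0r.
  - rewrite big1 ?add0r; last by move=> k _; rewrite mul0r.
    rewrite (@eq_ID _ _ (fun=> 0 * 0)) ?IDZ ?mul0r//; first exact: integrable0.
    by move=> u _; rewrite r0 !mul0r.
(* The Taylor coefficients of [F i x] at 1, counted by the order [k] of the derivative [F k 1],
   which starts at [i]. *)
pose be k : R := if (i <= k)%N then (x - 1) ^+ (k - i) / (k - i)`!%:R else 0.
pose j := (N - i)%N; have ijN : (i + j = N)%N by rewrite subnKC// (leq_trans i1).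
have beE (b : nat -> R) : \sum_(k < N) be k * b k = taylor_sum (fun k => b (i + k)%N) j x.
  rewrite -ijN big_split_ord/= big1 ?add0r; last first.
    by move=> k _; rewrite /be leqNgt ltn_ord mul0r.
  by apply: eq_bigr => k _; rewrite /be leq_addr addKn mulrC mulrA.
have kE u : 0 < u -> laplace_kernel j x u =
    rest be (fun u => (- u) ^+ i * expR (- (x * u))) u.
  move=> u0; rewrite /rest beE /laplace_kernel -ijN exprD.
  have -> : taylor_sum (fun k => (- u) ^+ (i + k)) j x =
      (- u) ^+ i * taylor_sum (fun k => (- u) ^+ k) j x.
    by rewrite mulr_sumr; apply: eq_bigr => k _; rewrite exprD -!mulrA.
  have : (- u) ^+ i != 0 by rewrite expf_neq0// oppr_eq0 gt_eqF.
  have : (- u) ^+ j != 0 by rewrite expf_neq0// oppr_eq0 gt_eqF.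
  move: ((- u) ^+ i) ((- u) ^+ j) => y z z0 y0; field; by rewrite z0 y0.
have rE u : rest (fun k => c * be k + al k)
    (fun u => c * ((- u) ^+ i * expR (- (x * u))) + e u) u =
    c * rest be (fun u => (- u) ^+ i * expR (- (x * u))) u + rest al e u.
  rewrite /rest; under eq_bigr do rewrite mulrDl -mulrA.
  by rewrite big_split/= -mulr_sumr; ring.
pose l := Num.min (x / 2) 1; pose r := x + 1.
have lx2 : l <= x / 2 by rewrite ge_min lexx.
have l1 : l <= 1 by rewrite ge_min lexx orbT.
have l0 : 0 < l by rewrite lt_min ltr01 andbT; lra.
have lxr : l <= x <= r by rewrite /r; apply/andP; split; lra.
have r1 : 1 <= r by rewrite /r; lra.
have kM u : 0 < u -> `|laplace_kernel j x u| <= (r - l) ^+ j * expR (- (l * u)).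
  by move=> u0; exact: laplace_kernel_le.
exists (fun k => c * be k + al k), (`|c| * (r - l) ^+ j + `|M|), (Num.min l tau).
have mb : measurable_fun D (rest be (fun u => (- u) ^+ i * expR (- (x * u)))).
  apply: measurable_funM; first exact: measurable_NexpV.
  apply: measurable_funB.
    by apply: measurable_funM; [exact: measurable_Nexp|exact: measurable_expRN].
  apply: measurable_funM.
    by have := @measurable_expRN R 1; under eq_fun do rewrite mul1r.
  by apply: measurable_sum => k; apply: measurable_funM => //; exact: measurable_Nexp.
split.
- by rewrite lt_min l0.
- rewrite (_ : rest _ _ = fun u =>
      c * rest be (fun u => (- u) ^+ i * expR (- (x * u))) u + rest al e u).
    by apply: measurable_funD => //; apply: measurable_funM.
  by apply/funext => u; exact: rE.
- move=> u u0; rewrite rE (le_trans (ler_normD _ _))// mulrDl lerD//.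
    rewrite normrM -mulrA ler_wpM2l// -kE// (le_trans (kM _ u0))//.
    rewrite ler_wpM2l ?exprn_ge0//; first by lra.
    by rewrite ler_expR lerN2 ler_pM2r// ge_min lexx.
  rewrite (le_trans (rM _ u0))// (@le_trans _ _ (`|M| * expR (- (tau * u))))//.
    by rewrite ler_wpM2r ?expR_ge0// ler_norm.
  by rewrite ler_wpM2l// ler_expR lerN2 ler_pM2r// ge_min lexx orbT.
- under [in RHS]eq_bigr do rewrite mulrDl -mulrA.
  rewrite big_split/= -mulr_sumr (beE (fun k => F k 1)).
  have i1b : intD (fun u => rest be (fun u => (- u) ^+ i * expR (- (x * u))) u * chi u).
    by apply: (LT_kernel Lchi l0 mb) => u u0; rewrite -kE//; exact: kM.
  have i1a : intD (fun u => rest al e u * chi u) by exact: (LT_kernel Lchi tau0 mr rM).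
  set b1 := rest be _ in i1b *.
  rewrite [X in _ = _ + X](@eq_ID _ _
    (fun u => c * (b1 u * chi u) + rest al e u * chi u)); last first.
    by move=> u _; rewrite rE mulrDl -mulrA.
  rewrite IDD//; last exact: intDZ.
  rewrite IDZ// (taylor_laplace Lchi dF FN ijN x0) vE.
  rewrite (@eq_ID _ (fun u => laplace_kernel j x u * chi u) _
    (fun u u0 => congr1 (fun y => y * chi u) (kE u u0))).
  by ring.
Qed.

(* A symbol vanishing to order [N] at 0 has [al = 0], so only the integral
   survives. *)
Lemma has_symbol_eq v e (C tau : R) : has_symbol v e -> 0 < tau ->
  (forall u, 0 < u -> `|e u| <= C * (u ^+ N * expR (- (tau * u)))) ->
  measurable_fun D (fun u => (- u) ^- N * e u) /\
  v = ID (fun u => (- u) ^- N * e u * chi u).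
Proof.
move=> /has_symbol_taylor[al [M [tau' [tau'0 mr rM vE]]]] tau0 eC.
have al0 k : (k < N)%N -> al k = 0.
  move=> kN; suff : al k * (-1) ^+ k = 0.
    by move/eqP; rewrite mulf_eq0 signr_eq0 orbF => /eqP.
  (* Solving the definition of [rest] for the polynomial multiplies by [expR u], at most [expR 1]
     for [u < 1]; [|C|] bounds the symbol and [|M|] the remainder. *)
  apply: (@littleo_poly_eq0 _ N (fun k => al k * (-1) ^+ k) (expR 1 * (`|C| + `|M|))) kN.
  move=> u /andP[u0 u1].
  have -> : \sum_(k0 < N) al k0 * (-1) ^+ k0 * u ^+ k0 =
      expR u * (e u - (- u) ^+ N * rest al e u).
    rewrite /rest mulrA divff ?expf_neq0 ?oppr_eq0 ?gt_eqF// mul1r opprB addrC subrK.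
    rewrite mulrA -expRD subrr expR0 mul1r; apply: eq_bigr => i _.
    by rewrite -mulrA -exprMn mulN1r.
  rewrite normrM ger0_norm ?expR_ge0// -mulrA ler_pM ?expR_ge0//.
    by rewrite ler_expR ltW.
  rewrite (le_trans (ler_normB _ _))// mulrDl.
  have uN : 0 <= u ^+ N by rewrite exprn_ge0// ltW.
  have ex (y : R) : 0 < y -> expR (- (y * u)) <= 1.
    by move=> y0; rewrite -[leRHS]expR0 ler_expR oppr_le0 mulr_ge0// ltW.
  rewrite lerD//.
    rewrite (le_trans (eC _ u0))// (@le_trans _ _ (`|C| * (u ^+ N * expR (- (tau * u)))))//.
      by rewrite ler_wpM2r ?mulr_ge0 ?expR_ge0// ler_norm.
    by rewrite ler_wpM2l// -[leRHS]mulr1 ler_wpM2l// ex.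
  rewrite normrM normrX normrN (gtr0_norm u0) mulrC ler_wpM2r//.
  rewrite (le_trans (rM _ u0))// (@le_trans _ _ (`|M| * expR (- (tau' * u))))//.
    by rewrite ler_wpM2r ?expR_ge0// ler_norm.
  by rewrite -[leRHS]mulr1 ler_wpM2l// ex.
have rE u : rest al e u = (- u) ^- N * e u.
  by rewrite /rest big1 ?mulr0 ?subr0// => k _; rewrite al0// mul0r.
split; first by rewrite (_ : (fun u => _) = rest al e) //; apply/funext => u; rewrite rE.
rewrite vE big1 ?add0r; last by move=> k _; rewrite al0// mul0r.
by apply: eq_ID => u _; rewrite rE.
Qed.

(** Dominated convergence: division by [(- u) ^+ N] turns the bound on the symbols into the
    integrable majorant [|C| * expR (- (tau * u)) * |chi u|]. *)
Lemma has_symbol_cvg (v : nat -> R) (e : nat -> R -> R) e0 (C tau : R) :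
  (forall K, has_symbol (v K) (e K)) -> 0 < tau ->
  (forall K u, 0 < u -> `|e K u| <= C * (u ^+ N * expR (- (tau * u)))) ->
  (forall u, 0 < u -> e K u @[K --> \oo] --> e0 u) ->
  v K @[K --> \oo] --> ID (fun u => (- u) ^- N * e0 u * chi u).
Proof.
move=> ve tau0 eC ee0.
have h K := has_symbol_eq (ve K) tau0 (eC K).
have -> : v = fun K => ID (fun u => (- u) ^- N * e K u * chi u).
  by apply/funext => K; have [] := h K.
apply: (@intD_dominated_cvg _ (fun K u => (- u) ^- N * e K u * chi u) _
    (fun u => `|C| * (`|expR (- (tau * u)) * chi u|))).
- by move=> K; apply: measurable_funM; [have [] := h K|exact: LT_measurable].
- by apply: intDZ; apply: intD_norm; exact: Lchi.
- move=> K u u0; rewrite !normrM mulrA ler_wpM2r// normfV normrX normrN (gtr0_norm u0).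
  rewrite [`|expR _|]ger0_norm ?expR_ge0// ler_pdivrMl ?exprn_gt0//.
  rewrite (le_trans (eC _ _ u0))// mulrCA ler_wpM2l//; first by rewrite exprn_ge0// ltW.
  by rewrite ler_wpM2r ?expR_ge0// ler_norm.
- move=> u u0; apply: cvgM; last exact: cvg_cst.
  by apply: cvgM; [exact: cvg_cst|exact: ee0].
Qed.

End Symbol.

(** * Symbols of complex combinations and geometric convergence of symbols *)

Section ComplexSymbol.
Context {R : realType}.
Variable F : nat -> R -> R[i].
Implicit Types (e : R -> R).

(** The coefficients stay real although [F] is complex, so that the real and the imaginary part of a
    combination have the same symbol. *)
Inductive csymbol : R[i] -> (R -> R) -> Prop :=
| csymbol0 : csymbol 0 (fun=> 0)
| csymbolS c i x v e : (i <= 1)%N -> 0 < x -> csymbol v e ->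
    csymbol (c%:C * F i x + v) (fun u => c * ((- u) ^+ i * expR (- (x * u))) + e u).

(** Only values at [u > 0] enter the integrals, so symbols are identified when they agree there. *)
Definition sym v e := exists2 e', csymbol v e' & forall u, 0 < u -> e' u = e u.

Lemma eq_sym_symbol v e e' : (forall u, 0 < u -> e u = e' u) -> sym v e -> sym v e'.
Proof. by move=> ee' [e1 v1 e1E]; exists e1 => // u u0; rewrite e1E// ee'. Qed.

Lemma sym0 : sym 0 (fun=> 0).
Proof. by exists (fun=> 0) => //; exact: csymbol0. Qed.

Lemma sym_pt i x : (i <= 1)%N -> 0 < x ->
  sym (F i x) (fun u => (- u) ^+ i * expR (- (x * u))).
Proof.
move=> i1 x0; exists (fun u => 1 * ((- u) ^+ i * expR (- (x * u))) + 0).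
  by have := csymbolS 1 i1 x0 csymbol0; rewrite mul1r addr0.
by move=> u _; rewrite mul1r addr0.
Qed.

Lemma symD v w e e' : sym v e -> sym w e' -> sym (v + w) (fun u => e u + e' u).
Proof.
move=> [e1 v1 e1E] [e2 w2 e2E]; exists (fun u => e1 u + e2 u); last first.
  by move=> u u0; rewrite e1E// e2E.
elim: v1 {e1E} => [|c i x {}v {}e1 i1 x0 _ ih].
  by rewrite add0r (_ : (fun u => _) = e2) //; apply/funext => u; rewrite add0r.
rewrite -addrA.
rewrite (_ : (fun u => _) = fun u => c * ((- u) ^+ i * expR (- (x * u))) + (e1 u + e2 u)).
  exact: csymbolS.
by apply/funext => u; rewrite addrA.
Qed.

Lemma symZ (c : R) v e : sym v e -> sym (c%:C * v) (fun u => c * e u).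
Proof.
move=> [e1 v1 e1E]; exists (fun u => c * e1 u); last by move=> u u0; rewrite e1E.
elim: v1 {e1E} => [|d i x {}v {}e1 i1 x0 _ ih].
  by rewrite mulr0 (_ : (fun u => _) = fun=> 0); [exact: csymbol0|apply/funext => u; rewrite mulr0].
rewrite mulrDr mulrA -rmorphM.
rewrite (_ : (fun u => _) = fun u => (c * d) * ((- u) ^+ i * expR (- (x * u))) + c * e1 u).
  exact: csymbolS.
by apply/funext => u; rewrite mulrDr mulrA.
Qed.

Lemma symB v w e e' : sym v e -> sym w e' -> sym (v - w) (fun u => e u - e' u).
Proof.
move=> ve we; have := symD ve (symZ (-1) we); rewrite rmorphN1 mulN1r.
by apply: eq_sym_symbol => u _; rewrite mulN1r.
Qed.

Lemma sym_sum (I : Type) (r : seq I) (v : I -> R[i]) (e : I -> R -> R) :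
  (forall i, sym (v i) (e i)) -> sym (\sum_(i <- r) v i) (fun u => \sum_(i <- r) e i u).
Proof.
move=> ve; elim: r => [|i r ih].
  by rewrite big_nil; apply: eq_sym_symbol sym0 => u _; rewrite big_nil.
rewrite big_cons; apply: eq_sym_symbol (symD (ve i) ih) => u _.
by rewrite big_cons.
Qed.

(* The factor [(1 - e^(-cu)) ^ K] vanishes to order [K] at 0, so that
   [has_symbol_eq] applies to the differences as soon as [N <= K]. *)
Definition tends (v : nat -> R[i]) e := exists ek M tau c,
  [/\ forall K, sym (v K) (ek K), 0 <= M, 0 < tau /\ 0 < c &
   forall K u, 0 < u ->
     `|ek K u - e u| <= M * expR (- (tau * u)) * (1 - expR (- (c * u))) ^+ K].

Lemma eq_tends v e e' : (forall u, 0 < u -> e u = e' u) -> tends v e -> tends v e'.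
Proof.
move=> ee' [ek [M [tau [c [H1 M0 H2 H3]]]]]; exists ek, M, tau, c; split => // K u u0.
by rewrite -ee'// H3.
Qed.

Let z01 (c u : R) : 0 < c -> 0 < u -> 0 <= 1 - expR (- (c * u)) <= 1.
Proof.
move=> c0 u0; have cu : 0 <= c * u by rewrite mulr_ge0// ltW.
apply/andP; split; last by rewrite gerBl expR_ge0.
by rewrite subr_ge0 -[leRHS]expR0 ler_expR oppr_le0.
Qed.

(** The error bound weakens when [tau] decreases and when [c] increases, so the minimum and the
    maximum serve for both sequences. *)
Lemma tendsD v w e e' : tends v e -> tends w e' ->
  tends (fun K => v K + w K) (fun u => e u + e' u).
Proof.
move=> [ek [M [tau [c [H1 M0 [tau0 c0] H3]]]]] [ek' [M' [tau' [c' [H1' M0' [tau0' c0'] H3']]]]].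
exists (fun K u => ek K u + ek' K u), (M + M'), (Num.min tau tau'), (Num.max c c').
split.
- by move=> K; exact: symD.
- exact: addr_ge0.
- by rewrite lt_min tau0 tau0' lt_max c0.
- have cc0 : 0 < Num.max c c' by rewrite lt_max c0.
  move=> K u u0; rewrite opprD addrACA (le_trans (ler_normD _ _))// !mulrDl lerD//.
    rewrite (le_trans (H3 _ _ u0))// ler_pM ?mulr_ge0 ?expR_ge0 ?exprn_ge0//.
    + by have /andP[] := z01 c0 u0.
    + by rewrite ler_wpM2l// ler_expR lerN2 ler_pM2r// ge_min lexx.
    + rewrite lerXn2r ?nnegrE//; last first.
        by rewrite lerD2l lerN2 ler_expR lerN2 ler_pM2r// le_max lexx.
      by have /andP[] := z01 cc0 u0.
    by have /andP[] := z01 c0 u0.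
  rewrite (le_trans (H3' _ _ u0))// ler_pM ?mulr_ge0 ?expR_ge0 ?exprn_ge0//.
  + by have /andP[] := z01 c0' u0.
  + by rewrite ler_wpM2l// ler_expR lerN2 ler_pM2r// ge_min lexx orbT.
  + rewrite lerXn2r ?nnegrE//; last first.
      by rewrite lerD2l lerN2 ler_expR lerN2 ler_pM2r// le_max lexx orbT.
    by have /andP[] := z01 cc0 u0.
  by have /andP[] := z01 c0' u0.
Qed.

Lemma tendsZ (d : R) v e : tends v e ->
  tends (fun K => d%:C * v K) (fun u => d * e u).
Proof.
move=> [ek [M [tau [c [H1 M0 H2 H3]]]]].
exists (fun K u => d * ek K u), (`|d| * M), tau, c; split => //.
- by move=> K; exact: symZ.
- exact: mulr_ge0.
- by move=> K u u0; rewrite -mulrBr normrM -2!mulrA ler_wpM2l// mulrA H3.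
Qed.

Lemma tends0 : tends (fun=> 0) (fun=> 0).
Proof.
exists (fun K => fun=> 0), 0, 1, 1; split => //.
- by move=> K; exact: sym0.
- by move=> K u u0; rewrite subrr normr0 !mul0r.
Qed.

Lemma tends_sum (I : Type) (r : seq I) (P : pred I) (v : I -> nat -> R[i]) (e : I -> R -> R) :
  (forall i, P i -> tends (v i) (e i)) ->
  tends (fun K => \sum_(i <- r | P i) v i K) (fun u => \sum_(i <- r | P i) e i u).
Proof.
move=> ve; elim: r => [|i r ih].
  have -> : (fun K : nat => \sum_(i <- [::] | P i) v i K) = fun=> 0.
    by apply/funext => K; rewrite big_nil.
  by apply: eq_tends tends0 => u _; rewrite big_nil.
have [Pi|Pi] := boolP (P i).
  have -> : (fun K : nat => \sum_(j <- i :: r | P j) v j K) =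
      fun K => v i K + \sum_(j <- r | P j) v j K.
    by apply/funext => K; rewrite big_cons Pi.
  by apply: eq_tends (tendsD (ve i Pi) ih) => u _; rewrite big_cons Pi.
have -> : (fun K : nat => \sum_(j <- i :: r | P j) v j K) =
    fun K => \sum_(j <- r | P j) v j K.
  by apply/funext => K; rewrite big_cons (negbTE Pi).
by apply: eq_tends ih => u _; rewrite big_cons (negbTE Pi).
Qed.

Section Limits.
Variables (N : nat) (chi : R -> R[i]).
Hypothesis N0 : (0 < N)%N.
Hypothesis Lchi : LTC chi.
Hypothesis dF : forall k (x : R), 0 < x -> cder (F k) x (F k.+1 x).
Hypothesis FN : forall x : R, 0 < x -> F N x = laplace chi x.

Lemma csymbol_Re v e : csymbol v e ->
  has_symbol (fun k x => complex.Re (F k x)) (complex.Re v) e.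
Proof.
elim=> [|c i x {}v {}e i1 x0 _ ih]; first exact: has_symbol0.
by rewrite cReD cReZ; exact: has_symbolS.
Qed.

Lemma csymbol_Im v e : csymbol v e ->
  has_symbol (fun k x => complex.Im (F k x)) (complex.Im v) e.
Proof.
elim=> [|c i x {}v {}e i1 x0 _ ih]; first exact: has_symbol0.
by rewrite cImD cImZ; exact: has_symbolS.
Qed.

Lemma sym_cvg (v : nat -> R[i]) (e : nat -> R -> R) e0 (C tau : R) :
  (forall K, sym (v K) (e K)) -> 0 < tau ->
  (forall K u, 0 < u -> `|e K u| <= C * (u ^+ N * expR (- (tau * u)))) ->
  (forall u, 0 < u -> e K u @[K --> \oo] --> e0 u) ->
  v K @[K --> \oo] -->
    (ID (fun u => (- u) ^- N * e0 u * complex.Re (chi u)) +i*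
     ID (fun u => (- u) ^- N * e0 u * complex.Im (chi u))).
Proof.
move=> ve tau0 eC ee0.
have /choice[e' e'P] : forall K, exists e', csymbol (v K) e' /\ forall u, 0 < u -> e' u = e K u.
  by move=> K; have [e' ? ?] := ve K; exists e'.
have e'C K u : 0 < u -> `|e' K u| <= C * (u ^+ N * expR (- (tau * u))).
  by move=> u0; rewrite (e'P K).2// eC.
have e'e0 u : 0 < u -> e' K u @[K --> \oo] --> e0 u.
  move=> u0; rewrite (_ : (fun K => e' K u) = fun K => e K u); first exact: ee0.
  by apply/funext => K; rewrite (e'P K).2.
have [LR LI] := Lchi.
apply/cvgC_ReIm; split => /=.
  apply: (@has_symbol_cvg _ (fun k x => complex.Re (F k x)) N _ N0 LR _ _
    (fun K => complex.Re (v K)) e' e0 C tau) => //.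
  - by move=> k x x0; have [] := dF k x0.
  - by move=> x x0; rewrite FN// laplaceE.
  - by move=> K; apply: csymbol_Re; exact: (e'P K).1.
apply: (@has_symbol_cvg _ (fun k x => complex.Im (F k x)) N _ N0 LI _ _
  (fun K => complex.Im (v K)) e' e0 C tau) => //.
- by move=> k x x0; have [] := dF k x0.
- by move=> x x0; rewrite FN// laplaceE.
- by move=> K; apply: csymbol_Im; exact: (e'P K).1.
Qed.

Lemma zK_le (c u : R) K : 0 < c -> 0 < u -> (N <= K)%N ->
  (1 - expR (- (c * u))) ^+ K <= c ^+ N * u ^+ N.
Proof.
move=> c0 u0 NK; have /andP[z0 z1] := z01 c0 u0.
rewrite -exprMn (@le_trans _ _ ((1 - expR (- (c * u))) ^+ N))//.
  by rewrite ler_wiXn2l// z0.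
rewrite lerXn2r ?nnegrE ?mulr_ge0 ?(ltW c0) ?(ltW u0)//.
have := @expR_ge1Dx R (- (c * u)); lra.
Qed.

Lemma z_cvg0 (c u : R) : 0 < c -> 0 < u ->
  (1 - expR (- (c * u))) ^+ K @[K --> \oo] --> (0 : R).
Proof.
move=> c0 u0; have /andP[z0 z1] := z01 c0 u0.
by apply: cvg_expr; rewrite ger0_norm// gtrBl expR_gt0.
Qed.

(** The limit symbol [e] need not vanish at 0, so the Taylor polynomial of [v K] survives. It is
    removed by subtracting [v N]: the symbol of [v (K + N) - v N] vanishes to order [N]. *)
Lemma tends_cvg v e : tends v e -> cvgn v.
Proof.
move=> [ek [M [tau [c [H1 M0 [tau0 c0] H3]]]]].
have H : v (K + N)%N - v N @[K --> \oo] -->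
    (ID (fun u => (- u) ^- N * (e u - ek N u) * complex.Re (chi u)) +i*
     ID (fun u => (- u) ^- N * (e u - ek N u) * complex.Im (chi u))).
  apply: (@sym_cvg (fun K => v (K + N)%N - v N) (fun K u => ek (K + N)%N u - ek N u)
    (fun u => e u - ek N u) (2 * M * c ^+ N) tau) => //.
  - by move=> K; exact: symB.
  - move=> K u u0; rewrite -(subrK (e u) (ek (K + N)%N u)) -addrA.
    rewrite (le_trans (ler_normD _ _))// [`|e u - _|]distrC.
    have b L : (N <= L)%N -> `|ek L u - e u| <= M * c ^+ N * (u ^+ N * expR (- (tau * u))).
      move=> NL; rewrite (le_trans (H3 _ _ u0))//.
      rewrite (le_trans (ler_wpM2l _ (zK_le c0 u0 NL))) ?mulr_ge0 ?expR_ge0//.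
      by rewrite le_eqVlt; apply/orP; left; apply/eqP; ring.
    rewrite (le_trans (lerD (b _ (leq_addl _ _)) (b _ (leqnn _))))//.
    by rewrite le_eqVlt; apply/orP; left; apply/eqP; ring.
  - move=> u u0; apply: cvgB; last exact: cvg_cst.
    rewrite (cvg_shiftn N (fun K => ek K u)).
    apply/cvgrPdist_le => d d0.
    have := z_cvg0 c0 u0 => /cvgr0_norm_le/(_ (d / (M + 1))) [|K _ HK].
      by rewrite divr_gt0//; lra.
    exists K => // L /= /HK zL; rewrite distrC (le_trans (H3 _ _ u0))//.
    have /andP[z0 z1] := z01 c0 u0.
    move: zL; rewrite ger0_norm ?exprn_ge0// => zL.
    rewrite (@le_trans _ _ (M * (d / (M + 1))))//.
      rewrite ler_pM ?mulr_ge0 ?expR_ge0 ?exprn_ge0// -[leRHS]mulr1 ler_wpM2l//.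
      by rewrite -[leRHS]expR0 ler_expR oppr_le0 mulr_ge0 ?ltW.
    rewrite mulrCA -[leRHS]mulr1 ler_wpM2l ?(ltW d0)//.
    by rewrite ler_pdivrMr ?mul1r; lra.
apply/cvg_ex; eexists; rewrite -(cvg_shiftn N).
rewrite (_ : (fun K => v (K + N)%N) = fun K => (v (K + N)%N - v N) + v N).
  exact: (cvgD H (cvg_cst (v N))).
by apply/funext => K; rewrite subrK.
Qed.

(** When [e = 0], the symbol of [v K] itself vanishes to order [N] for [K >= N], and the limiting
    integrand is 0. *)
Lemma tends_cvg0 v e : (forall u, 0 < u -> e u = 0) -> tends v e ->
  v K @[K --> \oo] --> (0 : R[i]).
Proof.
move=> e0 ve; have [ek [M [tau [c [H1 M0 [tau0 c0] H3]]]]] := eq_tends e0 ve.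
have b L u : (N <= L)%N -> 0 < u -> `|ek L u| <= M * c ^+ N * (u ^+ N * expR (- (tau * u))).
  move=> NL u0; have := H3 L u u0; rewrite subr0 => /le_trans; apply.
  rewrite (le_trans (ler_wpM2l _ (zK_le c0 u0 NL))) ?mulr_ge0 ?expR_ge0//.
  by rewrite le_eqVlt; apply/orP; left; apply/eqP; ring.
rewrite -(cvg_shiftn N).
have := @sym_cvg (fun K => v (K + N)%N) (fun K => ek (K + N)%N) (fun=> 0) (M * c ^+ N) tau
  (fun K => H1 _) tau0 (fun K u u0 => b _ _ (leq_addl _ _) u0).
have -> : ID (fun u => (- u) ^- N * 0 * complex.Re (chi u)) = 0.
  rewrite (@eq_ID _ _ (fun=> 0 * 0)) ?IDZ ?mul0r//; first exact: integrable0.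
  by move=> u _; rewrite mulr0 !mul0r.
have -> : ID (fun u => (- u) ^- N * 0 * complex.Im (chi u)) = 0.
  rewrite (@eq_ID _ _ (fun=> 0 * 0)) ?IDZ ?mul0r//; first exact: integrable0.
  by move=> u _; rewrite mulr0 !mul0r.
apply => u u0.
rewrite (cvg_shiftn N (fun K => ek K u)).
apply/cvgrPdist_le => d d0.
have := z_cvg0 c0 u0 => /cvgr0_norm_le/(_ (d / (M + 1))) [|K _ HK].
  by rewrite divr_gt0//; lra.
exists K => // L /= /HK zL; rewrite distrC (le_trans (H3 _ _ u0))//.
have /andP[z0 z1] := z01 c0 u0.
move: zL; rewrite ger0_norm ?exprn_ge0// => zL.
rewrite (@le_trans _ _ (M * (d / (M + 1))))//.
  rewrite ler_pM ?mulr_ge0 ?expR_ge0 ?exprn_ge0// -[leRHS]mulr1 ler_wpM2l//.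
  by rewrite -[leRHS]expR0 ler_expR oppr_le0 mulr_ge0 ?ltW.
rewrite mulrCA -[leRHS]mulr1 ler_wpM2l ?(ltW d0)//.
    by rewrite ler_pdivrMr ?mul1r; lra.
Qed.

End Limits.
End ComplexSymbol.

(** * Symbols of B and of the Newton series *)

Section ScalarSeries.
Context {R : realType}.
Implicit Types (w y h : R).
Local Notation z w := (1 - expR (- w)).

Lemma is_derive_1NexpRN y : is_derive y 1 (fun y => z y) (expR (- y)).
Proof.
have d1 := is_derive1_comp (is_derive_expR _) (is_deriveNid y (1 : R)).
apply: (is_derive_eq (is_deriveB (is_derive_cst (1 : R) y 1) d1)).
by rewrite sub0r mulrN1 opprK.
Qed.

Lemma is_derive_1NexpRNX n y :
  is_derive y 1 (fun y => z y ^+ n) (n%:R * z y ^+ n.-1 * expR (- y)).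
Proof.
have := is_deriveX n (is_derive_1NexpRN y); rewrite exprfctE => /is_derive_eq; apply.
by rewrite /GRing.scale/= mulr_natl.
Qed.

Lemma z_ge0 w : 0 <= w -> 0 <= z w.
Proof. by move=> w0; rewrite subr_ge0 -[leRHS]expR0 ler_expR oppr_le0. Qed.

Lemma le_z y w : y <= w -> z y <= z w.
Proof. by move=> yw; rewrite lerD2l lerN2 ler_expR lerN2. Qed.

(* The remainder of the logarithmic series [y = \sum_k (1 - e^(-y))^k / k]. *)
Definition log_rest K y := y - \sum_(k < K) z y ^+ k.+1 / k.+1%:R.

Lemma is_derive_log_rest K y : is_derive y 1 (log_rest K) (z y ^+ K).
Proof.
elim: K => [|K ih].
  rewrite expr0 (_ : log_rest 0 = id); first exact: is_derive_id.
  by apply/funext => x; rewrite /log_rest big_ord0 subr0.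
rewrite (_ : log_rest K.+1 = log_rest K - (fun y => K.+1%:R^-1 * z y ^+ K.+1)).
  apply: (is_derive_eq (is_deriveB ih (is_deriveZ _ (is_derive_1NexpRNX K.+1 y)))).
  rewrite /GRing.scale/= exprSr.
  by field; rewrite addrC natr1 pnatr_eq0.
apply/funext => x; rewrite /log_rest big_ord_recr/= opprD addrA.
by rewrite -[RHS]/(_ - _) [K.+1%:R^-1 * _]mulrC.
Qed.

(** The remainder vanishes at 0 and has derivative [(1 - e^(-y))^K], which is increasing. *)
Lemma log_rest_le K w : 0 <= w -> `|log_rest K w| <= w * z w ^+ K.
Proof.
move=> w0.
have := is_derive_bounded_increment w0 (fun y _ => is_derive_log_rest K y)
  (M := z w ^+ K).
rewrite subr0 mulrC [log_rest K 0](_ : _ = 0) ?subr0; first last.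
  rewrite /log_rest big1 ?subr0// => k _.
  by rewrite oppr0 expR0 subrr expr0n mul0r.
apply => y /andP[y0 yw]; rewrite normrX ger0_norm ?z_ge0//.
by rewrite lerXn2r ?nnegrE ?z_ge0 ?le_z.
Qed.

Lemma log_series_le K w : 0 < w ->
  `|\sum_(k < K.+1) z w ^+ k / k.+1%:R - w / z w| <= w * z w ^+ K.
Proof.
move=> w0; have z0 : 0 < z w by rewrite subr_gt0 -[ltRHS]expR0 ltr_expR oppr_lt0.
have := log_rest_le K.+1 (ltW w0).
rewrite exprS mulrCA mulrC -ler_pdivrMr// -[X in `|_| / X](gtr0_norm z0) -normf_div.
rewrite /log_rest mulrBl distrC mulr_suml.
under eq_bigr do rewrite exprS -mulrA mulrAC mulfV ?gt_eqF// mul1r.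
by [].
Qed.

Lemma gbinomS h k : gbinom h k.+1 * k.+1%:R = gbinom h k * (h - k%:R).
Proof.
rewrite /gbinom big_ord_recr/= factS natrM.
have k0 : k`!%:R != 0 :> R by rewrite pnatr_eq0 -lt0n fact_gt0.
have kS0 : k.+1%:R != 0 :> R by rewrite pnatr_eq0.
by field; rewrite k0 addrC natr1.
Qed.

Lemma gbinom0 h : gbinom h 0 = 1.
Proof. by rewrite /gbinom big_ord0 fact0 divr1. Qed.

(** By [gbinomS], each step replaces a factor [k + 1] by [h - (k + 1)], of modulus at most [k + 1]
    for [h] in [[0, 1]]. The product bounded here is the one appearing in [is_derive_binom_sum]. *)
Lemma gbinom_le h k : 0 <= h <= 1 -> `|gbinom h k.+1 * k.+1%:R| <= 1.
Proof.
move=> /andP[h0 h1]; elim: k => [|k ih].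
  by rewrite gbinomS gbinom0 mul1r subr0 ger0_norm.
rewrite gbinomS (le_trans _ ih)// !normrM ler_wpM2l//.
rewrite (ger0_norm (ler0n _ k.+1)) ler_norml -natr1.
by have := ler0n R k; lra.
Qed.

Definition binom_sum h K y := \sum_(k < K) gbinom h k * (- z y) ^+ k.

(** The full binomial series in [e^(-y) - 1] is [e^(-hy)], so its product with [e^(hy)] is constant;
    for a truncated series the derivative telescopes to a single boundary term. *)
Lemma is_derive_binom_sum h K y :
  is_derive y 1 (fun y => expR (h * y) * binom_sum h K y)
    (expR (h * y) * (gbinom h K * K%:R * (- z y) ^+ K.-1)).
Proof.
have d1 : is_derive y 1 (fun y => expR (h * y)) (expR (h * y) * h).
  have d : is_derive y 1 (fun y => h * y) h.
    by have := is_deriveZ h (is_derive_id y (1 : R)); rewrite /GRing.scale/= mulr1.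
  exact: (is_derive1_comp (is_derive_expR _) d).
elim: K => [|K ih].
  rewrite !(mulr0, mul0r) (_ : (fun y => _) = cst 0); first exact: is_derive_cst.
  by apply/funext => x; rewrite /binom_sum big_ord0 mulr0.
have d2 : is_derive y 1 (fun y => (- z y) ^+ K) (K%:R * (- z y) ^+ K.-1 * - expR (- y)).
  have := is_deriveX K (is_deriveN (is_derive_1NexpRN y)).
  rewrite exprfctE => /is_derive_eq; apply.
  by rewrite /GRing.scale/= mulr_natl.
rewrite (_ : (fun y => _) = (fun y => expR (h * y) * binom_sum h K y) +
    (fun y => gbinom h K * (expR (h * y) * (- z y) ^+ K))); last first.
  apply/funext => x; rewrite /binom_sum big_ord_recr/= mulrDr -[RHS]/(_ + _).
  by rewrite [gbinom h K * (expR _ * _)]mulrCA.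
apply: (is_derive_eq (is_deriveD ih (is_deriveZ (gbinom h K) (is_deriveM d1 d2)))).
rewrite /GRing.scale/= gbinomS.
case: K {ih d2} => [|K] /=.
  by rewrite !(mulr0n, expr0, mulr0, mul0r, add0r, subr0, mulr1); ring.
rewrite [(- z y) ^+ K.+1]exprSr.
by ring.
Qed.

Lemma binom_sum_le h K w : 0 <= h <= 1 -> 0 <= w ->
  `|binom_sum h K.+1 w - expR (- (h * w))| <= w * z w ^+ K.
Proof.
move=> h01 w0; have /andP[h0 h1] := h01.
have dM y : 0 <= y <= w ->
    `|expR (h * y) * (gbinom h K.+1 * K.+1%:R * (- z y) ^+ K)| <= expR (h * w) * z w ^+ K.
  move=> /andP[y0 yw]; rewrite normrM (ger0_norm (expR_ge0 _)) ler_pM ?expR_ge0//.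
    by rewrite ler_expR ler_wpM2l.
  rewrite normrM -[leRHS]mul1r ler_pM// ?gbinom_le//.
  rewrite normrX normrN ger0_norm ?z_ge0//.
  by rewrite lerXn2r ?nnegrE ?z_ge0 ?le_z.
have := is_derive_bounded_increment w0 (fun y _ => is_derive_binom_sum h K.+1 y) dM.
rewrite subr0 mulr0 expR0 mul1r [binom_sum h K.+1 0](_ : _ = 1); last first.
  rewrite /binom_sum big_ord_recl/= expr0 gbinom0 mulr1 big1 ?addr0// => k _.
  by rewrite oppr0 expR0 subrr oppr0 expr0n mulr0.
have -> : expR (h * w) * binom_sum h K.+1 w - 1 =
    expR (h * w) * (binom_sum h K.+1 w - expR (- (h * w))).
  by rewrite mulrBr -expRD subrr expR0.
rewrite normrM (ger0_norm (expR_ge0 _)) -mulrA ler_pM2l ?expR_gt0//.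
by rewrite [z w ^+ K * _]mulrC.
Qed.

(** Equivalent to [(1 + w) * e^(-w) <= 1]. It controls the symbols near 0, where their denominators
    vanish. *)
Lemma div_z_le w : 0 < w -> w / z w <= 1 + w.
Proof.
move=> w0; have z0 : 0 < z w by rewrite subr_gt0 -[ltRHS]expR0 ltr_expR oppr_lt0.
rewrite ler_pdivrMr// mulrBr mulr1 lerBrDr addrC lerD2r.
rewrite expRN ler_pdivrMr ?expR_gt0// mul1r.
exact: expR_ge1Dx.
Qed.

End ScalarSeries.

Section OperatorSymbols.
Context {R : realType}.
Variable F : nat -> R -> R[i].
Local Notation z w := (1 - expR (- w)).

Lemma u_expR_le (tau u : R) : 0 < tau ->
  u * expR (- (tau * u)) <= (tau / 2)^-1 * expR (- (tau / 2 * u)).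
Proof.
move=> tau0; rewrite ler_pdivlMl ?divr_gt0// mulrA.
have -> : - (tau * u) = - (tau / 2 * u) + - (tau / 2 * u) by field.
rewrite expRD mulrA -[leRHS]mul1r ler_wpM2r ?expR_ge0//.
rewrite expRN ler_pdivrMr ?expR_gt0// mul1r.
have := @expR_ge1Dx R (tau / 2 * u); lra.
Qed.

(** A unit step in [t] multiplies the symbol by [e^(-mu)], so each difference contributes
    [e^(-mu) - 1]. The complex constant [c] and the scale [m] are there for the dilated function
    [f^m]. *)
Lemma sym_fdiff (g : R -> R[i]) (c : R[i]) (m : R) : 0 < m ->
  (forall t, 0 < t -> sym F (c * g t) (fun u => expR (- (m * t * u)))) ->
  forall n t, 0 < t -> sym F (c * iter n fdiff g t)
    (fun u => expR (- (m * t * u)) * (- z (m * u)) ^+ n).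
Proof.
move=> m0 gE; elim=> [|n ih] t t0.
  by apply: eq_sym_symbol (gE t t0) => u _; rewrite expr0 mulr1.
rewrite iterS [fdiff _ t]/(_ - _) mulrBr.
have t10 : 0 < t + 1 by rewrite addr_gt0.
apply: eq_sym_symbol (symB (ih _ t10) (ih _ t0)) => u _.
have -> : - (m * (t + 1) * u) = - (m * t * u) + - (m * u) by ring.
by rewrite expRD exprS; ring.
Qed.

Lemma tends_opB (g : R -> R[i]) (c : R[i]) (m t : R) : 0 < m -> 0 < t ->
  (forall t, 0 < t -> sym F (c * g t) (fun u => expR (- (m * t * u)))) ->
  tends F (fun K => c * series (opB_term g t) K.+1)
    (fun u => expR (- (m * t * u)) * (m * u / z (m * u))).
Proof.
move=> m0 t0 gE; have mt0 : 0 < m * t by rewrite mulr_gt0.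
exists (fun K u => expR (- (m * t * u)) * \sum_(k < K.+1) z (m * u) ^+ k / k.+1%:R).
exists (m * (m * t / 2)^-1), (m * t / 2), m; split.
- move=> K; rewrite /series/= big_mkord mulr_sumr.
  have H (k : 'I_K.+1) : sym F (c * opB_term g t k)
      (fun u => ((-1) ^+ k / k.+1%:R) * (expR (- (m * t * u)) * (- z (m * u)) ^+ k)).
    rewrite /opB_term [c * _](_ : _ = ((-1) ^+ k / k.+1%:R)%:C * (c * iter k fdiff g t)).
      exact/symZ/sym_fdiff.
    rewrite rmorphM fmorphV rmorph_nat rmorphXn rmorphN1.
    by ring.
  apply: eq_sym_symbol (sym_sum _ H) => u _; rewrite mulr_sumr; apply: eq_bigr => k _.
  (* The signs of [opB_term] cancel those of the differences, leaving the logarithmic series in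
     [1 - e^(-mu)]. *)
  have s1 : (-1) ^+ k * (-1) ^+ k = 1 :> R by rewrite -exprMn mulrNN mulr1 expr1n.
  rewrite [(- z _) ^+ k]exprNn.
  transitivity (((-1) ^+ k * (-1) ^+ k) *
    (expR (- (m * t * u)) * (z (m * u) ^+ k / k.+1%:R))); first by ring.
  by rewrite s1 mul1r.
- by rewrite mulr_ge0 ?invr_ge0 ?divr_ge0 ?(ltW m0) ?(ltW mt0).
- by split => //; rewrite divr_gt0.
- move=> K u u0; rewrite -mulrBr normrM (ger0_norm (expR_ge0 _)).
  rewrite (le_trans (ler_wpM2l (expR_ge0 _) (log_series_le K (mulr_gt0 m0 u0))))//.
  rewrite mulrA ler_wpM2r ?exprn_ge0 ?z_ge0 ?mulr_ge0 ?(ltW m0) ?(ltW u0)//.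
  have -> : expR (- (m * t * u)) * (m * u) = m * (u * expR (- (m * t * u))) by ring.
  by rewrite -[leRHS]mulrA ler_wpM2l ?(ltW m0)// u_expR_le.
Qed.

(** The part [C] of the symbol does not depend on [k], so every difference annihilates it and it
    survives only in the term of order 0; on the other part the Newton series is the binomial series
    for [e^(-hmu)]. *)
Lemma tends_shift (A : nat -> R[i]) (c : R[i]) (C B : R -> R) (m h M tau : R) :
  0 < m -> 0 <= h <= 1 -> 0 <= M -> 0 < tau ->
  (forall u, 0 < u -> `|B u| <= M * expR (- (tau * u))) ->
  (forall k, sym F (c * A k) (fun u => C u + B u * expR (- (k%:R * (m * u))))) ->
  forall k, tends F (fun K => c * series (shift_term h A k) K.+1)
    (fun u => C u + B u * expR (- (k%:R * (m * u))) * expR (- (h * (m * u)))).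
Proof.
move=> m0 h01 M0 tau0 BM AE k.
have DA l : forall k, sym F (c * iter l sdiff A k)
    (fun u => (l == 0%N)%:R * C u + B u * expR (- (k%:R * (m * u))) * (- z (m * u)) ^+ l).
  elim: l => [|l ih] {}k.
    by apply: eq_sym_symbol (AE k) => u _; rewrite mul1r expr0 mulr1.
  rewrite iterS [sdiff _ k]/(_ - _) mulrBr.
  apply: eq_sym_symbol (symB (ih k.+1) (ih k)) => u _.
  have -> : - (k.+1%:R * (m * u)) = - (k%:R * (m * u)) + - (m * u).
    by rewrite -natr1; ring.
  by rewrite expRD exprS mulr0n mul0r; move: ((l == 0%N)%:R * C u) => y; ring.
exists (fun K u => C u + B u * expR (- (k%:R * (m * u))) * binom_sum h K.+1 (m * u)).
exists (M * m * (tau / 2)^-1), (tau / 2), m; split.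
- move=> K; rewrite /series/= big_mkord mulr_sumr.
  have H (l : 'I_K.+1) : sym F (c * shift_term h A k l)
      (fun u => gbinom h l * ((l == 0%N :> nat)%:R * C u +
        B u * expR (- (k%:R * (m * u))) * (- z (m * u)) ^+ l)).
    by rewrite /shift_term mulrCA; apply: symZ.
  apply: eq_sym_symbol (sym_sum _ H) => u _.
  under eq_bigr do rewrite mulrDr.
  rewrite big_split/=; congr (_ + _).
    rewrite big_ord_recl/= gbinom0 !mul1r big1 ?addr0// => l _.
    by rewrite mul0r mulr0.
  by rewrite /binom_sum mulr_sumr; apply: eq_bigr => l _; rewrite mulrCA.
- by rewrite !mulr_ge0 ?invr_ge0 ?divr_ge0 ?(ltW m0) ?(ltW tau0).
- by split => //; rewrite divr_gt0.
- move=> K u u0; have mu0 : 0 <= m * u by rewrite mulr_ge0 ?(ltW m0) ?(ltW u0).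
  rewrite opprD addrACA subrr add0r -mulrBr normrM.
  rewrite (le_trans (ler_wpM2l (normr_ge0 _) (binom_sum_le K h01 mu0)))//.
  rewrite [leLHS]mulrA ler_wpM2r ?exprn_ge0 ?z_ge0//.
  have bB : `|B u * expR (- (k%:R * (m * u)))| <= M * expR (- (tau * u)).
    rewrite normrM -[leRHS]mulr1 ler_pM ?BM// ger0_norm ?expR_ge0//.
    by rewrite -[leRHS]expR0 ler_expR oppr_le0 mulr_ge0.
  rewrite (le_trans (ler_wpM2r mu0 bB))//.
  have -> : M * expR (- (tau * u)) * (m * u) = M * m * (u * expR (- (tau * u))) by ring.
  rewrite -[leRHS]mulrA ler_wpM2l ?mulr_ge0 ?(ltW m0)//.
  exact: u_expR_le.
Qed.

End OperatorSymbols.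

(** * Translation-invariant means *)

Section MeanOnNat.
Context {R : realType}.
Variable P : {content set nat -> \bar R}.
Hypothesis hP1 : P [set: nat] = 1%E.
Hypothesis hPinv : translation_invariant P.

Lemma translation_invariant_lt n : P [set k | (k < n)%N] = (n%:R%:E * P [set 0%N])%E.
Proof.
elim: n => [|n ih].
  rewrite mul0e (_ : [set k | _] = set0) ?measure0//.
  by apply/seteqP; split => k.
have -> : [set k | (k < n.+1)%N] = [set k | (k < n)%N] `|` [set n].
  apply/seteqP; split => k /=.
    by rewrite ltnS leq_eqVlt => /orP[/eqP ->|]; [right|left].
  by case=> [kn|->]; [exact: ltnW|exact: ltnSn].
rewrite measureU//; last first.
  by apply/seteqP; split => [k [/= + kn]|//]; rewrite kn ltnn.
rewrite ih -natr1 EFinD ge0_muleDl ?lee_fin// mul1e; congr (_ + _)%E.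
rewrite -[RHS](hPinv _ n); congr (P _).
apply/seteqP; split => k /=; first by move=> ->; exists 0%N.
by move=> [i -> <-]; rewrite add0n.
Qed.

(** All singletons have the same mass, and [n] of them have total mass at most 1 for every [n]. *)
Lemma translation_invariant_finite n : P [set k | (k < n)%N] = 0%E.
Proof.
suff P0 : P [set 0%N] = 0%E by rewrite translation_invariant_lt P0 mule0.
apply/eqP; rewrite eq_le measure_ge0 andbT.
have nP n' : (n'%:R%:E * P [set 0%N] <= 1)%E.
  rewrite -translation_invariant_lt -hP1; apply: le_measure; rewrite ?inE//.
have : P [set 0%N] \is a fin_num.
  rewrite ge0_fin_numE//; have := nP 1%N; rewrite mul1e => /le_lt_trans; apply.
  exact: ltry.
case: (P [set 0%N]) nP (measure_ge0 P [set 0%N]) => [p||]// nP p0 _.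
rewrite lee_fin leNgt; apply/negP => p1.
have [n' _ /(_ n' (leqnn n'))] := @nbhs_infty_gtr R p^-1.
have := nP n'; rewrite -EFinM lee_fin => np /=.
by rewrite -[p^-1]mul1r ltr_pdivrMr// ltNge np.
Qed.

Import HBSimple HBNNSimple.

(** A simple function below [y] takes values above [c] only at indices below [m], a null set; the
    bound [c] is attained by the function equal to 0 before [m] and to [c] afterwards. Finite
    additivity suffices for both. *)
Lemma ereal_sup_eventually_cst (y : nat -> R) (c : R) (m : nat) :
  (forall n, 0 <= y n) -> (forall n, (m <= n)%N -> y n = c) ->
  ereal_sup [set sintegral P h | h in
    [set h : {nnsfun nat >-> R} | forall n, ((h n)%:E <= (y n)%:E)%E]] = c%:E.
Proof.
move=> y0 yc; have c0 : 0 <= c by rewrite -(yc m).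
apply/eqP; rewrite eq_le; apply/andP; split.
  apply: ge_ereal_sup => _ [h /= hy <-].
  rewrite /sintegral -(fsbig_widen (range h) setT)//=; last first.
    by move=> x [_ Nfx] /=; rewrite preimage10// measure0 mule0.
  have fh : finite_set (range h) by exact: fimfunP.
  apply: (@le_trans _ _ (\sum_(x \in range h) c%:E * P (h @^-1` [set x]))%E).
    apply: lee_fsum => // x _.
    have [xc|cx] := leP x c; first by rewrite lee_wpmul2r// lee_fin.
    have -> : P (h @^-1` [set x]) = 0%E.
      apply/eqP; rewrite eq_le measure_ge0 andbT -(translation_invariant_finite m).
      apply: le_measure; rewrite ?inE// => n /= hn; rewrite ltnNge; apply/negP => mn.
      by have := hy n; rewrite hn lee_fin yc// leNgt cx.
    by rewrite !mule0.
  rewrite -ge0_mule_fsumr// -measure_fin_bigcup//; last first.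
    apply/trivIsetP => i j _ _ ij; apply/seteqP; split => n //= [-> ji].
    by move: ij; rewrite ji eqxx.
  rewrite (_ : \bigcup_(i in _) _ = setT) ?hP1 ?mule1//.
  by apply/seteqP; split => n // _; exists (h n) => //; exists n.
pose g n : R := if (n < m)%N then 0 else c.
have mg : measurable_fun [set: nat] g by [].
have fg : finite_set (range g).
  apply: (@sub_finite_set _ _ [set 0; c]); last exact: finite_set2.
  by move=> _ [n _ <-]; rewrite /g; case: ifP => _; [left|right].
have g0 n : 0 <= g n by rewrite /g; case: ifP.
pose h : {nnsfun nat >-> R} := HB.pack g (isMeasurableFun.Build _ _ nat R g mg)
  (FiniteImage.Build nat R g fg) (isNonNegFun.Build nat R g g0).
apply: ereal_sup_ge; exists (sintegral P h).
  exists h => //= n; rewrite lee_fin /h/= /g; case: ltnP => [_|mn]; first exact: y0.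
  by rewrite yc.
rewrite /sintegral -(fsbig_widen [set c] setT)//=; last first.
  move=> x [_ /= xc]; rewrite /preimage /= /g.
  have [->|x0] := eqVneq x 0; first by rewrite mul0e.
  rewrite (_ : [set _ | _] = set0) ?measure0 ?mule0//.
  apply/seteqP; split => n //=; case: ifP => _ e; first by move: x0; rewrite -e eqxx.
  by apply: xc.
rewrite fsbig_set1.
have -> : P (h @^-1` [set c]) = 1%E; last by rewrite mule1.
apply/eqP; rewrite eq_le -{1}hP1 le_measure ?inE//=.
rewrite -[leLHS]adde0 -(translation_invariant_finite m) -hP1.
have -> : [set: nat] = [set k | (m <= k)%N] `|` [set k | (k < m)%N].
  by apply/seteqP; split => k // _ /=; case: (leqP m k); [left|right].
rewrite measureU//; last first.
  by apply/seteqP; split => [k [/= mk]|//]; rewrite ltnNge mk.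
rewrite -addeA translation_invariant_finite !adde0.
apply: le_measure; rewrite ?inE// => k /= mk.
by rewrite /g ltnNge mk.
Qed.

(** The positive part, the negative part and the modulus are again eventually constant, so the
    definition of the integral can be evaluated directly, without a convergence theorem. *)
Lemma integral_eventually_cst (x : nat -> R) (c : R) (m : nat) :
  (forall n, (m <= n)%N -> x n = c) ->
  P.-integrable setT (fun n => (x n)%:E) /\ (\int[P]_n (x n)%:E)%E = c%:E.
Proof.
move=> xc.
have H (y : nat -> R) (d : R) : (forall n, (m <= n)%N -> y n = d) ->
    (\int[P]_n (y n)%:E)%E = d%:E.
  move=> yd; rewrite /integral.
  rewrite (_ : (_ \_ _)^\+ = fun n => (Num.max (y n) 0)%:E)%E; last first.
    by apply/funext => n; rewrite funeposE patchT ?inE// EFin_max.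
  rewrite (_ : (_ \_ _)^\- = fun n => (Num.max (- y n) 0)%:E)%E; last first.
    by apply/funext => n; rewrite funenegE patchT ?inE// EFin_max.
  rewrite (@ereal_sup_eventually_cst _ (Num.max d 0) m); first last.
  - by move=> n /yd ->.
  - by move=> n; rewrite le_max lexx orbT.
  rewrite (@ereal_sup_eventually_cst _ (Num.max (- d) 0) m); first last.
  - by move=> n /yd ->.
  - by move=> n; rewrite le_max lexx orbT.
  rewrite -EFinB; congr (_%:E).
  have [d0|d0] : 0 <= d \/ d <= 0 by apply/orP; exact: le_total.
    by rewrite max_l// max_r ?subr0// oppr_le0.
  by rewrite max_r// max_l ?sub0r ?opprK// oppr_ge0.
split; last exact: H.
apply/integrableP; split => //.
by rewrite (H (fun n => `|x n|) `|c|) ?ltry// => n /xc ->.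
Qed.

End MeanOnNat.

(** * The random variable X_a *)

Section Assembly.
Context {R : realType}.
Variables (f : R[i] -> R -> R[i]) (s : R[i]).
Hypothesis hf : calH f.

(* The [k]-th derivative of [f s], by [cder_calH]. *)
Definition tower k (x : R) : R[i] := (\prod_(i < k) (s - i%:R)) * f (s - k%:R) x.

Lemma tower0 x : tower 0 x = f s x.
Proof. by rewrite /tower big_ord0 mul1r subr0. Qed.

Lemma tower1 x : tower 1 x = s * f (s - 1) x.
Proof. by rewrite /tower big_ord_recl big_ord0 mulr1 subr0. Qed.

Lemma cder_tower k (x : R) : 0 < x -> cder (tower k) x (tower k.+1 x).
Proof.
move=> x0; have := cder_cstM (\prod_(i < k) (s - i%:R)) (cder_calH (s - k%:R) hf x0).
by rewrite /tower big_ord_recr/= -addrA -opprD natr1 mulrA.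
Qed.

(** An integer [N] above [|Re s| + 1] gives [Re (N - s) > 1], so that [f (s - N)] lies in the range
    where elements of [calH] are Laplace transforms. *)
Lemma tower_laplace : exists N chi, [/\ (0 < N)%N, LTC chi &
  forall x, 0 < x -> tower N x = laplace chi x].
Proof.
have [_ [_ [_ [phi [Lphi _ _ fphi]]]]] := hf.
pose N := (Num.bound (`|complex.Re s| + 1)).
have sN : `|complex.Re s| + 1 < N%:R by apply: archi_boundP; rewrite addr_ge0.
have N1 : 1 < complex.Re (N%:R - s).
  have -> : (N%:R : R[i]) = (N%:R : R)%:C by rewrite rmorph_nat.
  by rewrite cReD cReN /=; have := ler_norm (complex.Re s); lra.
exists N, (fun u => (\prod_(i < N) (s - i%:R)) * laplace_weight phi (N%:R - s) u).
have L := LTC_weight Lphi N1.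
split.
- rewrite lt0n; apply/eqP => N0; move: sN; rewrite N0.
  by have := normr_ge0 (complex.Re s); lra.
- exact: LTCZ.
- by move=> x x0; rewrite laplaceM// /tower -fphi// opprB.
Qed.

Lemma tower_tends_cvg v e : tends tower v e -> cvgn v.
Proof.
have [N [chi [N0 Lchi FN]]] := tower_laplace.
exact: (tends_cvg N0 Lchi cder_tower FN).
Qed.

Lemma tower_tends_cvg0 v e : (forall u, 0 < u -> e u = 0) -> tends tower v e ->
  v K @[K --> \oo] --> (0 : R[i]).
Proof.
have [N [chi [N0 Lchi FN]]] := tower_laplace.
exact: (tends_cvg0 N0 Lchi cder_tower FN).
Qed.

Lemma cvg_seriesZ (c : R[i]) (w : nat -> R[i]) : c != 0 ->
  cvgn (fun K => c * series w K.+1) -> cvgn (series w).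
Proof.
move=> c0 /cvg_ex[/= l cl]; apply/cvg_ex; exists (c^-1 * l).
rewrite -cvg_shiftS.
rewrite (_ : (fun n => _) = fun K => c^-1 * (c * series w K.+1)).
  by apply: (@cvgM R[i]); [exact: cvg_cst|exact: cl].
by apply/funext => K; rewrite mulKf.
Qed.

(** The powers [m^s] and [m^(-s)] cancel and leave [f s (m * t)], which has a real symbol. *)
Lemma sym_dilate (m : nat) (t : R) : (0 < m)%N -> 0 < t ->
  sym tower (cpow m%:R s * fpow_dilate m f s t) (fun u => expR (- (m%:R * t * u))).
Proof.
move=> m0 t0; rewrite /fpow_dilate mulrA -cpowD subrr cpow0 mul1r -tower0.
have mt0 : 0 < m%:R * t by rewrite mulr_gt0// ltr0n.
by apply: eq_sym_symbol (@sym_pt R tower 0 _ _ mt0) => // u _; rewrite expr0 mul1r.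
Qed.

Lemma tends_opB_f (t : R) : 0 < t ->
  tends tower (fun K => 1 * series (opB_term (f s) t) K.+1)
    (fun u => expR (- (t * u)) * (u / (1 - expR (- u)))).
Proof.
move=> t0.
have H := @tends_opB R tower (f s) 1 1 t ltr01 t0.
apply: (eq_tends _ (H _)) => [u _|t' t'0]; first by rewrite !mul1r.
rewrite mul1r -tower0.
by apply: eq_sym_symbol (@sym_pt R tower 0 _ _ t'0) => // u _; rewrite expr0 !mul1r.
Qed.

Lemma tends_opB_dilate (m : nat) (t : R) : (0 < m)%N -> 0 < t ->
  tends tower (fun K => cpow m%:R s * series (opB_term (fpow_dilate m f s) t) K.+1)
    (fun u => expR (- (m%:R * t * u)) * (m%:R * u / (1 - expR (- (m%:R * u))))).
Proof.
move=> m0 t0; apply: tends_opB => //; first by rewrite ltr0n.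
by move=> t' t'0; exact: sym_dilate.
Qed.

Variables (t0 : R) (a : nat -> R[i]).
Hypothesis ht0 : 0 < t0.
Hypothesis hs : s != 0.
Hypothesis ha0 : a 0%N = 0.
Hypothesis ha : forall n : nat, (1 <= n)%N -> a n = f (s - 1) (t0 + n%:R - 1).

Local Notation q u := (expR (- u)).

Lemma qX (n : nat) (u : R) : expR (- (n%:R * u)) = q u ^+ n.
Proof. by rewrite -mulrN expRM_natl. Qed.

Let sa i u : R := if i is i'.+1 then - u * (expR (- (t0 * u)) * q u ^+ i') else 0.

Lemma sym_sa i : sym tower (s * a i) (sa i).
Proof.
case: i => [|i]; first by rewrite ha0 mulr0; exact: sym0.
rewrite ha// -(tower1 (t0 + i.+1%:R - 1)).
have x0 : 0 < t0 + i.+1%:R - 1 by rewrite -natr1 addrA addrK ltr_wpDr.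
apply: eq_sym_symbol (@sym_pt R tower 1 _ _ x0) => // u _.
rewrite expr1 /sa -qX -expRD; congr (_ * expR _).
by rewrite -natr1; ring.
Qed.

Lemma geom_sum (x : R) n : x != 1 -> \sum_(i < n) x ^+ i = (1 - x ^+ n) / (1 - x).
Proof.
move=> x1; have x1' : 1 - x != 0 by rewrite subr_eq0 eq_sym.
by apply: (mulfI x1'); rewrite mulrCA divff// mulr1 -opprB mulNr -subrX1 opprB.
Qed.

Lemma q_lt1 (u : R) : 0 < u -> q u < 1.
Proof. by move=> u0; rewrite -[ltRHS]expR0 ltr_expR oppr_lt0. Qed.

Lemma qX_lt1 m (u : R) : (0 < m)%N -> 0 < u -> q u ^+ m < 1.
Proof. by move=> m0 u0; rewrite exprn_ilt1 ?expR_ge0 ?q_lt1// -lt0n. Qed.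

(* The symbol of [s * s_tilde m a j k] is [Cst m u + Var m j u * e^(-kmu)]. *)
Let Cst m u : R := - u * expR (- (t0 * u)) *
  ((1 - q u)^-1 - m%:R * q u ^+ m.-1 / (1 - q u ^+ m)).

Let Var m j u : R := u * expR (- (t0 * u)) *
  (q u ^+ j / (1 - q u) - m%:R * q u ^+ m.-1 / (1 - q u ^+ m)).

(** Both sums of [s_bracket0] become geometric, with ratios [q] and [q^m]. Splitting [q^(km+j)] and
    [q^(mk)] from the constants separates the part depending on [k]. *)
Lemma sym_s_tilde m j k : (0 < m)%N ->
  sym tower (s * s_tilde m a j k)
    (fun u => Cst m u + Var m j u * expR (- (k%:R * (m%:R * u)))).
Proof.
move=> m0; rewrite /s_tilde /s_bracket0 addnK mulnK// mulrBr mulr_sumr.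
rewrite mulrCA mulr_sumr.
have H2 := sym_sum (index_iota 0 k.+1) (fun i => sym_sa (m * i)%N).
have -> : (m%:R : R[i]) = (m%:R : R)%:C by rewrite rmorph_nat.
apply: eq_sym_symbol (symB (sym_sum (index_iota 0 (k * m + j).+1) sym_sa) (symZ m%:R H2)) => u u0.
(* The index 0 drops out of both sums because [a 0 = 0]. *)
rewrite !big_mkord !big_ord_recl/= muln0 !add0r.
have -> : \sum_(i < k) sa (m * bump 0 i)%N u =
    - u * expR (- (t0 * u)) * (q u ^+ m.-1 * ((1 - (q u ^+ m) ^+ k) / (1 - q u ^+ m))).
  rewrite -geom_sum ?lt_eqF ?qX_lt1// !mulr_sumr; apply: eq_bigr => i _.
  rewrite /bump/= add1n mulnS; case: m m0 {H2} => // m _.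
  by rewrite addSn /sa /= exprD exprM -[RHS]mulrA.
have -> : \sum_(i < k * m + j) sa (bump 0 i) u =
    - u * expR (- (t0 * u)) * ((1 - q u ^+ (k * m + j)) / (1 - q u)).
  rewrite -geom_sum ?lt_eqF ?q_lt1// mulr_sumr; apply: eq_bigr => i _.
  by rewrite /bump leq0n add1n -[RHS]mulrA.
have -> : expR (- (k%:R * (m%:R * u))) = q u ^+ (m * k) by rewrite mulrA -natrM qX mulnC.
rewrite -exprM exprD [(k * m)%N]mulnC /Cst /Var.
have : 1 - q u != 0 by rewrite subr_eq0 gt_eqF ?q_lt1.
have : 1 - q u ^+ m != 0 by rewrite subr_eq0 gt_eqF ?qX_lt1.
move: (q u ^+ m.-1) (q u ^+ m) (q u) (q u ^+ (m * k)) (q u ^+ j) (expR _).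
move=> x1 x2 x3 x4 x5 x6 h1 h2.
by field; rewrite h1 h2.
Qed.

(** The factor [u] compensates the simple zeros of [1 - q] and [1 - q^m] by [div_z_le]; half of the
    decay [e^(-t0 u)] absorbs the linear growth that remains. *)
Lemma Var_le m j (u : R) : (0 < m)%N -> 0 < u ->
  `|Var m j u| <= (2 + (1 + m%:R) * (t0 / 2)^-1) * expR (- (t0 / 2 * u)).
Proof.
move=> m0 u0; have mu0 : 0 < m%:R * u by rewrite mulr_gt0// ltr0n.
have z1 : 0 < 1 - q u by rewrite subr_gt0 q_lt1.
have z2 : 0 < 1 - q u ^+ m by rewrite subr_gt0 qX_lt1.
have d1 := div_z_le u0; have d2 := div_z_le mu0; rewrite qX in d2.
have q1 n : `|q u ^+ n| <= 1.
  by rewrite ger0_norm ?exprn_ge0 ?expR_ge0// exprn_ile1 ?expR_ge0// ltW// q_lt1.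
have -> : Var m j u = expR (- (t0 * u)) *
    (q u ^+ j * (u / (1 - q u)) - q u ^+ m.-1 * (m%:R * u / (1 - q u ^+ m))).
  by rewrite /Var; ring.
rewrite normrM (ger0_norm (expR_ge0 _)).
have b : `|q u ^+ j * (u / (1 - q u)) - q u ^+ m.-1 * (m%:R * u / (1 - q u ^+ m))| <=
    (1 + u) + (1 + m%:R * u).
  rewrite (le_trans (ler_normB _ _))// lerD// normrM -[leRHS]mul1r ler_pM//.
    by rewrite ger0_norm// divr_ge0 ?ltW.
  by rewrite ger0_norm// divr_ge0 ?ltW.
rewrite (le_trans (ler_wpM2l (expR_ge0 _) b))//.
have -> : expR (- (t0 * u)) * (1 + u + (1 + m%:R * u)) =
  2 * expR (- (t0 * u)) + (1 + m%:R) * (u * expR (- (t0 * u))) by ring.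
rewrite [leRHS]mulrDl lerD//.
  rewrite ler_wpM2l// ler_expR lerN2 ler_pM2r//.
  by rewrite ler_pdivrMr// ler_peMr ?ler1n// ltW.
by rewrite -[leRHS]mulrA ler_wpM2l ?u_expR_le// addr_ge0.
Qed.

Lemma tends_shift_s_tilde m j h k : (0 < m)%N -> 0 <= h <= 1 ->
  tends tower (fun K => s * series (shift_term h (s_tilde m a j) k) K.+1)
    (fun u => Cst m u + Var m j u * expR (- (k%:R * (m%:R * u))) *
                        expR (- (h * (m%:R * u)))).
Proof.
move=> m0 h01; apply: (@tends_shift R tower (s_tilde m a j) s (Cst m) (Var m j) m%:R h
  (2 + (1 + m%:R) * (t0 / 2)^-1) (t0 / 2)) => //.
- by rewrite ltr0n.
- by rewrite addr_ge0// mulr_ge0 ?addr_ge0// invr_ge0 divr_ge0// ltW.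
- by rewrite divr_gt0.
- by move=> u u0; exact: Var_le.
- by move=> k'; exact: sym_s_tilde.
Qed.

Lemma frac01 i m : (i < m)%N -> 0 <= (i%:R / m%:R : R) <= 1.
Proof.
move=> im; rewrite divr_ge0//= ler_pdivrMr ?mul1r ?ler_nat ?(ltnW im)//.
by rewrite ltr0n (leq_ltn_trans _ im).
Qed.

Lemma shift_exists_s_tilde m j k i : (i < m)%N ->
  shift_exists (i%:R / m%:R) (s_tilde m a j) k.
Proof.
move=> im; have m0 : (0 < m)%N by exact: leq_ltn_trans im.
apply: (cvg_seriesZ hs); apply: tower_tends_cvg.
exact: (tends_shift_s_tilde _ _ m0 (frac01 im)).
Qed.

Lemma opB_exists_f : opB_exists (f s) t0.
Proof.
by apply: (cvg_seriesZ (oner_neq0 _)); apply: tower_tends_cvg; exact: tends_opB_f.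
Qed.

Lemma t1_gt0 m : (0 < m)%N -> 0 < (t0 - 1) / m%:R + 1.
Proof.
move=> m0; have m0' : 0 < m%:R :> R by rewrite ltr0n.
rewrite -[X in _ + X](divff (lt0r_neq0 m0')) -mulrDl divr_gt0//.
have : 1 <= m%:R :> R by rewrite ler1n.
by have := ht0; lra.
Qed.

Lemma opB_exists_dilate m : (0 < m)%N ->
  opB_exists (fpow_dilate m f s) ((t0 - 1) / m%:R + 1).
Proof.
move=> m0; apply: (@cvg_seriesZ (cpow m%:R s)); first exact: cexp_neq0.
apply: tower_tends_cvg; apply: tends_opB_dilate => //; exact: t1_gt0.
Qed.

(** After multiplication by [q^(n-j)] the first terms all equal [q^n / (1 - q)], while the second
    ones contain [q^n q^(m-1-j)], whose geometric sum [q^n (1 - q^m) / (1 - q)] cancels the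
    denominator [1 - q^m]. The weight [m] of the sub-series makes the two totals equal. *)
Lemma sum_Var m n (u : R) : (0 < m)%N -> (m <= n)%N -> 0 < u ->
  \sum_(j < m) Var m j u * q u ^+ (n - j) = 0.
Proof.
move=> m0 mn u0.
have z1 : 1 - q u != 0 by rewrite subr_eq0 gt_eqF ?q_lt1.
have z2 : 1 - q u ^+ m != 0 by rewrite subr_eq0 gt_eqF ?qX_lt1.
pose A := u * expR (- (t0 * u)) * q u ^+ n.
transitivity (\sum_(j < m) (A / (1 - q u) - A * m%:R / (1 - q u ^+ m) * q u ^+ (m - j.+1)%N)).
  apply: eq_bigr => j _; rewrite /Var /A.
  have jn : (j <= n)%N by exact: leq_trans (ltnW (ltn_ord j)) mn.
  have e1 : q u ^+ n = q u ^+ j * q u ^+ (n - j) by rewrite -exprD subnKC.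
  have jm : (j <= m.-1)%N by rewrite -ltnS prednK.
  have e2 : q u ^+ m.-1 = q u ^+ j * q u ^+ (m - j.+1).
    by rewrite -exprD -add1n subnDA subn1 subnKC.
  rewrite e1 e2.
  by move: (q u ^+ j) (q u ^+ (n - j)) (q u ^+ (m - j.+1)) => x1 x2 x3; ring.
rewrite big_split/= sumr_const card_ord -mulr_natr sumrN -mulr_sumr.
have -> : \sum_(j < m) q u ^+ (m - j.+1)%N = \sum_(j < m) q u ^+ j.
  by rewrite [RHS](reindex_inj rev_ord_inj).
rewrite geom_sum ?lt_eqF ?q_lt1//.
by field; rewrite z1 z2.
Qed.

(** The partial sums of all series in the identity are combined into one sequence [W]. Its limit
    symbol is 0, so [W] tends to 0, while termwise it tends to [s * X_ m a n] plus the bracket. The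
    bound [m <= n] keeps every [s_bracket] off its default value. *)
Lemma X_eventually m n : (0 < m)%N -> (m <= n)%N ->
  X_ m a n = - (1 / s) * (opB (f s) t0 -
    cpow m%:R s * opB (fpow_dilate m f s) ((t0 - 1) / m%:R + 1)).
Proof.
move=> m0 mn; set t1 := (t0 - 1) / m%:R + 1.
have t10 : 0 < t1 := t1_gt0 m0.
pose h j : R := ((n - j) %% m)%N%:R / m%:R.
have h01 j : 0 <= h j <= 1 by apply: frac01; rewrite ltn_mod.
pose v j K := s * series (shift_term (h j) (s_tilde m a j) ((n - j) %/ m)%N) K.+1.
have vT (j : 'I_m) : tends tower (v j)
    (fun u => Cst m u + Var m j u * q u ^+ (n - j)).
  (* Quotient and remainder of [n - j] modulo [m] recombine: the integer shift and the fractional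
     shift together give [q^(n-j)]. *)
  apply: eq_tends (tends_shift_s_tilde j ((n - j) %/ m)%N m0 (h01 j)) => u _.
  rewrite -mulrA -expRD -qX; congr (_ + _ * expR _).
  have m0' : m%:R != 0 :> R by rewrite pnatr_eq0 -lt0n.
  rewrite [in RHS](divn_eq (n - j) m) natrD natrM /h.
  by field.
have vC (j : 'I_m) : v j K @[K --> \oo] --> s * s_bracket m a j n.
  have jn : (n < j)%N = false.
    by apply/negbTE; rewrite -leqNgt (leq_trans (ltnW (ltn_ord j)) mn).
  rewrite /s_bracket jn /shift; apply: (@cvgM R[i]); first exact: cvg_cst.
  have := @shift_exists_s_tilde m j ((n - j) %/ m)%N ((n - j) %% m)%N.
  by rewrite ltn_mod => /(_ m0) H; rewrite (cvg_shiftS (series _)).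
pose W K := (m%:R^-1)%:C * (\sum_(j < m) v j K) +
  (1 * series (opB_term (f s) t0) K.+1 +
   (-1)%:C * (cpow m%:R s * series (opB_term (fpow_dilate m f s) t1) K.+1)).
have WT := tendsD (tendsZ m%:R^-1 (tends_sum (index_enum 'I_m) (P := xpredT)
    (fun j _ => vT j)))
  (tendsD (tends_opB_f ht0) (tendsZ (-1) (tends_opB_dilate m0 t10))).
have W0 : W K @[K --> \oo] --> (0 : R[i]).
  apply: tower_tends_cvg0 WT => u u0 /=.
  have z1 : 1 - q u != 0 by rewrite subr_eq0 gt_eqF ?q_lt1.
  have z2 : 1 - q u ^+ m != 0 by rewrite subr_eq0 gt_eqF ?qX_lt1.
  have m0' : m%:R != 0 :> R by rewrite pnatr_eq0 -lt0n.
  rewrite big_split/= sum_Var// addr0 sumr_const card_ord.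
  rewrite -[Cst m u *+ m]mulr_natl mulKf//.
  rewrite qX.
  (* Since [m * t1 = t0 + m - 1], the symbol of the dilated term acquires the same factor [q^(m-1)]
     as the sub-series part of [Cst]. *)
  have -> : expR (- (m%:R * t1 * u)) = expR (- (t0 * u)) * q u ^+ m.-1.
    rewrite -qX -expRD; congr expR; rewrite -subn1 natrB// /t1.
    by field.
  rewrite /Cst; move: (expR (- (t0 * u))) (q u ^+ m.-1) (q u ^+ m) (q u) z1 z2 => x1 x2 x3 x4 z1 z2.
  by field; rewrite z1 z2.
have WL : W K @[K --> \oo] --> s * X_ m a n +
    (opB (f s) t0 - cpow m%:R s * opB (fpow_dilate m f s) t1).
  have -> : s * X_ m a n + (opB (f s) t0 - cpow m%:R s * opB (fpow_dilate m f s) t1) =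
    (m%:R^-1)%:C * (\sum_(j < m) s * s_bracket m a j n) +
    (1 * opB (f s) t0 + (-1)%:C * (cpow m%:R s * opB (fpow_dilate m f s) t1)).
    rewrite /X_ big_mkord -mulr_sumr mulrCA fmorphV rmorph_nat mul1r.
    by rewrite rmorphN1 mulN1r.
  apply: cvgD.
    apply: (@cvgM R[i]); first exact: cvg_cst.
    by apply: cvg_big => [|j _]; [exact: add_continuous|exact: vC].
  apply: cvgD; apply: (@cvgM R[i]); try exact: cvg_cst.
    by rewrite (cvg_shiftS (series _)); exact: opB_exists_f.
  apply: (@cvgM R[i]); first exact: cvg_cst.
  by rewrite (cvg_shiftS (series _)); exact: opB_exists_dilate.
have E : s * X_ m a n + (opB (f s) t0 - cpow m%:R s * opB (fpow_dilate m f s) t1) = 0.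
  exact: (cvg_unique _ WL W0).
apply: (mulfI hs).
have -> (D : R[i]) : s * (- (1 / s) * D) = - D by field.
by apply/eqP; rewrite -addr_eq0 E.
Qed.

End Assembly.

Theorem theorem5p1 (R : realType)
    (P : {content set nat -> \bar R})
    (hP1 : P [set: nat] = 1%E)
    (hPinv : translation_invariant P)
    (f : R[i] -> R -> R[i]) (hf : calH f)
    (phi : R -> R[i]) (hphi : laplace_dom phi)
    (hfphi : forall t : R, 0 < t -> f (-1) t = laplace phi t)
    (gamma : R[i]) (hgamma : -1 < complex.Re gamma)
    (ho : phi =o_ (0^'+) (fun u : R => cpow u gamma))
    (t0 : R) (ht0 : 0 < t0)
    (s : R[i]) (hs : s != 0)
    (a : nat -> R[i]) (ha0 : a 0%N = 0)
    (ha : forall n : nat, (1 <= n)%N -> a n = f (s - 1) (t0 + n%:R - 1)) :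
  weakly_renormalizable P a /\
  forall m : nat, (1 <= m)%N ->
    [/\ opB_exists (f s) t0,
        opB_exists (fpow_dilate m f s) ((t0 - 1) / m%:R + 1) &
        expectC P (X_ m a) =
          - (1 / s) * (opB (f s) t0 -
            cpow m%:R s * opB (fpow_dilate m f s) ((t0 - 1) / m%:R + 1))].
Proof.
have XR m (m0 : (0 < m)%N) := integral_eventually_cst hP1 hPinv (m := m)
  (fun n mn => congr1 (@complex.Re R) (X_eventually hf ht0 hs ha0 ha m0 mn)).
have XI m (m0 : (0 < m)%N) := integral_eventually_cst hP1 hPinv (m := m)
  (fun n mn => congr1 (@complex.Im R) (X_eventually hf ht0 hs ha0 ha m0 mn)).
split=> m m0.
  split; first by move=> j k i _; exact: (shift_exists_s_tilde hf ht0 hs ha0 ha).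
  by split; [have [] := XR m m0|have [] := XI m m0].
split; [by apply: opB_exists_f|by apply: opB_exists_dilate|].
have [_ ER] := XR m m0; have [_ EI] := XI m m0.
by rewrite /expectC /integralC ER EI; apply: complex_eqP.
Qed.
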